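(* Let $N\ge 1$, $\Lambda>1$, and let $(u,v)\in L^3_{loc}(\mathbb{R}^N)\times L^3_{loc}(\mathbb{R}^N)$ be a distributional solution of $$\begin{cases}-\Delta u=u-u^3-\Lambda uv^2 & \text{in }\mathbb{R}^N\\ -\Delta v=v-v^3-\Lambda u^2v & \text{in }\mathbb{R}^N\\ u,v\ge 0 & \text{in }\mathbb{R}^N,\end{cases}$$ satisfying $$u(x',x_N)\to 1,\quad v(x',x_N)\to 0\quad\text{as }x_N\to+\infty,\qquad u(x',x_N)\to 0,\quad v(x',x_N)\to 1\quad\text{as }x_N\to-\infty,$$ uniformly with respect to $x'\in\mathbb{R}^{N-1}$. Then $(u,v)$ is smooth, depends only on $x_N$, and $$\partial_N u>0,\qquad \partial_N v<0\qquad\text{in }\mathbb{R}^N.$$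
   Context: Points of $\mathbb{R}^N$ are written $x=(x',x_N)\in\mathbb{R}^{N-1}\times\mathbb{R}$, and $\partial_N$ denotes the partial derivative with respect to $x_N$. Functions in $L^3_{loc}$ are identified when equal almost everywhere; ''smooth'' means that there is a smooth representative, and pointwise statements refer to it. *)

(* Defs.v *)
From HB Require Import structures.
From mathcomp Require Import all_boot all_order all_algebra.
From mathcomp Require Import all_classical all_reals all_analysis.
From mathcomp Require Import measurable_realfun.

Set Implicit Arguments.
Unset Strict Implicit.
Unset Printing Implicit Defensive.

Import Order.TTheory GRing.Theory Num.Theory.
Import numFieldNormedType.Exports.

Local Open Scope classical_set_scope.
Local Open Scope ring_scope.

(* R^n is 'rV[R]_n. Its sigma-algebra is generated by the coordinate maps,    *)
(* as the library does for n.-tuple T; by open_measurable_rV below it         *)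
(* contains the open sets, so it is the Borel sigma-algebra.                  *)
Section measurable_rV.
Context {R : realType}.
Variable n : nat.

Let coors (i : 'I_n) (x : 'rV[R]_n) : R := x ord0 i.

Let rV_set0 : g_sigma_preimage coors set0.
Proof. exact: sigma_algebra0. Qed.

Let rV_setC A : g_sigma_preimage coors A -> g_sigma_preimage coors (~` A).
Proof. exact: sigma_algebraC. Qed.

Let rV_bigcup (F : _^nat) : (forall i, g_sigma_preimage coors (F i)) ->
  g_sigma_preimage coors (\bigcup_i (F i)).
Proof. exact: sigma_algebra_bigcup. Qed.

HB.instance Definition _ :=
  @isMeasurable.Build (measure_tuple_display default_measure_display)
  'rV[R]_n (g_sigma_preimage coors) rV_set0 rV_setC rV_bigcup.

End measurable_rV.

Section measurable_rV_theory.
Context {R : realType}.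

Lemma measurable_coord n (i : 'I_n) :
  measurable_fun [set: 'rV[R]_n] (fun x : 'rV[R]_n => x ord0 i).
Proof.
move=> _ Y mY; rewrite setTI; apply: sub_sigma_algebra => /=.
rewrite -bigcup_seq/=; exists i => /=; first by rewrite mem_index_enum.
by exists Y => //; rewrite setTI.
Qed.

Lemma measurable_fun_rVP d (T : measurableType d) n (f : T -> 'rV[R]_n) :
  (forall i, measurable_fun [set: T] (fun t => f t ord0 i)) ->
  measurable_fun [set: T] f.
Proof.
move=> mf _ A mA; rewrite setTI.
have : g_sigma_preimage (fun i t => f t ord0 i : R) `<=` (@measurable _ T).
  apply: smallest_sub; first exact: sigma_algebra_measurable.
  rewrite -bigcup_seq; apply: bigcup_sub => i _ B [C mC <-].
  exact: mf.
apply.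
have := @g_sigma_preimage_comp _ R n _ (fun i (x : 'rV[R]_n) => x ord0 i) _ f.
by move=> ->; exists A => //; rewrite setTI.
Qed.

Lemma measurable_box n (A : 'I_n -> set R) :
  (forall i, measurable (A i)) ->
  measurable [set x : 'rV[R]_n | forall i, A i (x ord0 i)].
Proof.
move=> mA.
rewrite (_ : mkset _ =
    \big[setI/setT]_(i < n) ((fun x : 'rV[R]_n => x ord0 i) @^-1` A i)).
  apply: bigsetI_measurable => i _; rewrite -[X in measurable X]setTI.
  exact: measurable_coord.
rewrite -bigcap_seq; apply/seteqP; split => x /= xA i.
- by move=> _; exact: xA.
- by apply: xA; rewrite /= mem_index_enum.
Qed.

Lemma open_measurable_rV n (U : set 'rV[R]_n) : open U -> measurable U.
Proof.
move=> oU.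
pose q (p : 'rV[rat]_n * nat) : 'rV[R]_n := map_mx ratr p.1.
pose r (p : 'rV[rat]_n * nat) : R := p.2.+1%:R^-1.
pose D := [set p | ball (q p) (r p) `<=` U].
have -> : U = \bigcup_(p in D) ball (q p) (r p).
  apply/seteqP; split=> [x Ux|x [p Dp]]; last exact: Dp.
  have /nbhs_ballP[e /= e0 xeU] := open_nbhs_nbhs (conj oU Ux).
  have e20 : 0 < e / 2 by rewrite divr_gt0.
  pose k := Num.truncn (e / 2)^-1.
  have ke : k.+1%:R^-1 < e / 2 :> R.
    by rewrite invf_plt ?posrE// truncnS_gt.
  have qx i : exists c : rat, x ord0 i < ratr c < x ord0 i + k.+1%:R^-1.
    have [|c] := @rat_in_itvoo R (x ord0 i) (x ord0 i + k.+1%:R^-1).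
      by rewrite ltrDl invr_gt0.
    by rewrite in_itv/= => ?; exists c.
  have [c cP] := choice qx.
  have xq : ball (q (\row_i c i, k)) (r (\row_i c i, k)) x.
    split=> [|i j]; first by rewrite invr_gt0.
    rewrite ord1 /q /r /= !mxE.
    have /andP[c1 c2] := cP j.
    rewrite /ball/= gtr0_norm ?subr_gt0//.
    by rewrite ltrBlDl.
  exists (\row_i c i, k) => // y qy; apply: xeU.
  have : ball x (r (\row_i c i, k) + r (\row_i c i, k)) y.
    by apply: ball_triangle qy; exact: ball_sym.
  apply: le_ball; rewrite /r /= [leRHS]splitr lerD// ltW//.
rewrite bigcup_mkcond; apply: countable_bigcupT_measurable => // p.
case: ifPn => // _.
rewrite (_ : ball _ _ = [set x : 'rV[R]_n | forall i, ball (q p ord0 i) (r p)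
    (x ord0 i)]); first by apply: (@measurable_box _ (fun i =>
    ball (q p ord0 i) (r p))) => i; apply: open_measurable; exact: ball_open.
apply/seteqP; split=> [x [_ xq] i|x xq]; first exact: xq.
by split=> [|i j]; [rewrite /r invr_gt0|rewrite ord1; exact: xq].
Qed.

(* (x', t) |-> (x'_0, ..., x'_(n-1), t), identifying R^n x R with R^(n+1).    *)
Definition rcons_rV n (p : 'rV[R]_n * R) : 'rV[R]_n.+1 :=
  \row_i (if unlift ord_max i is Some j then p.1 ord0 j else p.2).

Lemma measurable_rcons_rV n : measurable_fun [set: 'rV[R]_n * R] (@rcons_rV n).
Proof.
apply: measurable_fun_rVP => i.
under eq_fun do rewrite mxE.
case: (unlift ord_max i) => [j|]; last exact: measurable_snd.
exact: (measurableT_comp (measurable_coord j) measurable_fst).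
Qed.

(* Lebesgue measure on R^n: the n-fold product of lebesgue_measure.           *)
Fixpoint lebesgue_measure_rV n : set 'rV[R]_n -> \bar R :=
  if n is m.+1
  then pushforward (@lebesgue_measure_rV m \x lebesgue_measure)%E (@rcons_rV m)
  else \d_ (0 : 'rV[R]_0).

Let lebesgue_measure_rV_measure n :
  exists mu : {measure set 'rV[R]_n -> \bar R},
    mu = @lebesgue_measure_rV n :> (set _ -> \bar R).
Proof.
elim: n => [|n [mu muE]]; first by exists (\d_ (0 : 'rV[R]_0)).
rewrite /= -muE.
by exists (measure_function_pushforward__canonical__measure_function_Measure
  (mu \x lebesgue_measure)%E (measurable_rcons_rV (n := n))).
Qed.

Let lebesgue_measure_rV0 n : @lebesgue_measure_rV n set0 = 0%E.
Proof. by have [mu <-] := lebesgue_measure_rV_measure n; exact: measure0. Qed.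

Let lebesgue_measure_rV_ge0 n A : (0 <= @lebesgue_measure_rV n A)%E.
Proof. by have [mu <-] := lebesgue_measure_rV_measure n. Qed.

Let lebesgue_measure_rV_sigma_additive n :
  semi_sigma_additive (@lebesgue_measure_rV n).
Proof.
by have [mu <-] := lebesgue_measure_rV_measure n; exact: measure_semi_sigma_additive.
Qed.

HB.instance Definition _ n := isMeasure.Build _ _ _ (@lebesgue_measure_rV n)
  (lebesgue_measure_rV0 n) (@lebesgue_measure_rV_ge0 n)
  (@lebesgue_measure_rV_sigma_additive n).

Lemma lebesgue_measure_rV_box n (A : 'I_n -> set R) :
  (forall i, measurable (A i)) ->
  lebesgue_measure_rV [set x : 'rV[R]_n | forall i, A i (x ord0 i)] =
  (\prod_(i < n) lebesgue_measure (A i))%E.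
Proof.
elim: n A => [|n IHn] A mA.
  by rewrite big_ord0 /= diracE mem_set// => -[].
rewrite big_ord_recr /= -(IHn (fun i => A (widen_ord (leqnSn n) i)))//.
have mB : measurable
    [set x : 'rV[R]_n | forall i, A (widen_ord (leqnSn n) i) (x ord0 i)].
  exact: (@measurable_box _ (fun i => A (widen_ord (leqnSn n) i))).
have /= <- := @product_measure1E _ _ _ _ _ (@lebesgue_measure_rV n)
  lebesgue_measure _ _ mB (mA ord_max).
rewrite /pushforward.
congr (_ _); apply/seteqP; split => -[x t] /=.
- move=> xA; split => [i|].
  + have := xA (lift ord_max i); rewrite mxE liftK.
    congr (A _ _); apply/val_inj; exact: lift_max.
  + by have := xA ord_max; rewrite mxE unlift_none.
- move=> [xA tA] i; rewrite mxE; case: unliftP => [j|] -> //.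
  have := xA j; congr (A _ _); apply/val_inj; exact/esym/lift_max.
Qed.

End measurable_rV_theory.
Arguments lebesgue_measure_rV {R n}.

Section pde_notions.
Context {R : realType} {n : nat}.
Implicit Types (f u v phi : 'rV[R]_n -> R).

Definition partial (i : 'I_n) f : 'rV[R]_n -> R := 'D_(delta_mx 0 i) f.

Definition laplacian f (x : 'rV[R]_n) : R :=
  \sum_(i < n) partial i (partial i f) x.

(* C^oo: iterated partial derivatives of all orders exist and are continuous. *)
Definition smooth f : Prop :=
  forall s : seq 'I_n,
    continuous (foldr partial f s) /\
    forall (i : 'I_n) (x : 'rV[R]_n),
      derivable (foldr partial f s) x (delta_mx 0 i).

Definition test_function phi : Prop :=
  smooth phi /\ compact (closure [set x | phi x != 0]).

(* The elements of L^p_loc are represented by Borel functions; every          *)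
(* Lebesgue-measurable function agrees almost everywhere with one of these.   *)
Definition Lloc (p : nat) u : Prop :=
  measurable_fun [set: 'rV[R]_n] u /\
  forall K : set 'rV[R]_n, compact K ->
    (\int[lebesgue_measure_rV]_(x in K) (`|u x| ^+ p)%:E < +oo)%E.

(* - Delta u = g in the sense of distributions.                               *)
Definition distributional_poisson u (g : 'rV[R]_n -> R) : Prop :=
  forall phi, test_function phi ->
    \int[lebesgue_measure_rV]_x (u x * - laplacian phi x) =
    \int[lebesgue_measure_rV]_x (g x * phi x).

End pde_notions.

Section last_coordinate.
Context {R : realType} {n : nat}.
Implicit Types (u : 'rV[R]_n.+1 -> R) (l : R).

Definition last_coord (x : 'rV[R]_n.+1) : R := x ord0 ord_max.

(* u(x', x_N) -> l as x_N -> +oo (resp. -oo), uniformly in x', for the class  *)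
(* of u modulo equality almost everywhere.                                    *)
Definition unif_cvg_pinfty u l : Prop :=
  forall e : R, 0 < e -> \forall M \near +oo,
    \forall x \ae lebesgue_measure_rV, M < last_coord x -> `|u x - l| < e.

Definition unif_cvg_ninfty u l : Prop :=
  forall e : R, 0 < e -> \forall M \near -oo,
    \forall x \ae lebesgue_measure_rV, last_coord x < M -> `|u x - l| < e.

Definition depends_only_on_last u : Prop :=
  forall x y, last_coord x = last_coord y -> u x = u y.

End last_coordinate.

(* Main.v *)
Require Import Defs.
From HB Require Import structures.
From mathcomp Require Import all_boot all_order all_algebra.
From mathcomp Require Import all_classical all_reals all_analysis.
From mathcomp Require Import measurable_realfun.
From mathcomp Require Import ring lra.

Set Implicit Arguments.
Unset Strict Implicit.
Unset Printing Implicit Defensive.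

Import Order.TTheory GRing.Theory Num.Theory.
Import numFieldNormedType.Exports.
Import HBSimple.

Local Open Scope classical_set_scope.
Local Open Scope ring_scope.

(** A mollification [w = rho * u] satisfies [w ^+ 3 - w <= Laplacian w] by
    Jensen's inequality, so the Keller-Osserman barrier yields [w <= 1] for every mollifier, hence
    [u <= 1] almost everywhere, and likewise [v <= 1]. The right-hand sides are
    then bounded, so the mollifications are Lipschitz uniformly in the mollifier
    (barrier for the odd reflection across a hyperplane), and [u], [v] have
    Lipschitz representatives [U], [V] which are uniform limits of functions
    with uniformly convergent Laplacians. For such functions the maximum
    principle holds in unbounded domains in a penalized form, and no elliptic
    regularity theory is needed.

    The system is cooperative in [(U, 1 - V)], and linearly stable near both
    limit states since [Lambda > 1]. The sliding method compares [(U, V)] with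
    its translate by [nu]: for every [nu] with [nu_N > 0] the translate lies
    above. Letting [nu] tend to horizontal vectors gives the dependence on [x_N]
    only. The profiles then solve an ODE system, which gives smoothness, and a
    nonnegative derivative vanishing at a point would vanish identically. *)

(** Two compactness devices of the classical argument are replaced by explicit estimates. A supremum
    over the whole space need not be attained: maximizing after subtraction of a small multiple of
    the squared distance yields a point where everything holds up to an error [e]. Such errors are
    harmless because near the two limit states the linearized system damps at a definite rate, so
    that every contradiction leaves a margin proportional to the assumed violation. Limits of
    translates are replaced by lower bounds that do not depend on the point: where [|x_N| <= M], the
    increment produced by a slide is bounded below uniformly for slides in a compact range, hence
    the slide can be shortened by a fixed amount, finitely many times. Laplacians are limits of
    second differences. These have a sign at a maximum, commute with translations and reflections,
    and pass under a convolution integral by dominated convergence, which is all that the comparison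
    arguments use. *)

Section one_variable.
Context {R : realType}.

Lemma continuous_is_derive (f f1 : R -> R) :
  (forall x : R, is_derive x 1 f (f1 x)) -> continuous f.
Proof.
move=> df x; apply: differentiable_continuous; apply/derivable1_diffP.
by have [] := df x.
Qed.

Lemma is_derive_comp_affine (f f1 : R -> R) (a b : R) :
  (forall x : R, is_derive x 1 f (f1 x)) ->
  forall t : R, is_derive t 1 (fun t => f (a * t + b)) (a * f1 (a * t + b)).
Proof.
move=> df t; rewrite mulrC.
have da : is_derive t 1 (fun t => a * t + b) a.
  by apply: is_derive_eq; rewrite addr0 /GRing.scale/= mulr1.
exact: is_derive1_comp.
Qed.

(* Rolle's theorem for [t |-> f (s + t) + f (s - t) - c * t ^+ 2], where [c]
   is chosen to make the values at [0] and [h] agree. *)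
Lemma second_difference_mvt (f f1 f2 : R -> R) (s h : R) :
  (forall x : R, is_derive x 1 f (f1 x)) -> (forall x : R, is_derive x 1 f1 (f2 x)) ->
  0 < h -> exists2 z, `|z - s| < h &
    f (s + h) + f (s - h) - 2 * f s = f2 z * h ^+ 2.
Proof.
move=> df df1 h0.
set D := f (s + h) + f (s - h) - 2 * f s.
pose c := D / h ^+ 2.
pose k t := f (1 * t + s) + f (- 1 * t + s) - c * t ^+ 2.
pose k1 t := f1 (1 * t + s) - f1 (- 1 * t + s) - c * (2 * t).
have dk (t : R) : is_derive t 1 k (k1 t).
  have dp := is_derive_comp_affine 1 s df t.
  have dm := is_derive_comp_affine (-1) s df t.
  apply: is_derive_eq; rewrite /k1 /GRing.scale/= /GRing.scale/=; ring.
have [|||] := @Rolle R k 0 h h0.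
- by move=> x _; have [] := dk x.
- by apply: continuous_subspaceT; exact: continuous_is_derive dk.
- rewrite /k /c !mulr0 !add0r expr0n /= mulr0 subr0 mul1r mulN1r.
  by rewrite divfK ?sqrf_eq0 ?gt_eqF// /D [h + s]addrC [- h + s]addrC; ring.
move=> t; rewrite in_itv/= => /andP[t0 th] [_ dk0].
have {}dk0 : f1 (1 * t + s) - f1 (- 1 * t + s) = c * (2 * t).
  have [_] := dk t; rewrite dk0 /k1 => e0.
  by apply/eqP; rewrite -subr_eq0 -e0.
have lt : -1 * t + s < 1 * t + s by lra.
have [|z] := @MVT R f1 f2 _ _ lt (fun x _ => df1 x).
  by apply: continuous_subspaceT; exact: continuous_is_derive df1.
rewrite in_itv/= => /andP[z1 z2]; rewrite dk0 => E.
exists z; first by rewrite ltr_norml; lra.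
have t2 : 2 * t != 0 by rewrite mulf_neq0// gt_eqF.
have cz : c = f2 z.
  by apply: (mulIf t2); rewrite E; congr (_ * _); ring.
by rewrite -cz /c divfK// sqrf_eq0 gt_eqF.
Qed.

(** One sequence serves twice, as increments of the second differences and as radii of the
    mollifiers. It starts at 1, so that all of them are at most 1. *)
Definition step (m : nat) : R := m.+1%:R^-1.

Lemma step_gt0 m : 0 < step m. Proof. by rewrite invr_gt0. Qed.

Lemma step_le1 m : step m <= 1.
Proof. by rewrite invf_le1 ?ler1n ?ltr0n. Qed.

Lemma cvg_step : step @ \oo --> (0 : R).
Proof. exact: cvg_harmonic. Qed.

Lemma cvg_second_difference (f f1 f2 : R -> R) (s : R) :
  (forall x : R, is_derive x 1 f (f1 x)) -> (forall x : R, is_derive x 1 f1 (f2 x)) ->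
  {for s, continuous f2} ->
  (f (s + step m) + f (s - step m) - 2 * f s) / step m ^+ 2 @[m --> \oo] -->
  f2 s.
Proof.
move=> df df1 cf2; apply/cvgrPdist_lt => e e0.
have /cvgrPdist_lt/(_ e e0)/nbhs_ballP[d /= d0 dP] := cf2.
near=> m; have [z zs ->] := second_difference_mvt s df df1 (step_gt0 m).
rewrite mulfK ?sqrf_eq0 ?gt_eqF ?step_gt0//; apply: dP => /=.
rewrite /ball/= distrC (lt_trans zs)//; near: m.
have /cvgrPdist_lt/(_ d d0) := cvg_step.
by apply: filterS => k; rewrite sub0r normrN gtr0_norm// step_gt0.
Unshelve. all: by end_near. Qed.

End one_variable.

Section real_valued_continuity.
Context {R : realType} {T : topologicalType}.
Implicit Types f g : T -> R.

Lemma continuous_add f g : continuous f -> continuous g ->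
  continuous (fun x => f x + g x).
Proof. by move=> cf cg x; exact: (cvgD (cf x) (cg x)). Qed.

Lemma continuous_sub f g : continuous f -> continuous g ->
  continuous (fun x => f x - g x).
Proof. by move=> cf cg x; exact: (cvgB (cf x) (cg x)). Qed.

Lemma continuous_mul f g : continuous f -> continuous g ->
  continuous (fun x => f x * g x).
Proof. by move=> cf cg x; exact: (cvgM (cf x) (cg x)). Qed.

Lemma continuous_scale (c : R) f : continuous f -> continuous (fun x => c * f x).
Proof. by move=> cf x; exact: (cvgM (cvg_cst c) (cf x)). Qed.

Lemma continuous_maxr f g : continuous f -> continuous g ->
  continuous (fun x => Num.max (f x) (g x)).
Proof. by move=> cf cg x; exact: (continuous_max (cf x) (cg x)). Qed.

Lemma continuous_compose f (g : R -> R) : continuous f -> continuous g ->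
  continuous (fun x => g (f x)).
Proof. by move=> cf cg x; apply: continuous_comp; [exact: cf|exact: cg]. Qed.

End real_valued_continuity.

Lemma continuous_idr {R : realType} : continuous (fun t : R => t).
Proof. by move=> t; exact: cvg_id. Qed.

(** * Discrete Laplacian *)

Section discrete_laplacian.
Context {R : realType} {n : nat}.
Local Notation X := 'rV[R]_n.
Implicit Types (w : X -> R) (x y : X) (l h : R).

Let cvg_sum_ord T (F : set_system T) (f : 'I_n -> T -> R) (a : 'I_n -> R) :
  Filter F -> (forall i, f i x @[x --> F] --> a i) ->
  \sum_(i < n) f i x @[x --> F] --> \sum_(i < n) a i.
Proof.
move=> FF fa; apply: (@cvg_big _ _ +%R 0 xpredT _ _ F) => //.
exact: (@pseudometric_normed_Zmodule.add_continuous _ R).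
Qed.

Let eq_cvg_seq (f g : nat -> R) l : f =1 g -> f @ \oo --> l -> g @ \oo --> l.
Proof. by move=> /funext ->. Qed.

Definition lapdisc h w x : R :=
  \sum_(i < n) (w (x + h *: delta_mx 0 i) + w (x - h *: delta_mx 0 i)
                - 2 * w x) / h ^+ 2.

(** Convergence is asked at one point and along one sequence, so the notion makes sense without
    derivatives of [w], can be checked for a convolution by dominated convergence, and still has a
    sign at a maximum. *)
Definition haslap w l x := lapdisc (step m) w x @[m --> \oo] --> l.

Definition sq x : R := \sum_(i < n) x ord0 i ^+ 2.

Lemma haslapD w1 w2 l1 l2 x : haslap w1 l1 x -> haslap w2 l2 x ->
  haslap (fun y => w1 y + w2 y) (l1 + l2) x.
Proof.
move=> h1 h2; apply: eq_cvg_seq (cvgD h1 h2) => m; rewrite fctE /lapdisc -big_split/=; apply: eq_bigr => i _.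
by rewrite -mulrDl; congr (_ / _); ring.
Qed.

Lemma haslapZ w l (c : R) x :
  haslap w l x -> haslap (fun y => c * w y) (c * l) x.
Proof.
move=> h1; apply: eq_cvg_seq (@cvgMl_tmp _ _ _ _ _ c _ h1) => m.
rewrite ?fctE /lapdisc big_distrr/=; apply: eq_bigr => i _; ring.
Qed.

Lemma haslapN w l x : haslap w l x -> haslap (fun y => - w y) (- l) x.
Proof.
move=> h1; have := @haslapZ _ _ (-1) _ h1; rewrite mulN1r.
by rewrite (_ : (fun y => _) = (fun y => - w y))//; apply/funext => y; rewrite mulN1r.
Qed.

Lemma haslapB w1 w2 l1 l2 x : haslap w1 l1 x -> haslap w2 l2 x ->
  haslap (fun y => w1 y - w2 y) (l1 - l2) x.
Proof. by move=> h1 /haslapN; exact: haslapD. Qed.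

Lemma haslap_cst (c : R) x : haslap (fun=> c) 0 x.
Proof.
rewrite /haslap (_ : (fun m => _) = (fun=> 0)); first exact: cvg_cst.
apply/funext => m; rewrite /lapdisc big1// => i _.
by rewrite (_ : c + c - 2 * c = 0) ?mul0r//; ring.
Qed.

Lemma haslap_shift w l (a x : X) :
  haslap w l (x + a) -> haslap (fun y => w (y + a)) l x.
Proof.
apply: eq_cvg_seq => m.
by apply: eq_bigr => i _; rewrite ![_ + _ + a]addrAC.
Qed.

Lemma haslap_slices w x (d : 'I_n -> R) :
  (forall i, (w (x + step m *: delta_mx 0 i) + w (x - step m *: delta_mx 0 i)
     - 2 * w x) / step m ^+ 2 @[m --> \oo] --> d i) ->
  haslap w (\sum_(i < n) d i) x.
Proof.
move=> dP; rewrite /haslap /lapdisc.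
exact: cvg_sum_ord.
Qed.

Lemma haslap_coord (f f1 f2 : R -> R) (j : 'I_n) x :
  (forall s : R, is_derive s 1 f (f1 s)) ->
  (forall s : R, is_derive s 1 f1 (f2 s)) -> continuous f2 ->
  haslap (fun y => f (y ord0 j)) (f2 (x ord0 j)) x.
Proof.
move=> df df1 cf2.
have -> : f2 (x ord0 j) = \sum_(i < n) (if i == j then f2 (x ord0 j) else 0).
  by rewrite -big_mkcond big_pred1_eq.
apply: haslap_slices => i; have [->|ij] := eqVneq i j.
  have := cvg_second_difference df df1 (cf2 (x ord0 j)).
  apply: eq_cvg_seq => m.
  by rewrite !mxE !eqxx/= mulr1.
rewrite (_ : (fun m => _) = (fun=> 0)); first exact: cvg_cst.
apply/funext => m; rewrite !mxE [j == i]eq_sym (negbTE ij) andbF mulr0 oppr0 !addr0.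
by rewrite (_ : f (x ord0 j) + f (x ord0 j) - 2 * f (x ord0 j) = 0) ?mul0r//; ring.
Qed.

Lemma haslap_sq x : haslap sq (2 * n%:R) x.
Proof.
have -> : 2 * n%:R = \sum_(i < n) 2 :> R.
  by rewrite sumr_const card_ord mulr_natr.
rewrite /haslap (_ : (fun m => _) = (fun=> \sum_(i < n) 2)); first exact: cvg_cst.
apply/funext => m; apply: eq_bigr => i _.
have -> : sq (x + step m *: delta_mx 0 i) + sq (x - step m *: delta_mx 0 i) - 2 * sq x =
    \sum_(j < n) (if j == i then 2 * step m ^+ 2 else 0).
  rewrite /sq big_distrr/= -big_split -sumrB; apply: eq_bigr => j _/=.
  rewrite !mxE eqxx/=; have [_|_] := eqVneq j i; rewrite ?mulr1 ?mulr0 ?subr0; ring.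
by rewrite -big_mkcond big_pred1_eq mulfK// sqrf_eq0 gt_eqF// step_gt0.
Qed.

Lemma cvg_axis (i : 'I_n) x (c : R) : x + (c * step m) *: delta_mx 0 i @[m --> \oo] --> x.
Proof.
rewrite -[X in _ --> X]addr0; apply: cvgD; first exact: cvg_cst.
rewrite -[X in _ --> X](scale0r (delta_mx 0 i : X)); apply: cvgZr_tmp.
by rewrite -(mulr0 c); apply: cvgMl_tmp; exact: cvg_step.
Qed.

(** Each second difference at a local maximum is nonpositive once the step stays in the
    neighbourhood, and the sign survives in the limit. *)
Lemma haslap_max w l x :
  (\forall y \near x, w y <= w x) -> haslap w l x -> l <= 0.
Proof.
move=> wx h1; apply: (cvgr_to_le h1).
have : \forall m \near \oo, forall i : 'I_n,
    w (x + step m *: delta_mx 0 i) <= w x /\ w (x - step m *: delta_mx 0 i) <= w x.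
  apply: (@filter_forall _ _ (fun (i : 'I_n) m => w (x + step m *: delta_mx 0 i) <= w x /\
    w (x - step m *: delta_mx 0 i) <= w x)) => i.
  have A (c : R) : \forall m \near \oo, w (x + (c * step m) *: delta_mx 0 i) <= w x.
    exact: (@cvg_axis i x c _ wx).
  near=> m; split; near: m.
    by have := A 1; apply: filterS => m; rewrite mul1r.
  by have := A (-1); apply: filterS => m; rewrite mulN1r scaleNr.
apply: filterS => m wm; apply: sumr_le0 => i _; have [w1 w2] := wm i.
rewrite mulr_le0_ge0// ?invr_ge0 ?sqr_ge0//; lra.
Unshelve. all: by end_near. Qed.

Lemma sq_ge0 x : 0 <= sq x.
Proof. by apply: sumr_ge0 => i _; exact: sqr_ge0. Qed.

Lemma continuous_sq : continuous sq.
Proof.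
move=> x; apply: (@cvg_sum_ord _ (nbhs x) (fun i (y : X) => y ord0 i ^+ 2)) => i.
by apply: (@cvg_comp _ _ _ (fun y : X => y ord0 i) (fun t => t ^+ 2)); [exact: coord_continuous|exact: exprn_continuous].
Qed.

Lemma norm_sq x (r : R) : 0 <= r -> sq x <= r ^+ 2 -> `|x| <= r.
Proof.
move=> r0 xr; rewrite /Num.norm/= mx_normrE; apply/bigmax_leP; split => // -[i j] _/=.
rewrite ord1 -ler_sqr ?nnegrE// real_normK ?num_real// (le_trans _ xr)//.
by rewrite /sq (bigD1 j)//= lerDl; apply: sumr_ge0 => k _; exact: sqr_ge0.
Qed.

Lemma compact_sq_le (r : R) : compact [set x | sq x <= r].
Proof.
apply: bounded_closed_compact; last first.
  by apply: (@closed_comp _ _ sq [set t | t <= r]) => [x _|]; [exact: continuous_sq|exact: closed_le].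
exists (1 + `|r|); split=> [|M rM x /= xr]; first exact: num_real.
have M1 : 1 <= M by rewrite (le_trans _ (ltW rM))// lerDl.
apply: norm_sq; first by rewrite (le_trans _ M1).
rewrite (le_trans xr)// (le_trans (ler_norm r))// (@le_trans _ _ M)//.
  by rewrite (le_trans _ (ltW rM))// lerDr.
by rewrite expr2 ler_peMr// (le_trans _ M1).
Qed.

End discrete_laplacian.

(** * Weak Laplacians and the penalized maximum principle *)

Section weak_laplacian.
Context {R : realType} {n : nat}.
Local Notation X := 'rV[R]_n.
Implicit Types (w F : X -> R) (D : set X).

(* [F] is the Laplacian of [w] in a weak sense that is strong enough for the
   maximum principle: both are uniform limits, [w] of functions whose discrete
   Laplacians converge and [F] of the limits. *)
Definition wlap w F := forall e : R, 0 < e -> exists w' F',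
  [/\ continuous w', forall x, haslap w' (F' x) x,
      forall x, `|w x - w' x| <= e & forall x, `|F x - F' x| <= e].

Lemma wlap_haslap w F : continuous w -> (forall x, haslap w (F x) x) -> wlap w F.
Proof.
by move=> cw lw e e0; exists w, F; split => // x; rewrite subrr normr0 ltW.
Qed.

Lemma wlapN w F : wlap w F -> wlap (fun x => - w x) (fun x => - F x).
Proof.
move=> wF e /wF[w' [F' [cw lw ew eF]]]; exists (fun x => - w' x), (fun x => - F' x).
split => [x|x|x|x]; [exact/continuousN/cw|exact: haslapN| |];
  by rewrite -opprD normrN.
Qed.

Lemma wlapD w1 F1 w2 F2 : wlap w1 F1 -> wlap w2 F2 ->
  wlap (fun x => w1 x + w2 x) (fun x => F1 x + F2 x).
Proof.
move=> h1 h2 e e0; have e2 : 0 < e / 2 by rewrite divr_gt0.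
have [w1' [F1' [cw1 lw1 ew1 eF1]]] := h1 _ e2.
have [w2' [F2' [cw2 lw2 ew2 eF2]]] := h2 _ e2.
exists (fun x => w1' x + w2' x), (fun x => F1' x + F2' x).
split => [x|x|x|x].
- by apply: continuousD; [exact: cw1|exact: cw2].
- exact: haslapD.
- by rewrite opprD addrACA (le_trans (ler_normD _ _))// [leRHS]splitr lerD.
- by rewrite opprD addrACA (le_trans (ler_normD _ _))// [leRHS]splitr lerD.
Qed.

Lemma wlapB w1 F1 w2 F2 : wlap w1 F1 -> wlap w2 F2 ->
  wlap (fun x => w1 x - w2 x) (fun x => F1 x - F2 x).
Proof. by move=> h1 /wlapN; exact: wlapD. Qed.

Lemma continuous_translate w (a : X) : continuous w -> continuous (fun x : X => w (x + a)).
Proof.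
move=> cw x; apply: (@cvg_trans _ _ ((w \o shift a) @ x)) => //.
by rewrite cvg_comp_shift; exact: cw.
Qed.

Lemma wlap_shift w F (a : X) : wlap w F -> wlap (fun x => w (x + a)) (fun x => F (x + a)).
Proof.
move=> wF e /wF[w' [F' [cw lw ew eF]]].
exists (fun x => w' (x + a)), (fun x => F' (x + a)); split => [x|x|//|//].
  exact: continuous_translate cw x.
exact/haslap_shift.
Qed.

Lemma penalized_max D (f : X -> R) (B d : R) (p : X) :
  closed D -> continuous f -> (forall x, D x -> f x <= B) -> 0 < d -> D p ->
  exists2 x, D x & forall y, D y -> f y - d * sq y <= f x - d * sq x.
Proof.
move=> clD cf fB d0 Dp.
(* Where [sq y > r], the penalty exceeds [d * r = B - f p + d * sq p], so the penalized value lies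
   below the one at [p]. The maximum over the compact set [sq y <= r] is therefore global. *)
pose r := (B - f p) / d + sq p.
have Bp := fB _ Dp.
have cg : continuous (fun y : X => f y - d * sq y).
  by apply: continuous_sub cf _; apply: continuous_scale; exact: continuous_sq.
have pr : sq p <= r by rewrite lerDr divr_ge0 ?subr_ge0// ltW.
have [||x|x] := @compact_EVT_max _ R (fun y => f y - d * sq y) ([set y | sq y <= r] `&` D).
- by exists p.
- by apply: compact_closedI => //; exact: compact_sq_le.
- apply: continuous_subspaceT; exact: cg.
rewrite inE => -[/= xr Dx] xmax; exists x => // y Dy.
have [yr|ry] := lerP (sq y) r; first by apply: xmax; rewrite inE.
apply: (@le_trans _ _ (f p - d * sq p)); last by apply: xmax; rewrite inE.
have := fB _ Dy; have : d * r <= d * sq y by rewrite ler_pM2l// ltW.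
rewrite /r mulrDr mulrCA divff ?gt_eqF// mulr1; lra.
Qed.

(* The quadratic penalization [d * sq] replaces compactness of the domain, at
   the cost of errors in the conclusion. *)
Lemma max_principle D w1 F1 w2 F2 (B e : R) (p : X) :
  closed D -> wlap w1 F1 -> wlap w2 F2 ->
  (forall x, D x -> w1 x <= B /\ w2 x <= B) -> D p -> 0 < e ->
  exists2 x, D x &
    [/\ w2 x - e <= w1 x, w1 p - e <= w1 x, w2 p - e <= w1 x &
        F1 x <= e \/ ~ D° x] \/
    [/\ w1 x - e <= w2 x, w1 p - e <= w2 x, w2 p - e <= w2 x &
        F2 x <= e \/ ~ D° x].
Proof.
move=> clD h1 h2 wB Dp e0; have e8 : 0 < e / 8 by rewrite divr_gt0.
have [w1' [F1' [cw1 lw1 ew1 eF1]]] := h1 _ e8.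
have [w2' [F2' [cw2 lw2 ew2 eF2]]] := h2 _ e8.
pose f x := Num.max (w1' x) (w2' x).
have cf : continuous f.
  exact: continuous_maxr cw1 cw2.
have sp := sq_ge0 p; have n0 : 0 <= n%:R :> R by [].
(* With [d * c = e / 8], both the Laplacian [d * (2 * n%:R)] of the penalty and its value at [p] are
   at most [e / 8]. *)
pose c : R := 2 * n%:R + sq p + 1.
have c0 : 0 < c by rewrite /c; lra.
pose d := e / 8 / c.
have d0 : 0 < d by rewrite divr_gt0.
have dc : d * c = e / 8 by rewrite divfK// gt_eqF.
have dn : d * (2 * n%:R) <= e / 8.
  by rewrite -dc ler_pM2l// /c; lra.
have dp : d * sq p <= e / 8.
  by rewrite -dc ler_pM2l// /c; lra.
have [|x Dx xmax] := @penalized_max D f (B + e / 8) d p clD cf _ d0 Dp.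
  move=> x /wB[? ?]; rewrite ge_max; move: (ew1 x) (ew2 x).
  by rewrite !ler_distl => /andP[? ?] /andP[? ?]; apply/andP; split; lra.
have fp := xmax _ Dp.
have dsq := mulr_ge0 (ltW d0) (sq_ge0 x).
(* The maximum [f] of two functions need not have a Laplacian. The one that realizes it at [x]
   touches [f] from below, hence inherits the penalized local maximum. *)
have crit v G : (forall y, v y <= f y) -> f x = v x -> haslap v (G x) x ->
    D° x -> G x <= e / 8.
  move=> vf fx lv Dox; apply: le_trans dn; rewrite -subr_le0.
  apply: (haslap_max _ (haslapB lv (@haslapZ _ _ _ _ d _ (haslap_sq x)))).
  have : nbhs x D by [].
  apply: filterS => y Dy; rewrite (le_trans _ (le_trans (xmax _ Dy) _))//.
    by rewrite lerD2r.
  by rewrite fx.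
have f1 y : w1' y <= f y by rewrite le_max lexx.
have f2 y : w2' y <= f y by rewrite le_max lexx orbT.
exists x => //.
move: (ew1 x) (ew2 x) (ew1 p) (ew2 p) (eF1 x) (eF2 x) (f1 p) (f2 p) (f1 x) (f2 x).
rewrite !ler_distl => /andP[? ?] /andP[? ?] /andP[? ?] /andP[? ?] /andP[? ?] /andP[? ?] ? ? ? ?.
have [w21|w12] := lerP (w2' x) (w1' x).
  have fx : f x = w1' x by rewrite /f; apply/max_idPl.
  left; split; [lra|lra|lra|].
  have [/(crit _ F1' f1 fx (lw1 x)) ?|] := pselect (D° x); [left; lra|by right].
have fx : f x = w2' x by rewrite /f; apply/max_idPr/ltW.
right; split; [lra|lra|lra|].
have [/(crit _ F2' f2 fx (lw2 x)) ?|] := pselect (D° x); [left; lra|by right].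
Qed.

End weak_laplacian.

(** * Barriers *)

Section comparison_functions.
Context {R : realType} {n : nat}.
Local Notation X := 'rV[R]_n.
Implicit Types (w F : X -> R) (x y : X) (i : 'I_n).

Lemma sqD_axis x i (t : R) :
  sq (x + t *: delta_mx 0 i) = sq x + 2 * t * x ord0 i + t ^+ 2.
Proof.
rewrite /sq (bigD1 i)//= [in RHS](bigD1 i)//= !mxE !eqxx/= mulr1.
rewrite (eq_bigr (fun j => x ord0 j ^+ 2)); last first.
  by move=> j /negbTE ji; rewrite !mxE ji andbF mulr0 addr0.
ring.
Qed.

Definition gaussian (a : R) y x := expR (- a * sq (x - y)).

Lemma gaussian_gt0 a y x : 0 < gaussian a y x.
Proof. exact: expR_gt0. Qed.

Lemma gaussian_le1 a y x : 0 <= a -> gaussian a y x <= 1.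
Proof. by move=> a0; rewrite -expR0 ler_expR mulNr oppr_le0 mulr_ge0 ?sq_ge0. Qed.

Lemma continuous_gaussian a y : continuous (gaussian a y).
Proof.
apply: continuous_compose; last exact: continuous_expR.
apply: continuous_scale; apply: (@continuous_translate _ _ sq (- y)).
exact: continuous_sq.
Qed.

Lemma haslap_gaussian a y x :
  haslap (gaussian a y) ((4 * a ^+ 2 * sq (x - y) - 2 * a * n%:R) * gaussian a y x) x.
Proof.
have -> : (4 * a ^+ 2 * sq (x - y) - 2 * a * n%:R) * gaussian a y x =
    \sum_(i < n) (4 * a ^+ 2 * (x - y) ord0 i ^+ 2 - 2 * a) * gaussian a y x.
  rewrite -big_distrl/= sumrB -big_distrr/= sumr_const card_ord.
  by rewrite -(mulr_natr (2 * a)).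
apply: haslap_slices => i; set s := (x - y) ord0 i.
(* On a line along axis [i] the Gaussian is a one-variable Gaussian times [C], which collects the
   other coordinates. *)
pose C := expR (- a * (sq (x - y) - s ^+ 2)).
pose f (t : R) := C * expR (- a * t ^+ 2).
pose f1 (t : R) := C * (- 2 * a * t) * expR (- a * t ^+ 2).
pose f2 (t : R) := C * (4 * a ^+ 2 * t ^+ 2 - 2 * a) * expR (- a * t ^+ 2).
have df (t : R) : is_derive t 1 f (f1 t).
  by apply: is_derive_eq; rewrite /f1 /GRing.scale/= /GRing.scale/=; ring.
have df1 (t : R) : is_derive t 1 f1 (f2 t).
  by apply: is_derive_eq; rewrite /f2 /GRing.scale/= /GRing.scale/=; ring.
have cf2 : continuous f2.
  apply: continuous_mul.
    apply: continuous_scale; apply: continuous_sub; last exact: cst_continuous.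
    by apply: continuous_scale; exact: exprn_continuous.
  apply: continuous_compose; last exact: continuous_expR.
  by apply: continuous_scale; exact: exprn_continuous.
have fE t : gaussian a y (x + t *: delta_mx 0 i) = f (s + t).
  rewrite /gaussian /f /C -expRD; congr expR.
  by rewrite addrAC sqD_axis -/s; ring.
have fE0 : gaussian a y x = f s by rewrite -(addr0 s) -fE scale0r addr0.
have -> : (4 * a ^+ 2 * s ^+ 2 - 2 * a) * gaussian a y x = f2 s.
  by rewrite fE0 /f /f2; ring.
rewrite (_ : (fun m => _) = (fun m => (f (s + step m) + f (s - step m) - 2 * f s) / step m ^+ 2)).
  exact: cvg_second_difference df df1 (cf2 s).
by apply/funext => m; rewrite fE -scaleNr fE fE0.
Qed.

Lemma interiorT' x : (@setT X)° x.
Proof. exact: filterT. Qed.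

(* A quantitative strong maximum principle: the Gaussian is a subsolution away
   from its center. *)
Lemma spread w F (A a c r : R) y :
  wlap w F -> (forall x, 0 <= w x) -> 0 < A -> (forall x, F x <= A * w x) ->
  0 < c -> 0 <= a -> A + 2 * a * n%:R <= 4 * a ^+ 2 * r ^+ 2 ->
  (forall x, sq (x - y) <= r ^+ 2 -> c <= w x) ->
  forall x, c * gaussian a y x <= w x.
Proof.
move=> wF w0 A0 FA c0 a0 ar wc p.
rewrite -subr_le0 leNgt; apply/negP => m0; set m := _ - _ in m0.
pose g x := c * gaussian a y x - w x.
pose G x := c * ((4 * a ^+ 2 * sq (x - y) - 2 * a * n%:R) * gaussian a y x) - F x.
have gG : wlap g G.
  apply: wlapB wF; apply: wlap_haslap; last by move=> x; exact/haslapZ/haslap_gaussian.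
  by apply: continuous_scale; exact: continuous_gaussian.
have A1 : 0 < A + 1 by rewrite addr_gt0.
(* The maximum principle yields a point with [g >= m - e] and [G <= e]. To contradict [A * g <= G]
   there, [e * (A + 1) < m * A] is required. *)
pose e := m * A / (2 * (A + 1)).
have e0 : 0 < e by rewrite divr_gt0 ?mulr_gt0.
have eA : e * (2 * (A + 1)) = m * A by rewrite divfK// mulf_neq0 ?gt_eqF.
have eA1 : e * A < A * m / 2 by lra.
have mA := mulr_gt0 m0 A0.
have em : e < m by rewrite -(ltr_pM2r A0); lra.
have gc x : g x <= c.
  rewrite /g lerBlDr (le_trans _ (_ : c <= _))// ?lerDl//.
  by rewrite ger_pMr// gaussian_le1.
have [x _] := max_principle (@closedT X) gG gG (fun x _ => conj (gc x) (gc x)) I e0 (p := p).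
move=> H; have [gx Gx] : m - e <= g x /\ G x <= e.
  by case: H => -[_ ? _ [|/(_ (interiorT' x))//]].
(* Inside the ball [g <= 0 < m - e]. Outside, the condition on [a] makes the Laplacian of the
   Gaussian at least [A] times the Gaussian. *)
have [/wc|rx] := lerP (sq (x - y)) (r ^+ 2).
  have : c * gaussian a y x <= c by rewrite ger_pMr// gaussian_le1.
  by rewrite /g in gx; lra.
have Gg : A * g x <= G x.
  rewrite /g /G mulrBr lerB// mulrCA ler_pM2l// ler_pM2r ?gaussian_gt0//.
  have : 4 * a ^+ 2 * r ^+ 2 <= 4 * a ^+ 2 * sq (x - y).
    by apply: ler_wpM2l (ltW rx); rewrite mulr_ge0// sqr_ge0.
  lra.
have : A * (m - e) <= A * g x by rewrite ler_pM2l.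
lra.
Qed.

Definition strip i (a b : R) : set X := [set x | a <= x ord0 i <= b].

Lemma closed_strip i a b : closed (strip i a b).
Proof.
apply: (@closed_comp _ _ (fun x : X => x ord0 i) [set t | a <= t <= b]).
  by move=> x _; exact: coord_continuous.
have -> : [set t | a <= t <= b] = `[a, b]%classic by apply/seteqP; split => t; rewrite /= in_itv.
exact: itv_closed.
Qed.

Lemma interior_strip i a b x : strip i a b x -> ~ (strip i a b)° x ->
  x ord0 i = a \/ x ord0 i = b.
Proof.
move=> /andP[ax xb] nx; have [|xa] := eqVneq (x ord0 i) a; first by left.
right; apply/eqP; apply: contra_notT nx => xnb.
have xab : nbhs (x ord0 i) `]a, b[%classic.
  by apply: near_in_itvoo; rewrite in_itv/= !lt_neqAle eq_sym xa xnb ax xb.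
have : nbhs x [set y : X | `]a, b[%classic (y ord0 i)].
  exact: (@coord_continuous _ _ _ ord0 i x _ xab).
apply: filterS => y /=.
by rewrite in_itv/= /strip/= => /andP[? ?]; rewrite !ltW.
Qed.

Definition mirror i (c : R) x : X := x + (2 * (c - x ord0 i)) *: delta_mx 0 i.

Lemma continuous_mirror w i c : continuous w -> continuous (w \o mirror i c).
Proof.
move=> cw x; apply: continuous_comp; last exact: cw.
apply: (@continuousD _ _ _ (fun x : X => x)); first by [].
apply: continuousZr_tmp.
apply: (@continuous_scale R X 2); apply: continuous_sub; first exact: cst_continuous.
exact: coord_continuous.
Qed.

(** The reflection commutes with steps along the other axes and reverses those along axis [i], so it
    only exchanges the two neighbours in one second difference. *)
Lemma haslap_mirror w l i c x :
  haslap w l (mirror i c x) -> haslap (w \o mirror i c) l x.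
Proof.
have mD (t : R) j : mirror i c (x + t *: delta_mx 0 j) =
    mirror i c x + ((-1) ^+ (j == i) * t) *: delta_mx 0 j.
  rewrite /mirror -!addrA; congr (_ + _); rewrite addrC !mxE eqxx/= eq_sym.
  have [->|ij] := eqVneq j i; rewrite ?expr1 ?mulr1 ?mulr0 ?addr0 ?mul1r//=.
  by rewrite -!scalerDl; congr (_ *: _); ring.
rewrite /haslap; set g := fun m => _; set h := fun m => _.
suff -> : g = h by [].
apply/funext => m; apply: eq_bigr => j _ /=; rewrite -scaleNr !mD.
by case: (j == i); rewrite ?mulN1r ?mul1r ?opprK ?scaleNr ?[w (_ - _) + _]addrC ?[in RHS]opprK.
Qed.

(** The points [y] and [x] are mirror images in the hyperplane [z_i = c], so the increment is the
    value at [y] of the odd function [w - w \o mirror i c]. On the strip [c <= z_i <= c + 1], which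
    contains [y] because [t <= 2], this function is dominated by [f]: both vanish on the face
    [z_i = c], and [f] equals [K >= 1] on the opposite face. At [y], at distance [t / 2] from the
    first face, [f] is at most [K * t]. *)
Let lipschitz_axis_half w F (C : R) i x (t : R) :
  continuous w -> (forall x, haslap w (F x) x) ->
  (forall x, 0 <= w x <= 1) -> (forall x, `|F x| <= C) ->
  0 < t <= 2 -> w (x + t *: delta_mx 0 i) - w x <= (C + 1) * t.
Proof.
move=> cw lw w01 FC /andP[t0 t2].
have C0 : 0 <= C := le_trans (normr_ge0 _) (FC 0).
pose c := x ord0 i + t / 2; pose y := x + t *: delta_mx 0 i.
have yi : y ord0 i = x ord0 i + t by rewrite !mxE !eqxx/= mulr1.
have yx : mirror i c y = x.
  rewrite /mirror yi /c /y -addrA -scalerDl (_ : t + _ = 0) ?scale0r ?addr0//.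
  by field.
(* The Laplacian of [- f] is [2 * C + 2], which exceeds any value of [|F z - F (mirror i c z)|] by
   2. An interior point with [G z <= e1 <= 1] is thus impossible. *)
pose K := C + 1.
pose f (s : R) := K * ((s - c) * (2 - (s - c))).
pose f1 (s : R) := K * (2 - 2 * (s - c)).
pose f2 (s : R) := - 2 * K.
pose g z := w z - w (mirror i c z) - f (z ord0 i).
pose G z := F z - F (mirror i c z) - f2 (z ord0 i).
have df (s : R) : is_derive s 1 f (f1 s).
  by apply: is_derive_eq; rewrite /f1 /GRing.scale/= /GRing.scale/=; ring.
have df1 (s : R) : is_derive s 1 f1 (f2 s).
  by apply: is_derive_eq; rewrite /f2 /GRing.scale/= /GRing.scale/=; ring.
have gG : wlap g G.
  apply: wlapB; last first.
    apply: wlap_haslap; last first.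
      by move=> z; apply: haslap_coord df df1 _; exact: cst_continuous.
    apply: continuous_compose; first by move=> z; exact: coord_continuous.
    exact: continuous_is_derive df.
  apply: wlapB; first exact: wlap_haslap.
  apply: wlap_haslap; first exact: (@continuous_mirror w i c).
  by move=> z; apply: haslap_mirror.
pose D := strip i c (c + 1).
have fD z : D z -> 0 <= f (z ord0 i).
  by move=> /andP[cz zc]; rewrite !mulr_ge0 ?subr_ge0 /K//; lra.
have g1 z : D z -> g z <= 1.
  move=> /fD; rewrite /g; have /andP[? ?] := w01 z.
  by have /andP[? ?] := w01 (mirror i c z); lra.
have Dy : D y by rewrite /D/strip/= yi /c; apply/andP; split; lra.
suff gy : g y <= 0.
  move: gy; rewrite /g yx /f yi /y /c -/K => gy.
  have K0 : 0 <= K by rewrite /K; lra.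
  have := mulr_ge0 K0 (mulr_ge0 (ltW t0) (ltW t0)).
  by move: gy; rewrite (_ : _ * (_ * _) = K * (t - t * t / 4)); [lra|field].
apply/ler_addgt0Pr => e e0; rewrite add0r.
pose e1 := Num.min e 1.
have e10 : 0 < e1 by rewrite lt_min e0 ltr01.
have [ee e11] : e1 <= e /\ e1 <= 1 by split; rewrite ge_min lexx ?orbT.
have [z Dz H] := max_principle (@closed_strip i c (c + 1)) gG gG (fun z Dz => conj (g1 z Dz) (g1 z Dz)) Dy e10.
have [gz Gz] : g y - e1 <= g z /\ (G z <= e1 \/ ~ D° z) by case: H => -[_ ? _ ?].
have : g z <= 0.
  case: Gz => [|/(interior_strip Dz)[|]] zc.
  - exfalso; move: zc; rewrite /G /f2; have := FC z; have := FC (mirror i c z).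
    by rewrite !ler_norml /K => /andP[? ?] /andP[? ?]; lra.
  - by rewrite /g /mirror zc subrr mulr0 scale0r addr0 /f !subrr mul0r mulr0 subr0.
  - rewrite /g /f zc; have /andP[? ?] := w01 z.
    by have /andP[? ?] := w01 (mirror i c z); rewrite /K; lra.
lra.
Qed.

(* Comparison of the odd reflection of [w] across a hyperplane with a concave
   quadratic barrier. *)
Lemma lipschitz_axis w F (C : R) i x (t : R) :
  continuous w -> (forall x, haslap w (F x) x) ->
  (forall x, 0 <= w x <= 1) -> (forall x, `|F x| <= C) ->
  `|w (x + t *: delta_mx 0 i) - w x| <= (C + 1) * `|t|.
Proof.
move=> cw lw w01 FC.
have C0 : 0 <= C := le_trans (normr_ge0 _) (FC 0).
suff H y s : 0 < s -> `|w (y + s *: delta_mx 0 i) - w y| <= (C + 1) * s.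
  have [t0|t0|->] := ltrgtP t 0.
  - rewrite (ltr0_norm t0) distrC.
    have := H (x + t *: delta_mx 0 i) (- t); rewrite oppr_gt0 => /(_ t0).
    by rewrite -addrA scaleNr subrr addr0.
  - by rewrite [in leRHS]gtr0_norm// H.
  - by rewrite scale0r addr0 subrr !normr0 mulr0.
(* For increments longer than 2 the bound 1 on the oscillation is enough. *)
move=> s0; have [s2|s2] := lerP s 2; last first.
  have C2 : 1 <= (C + 1) * s.
    have : 0 <= C * s by rewrite mulr_ge0// ltW.
    lra.
  apply: le_trans C2; have /andP[? ?] := w01 y.
  by have /andP[? ?] := w01 (y + s *: delta_mx 0 i); rewrite ler_norml; apply/andP; split; lra.
have s02 : 0 < s <= 2 by rewrite s0.
rewrite ler_norml; apply/andP; split; last exact: lipschitz_axis_half.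
(* The lower bound for [w] is the upper bound for [1 - w], which satisfies the same hypotheses. *)
pose v z := 1 - w z.
have cv : continuous v by apply: continuous_sub; [exact: cst_continuous|].
have lv z : haslap v (- F z) z by rewrite -sub0r; apply: haslapB => //; exact: haslap_cst.
have v01 z : 0 <= v z <= 1 by have /andP[? ?] := w01 z; apply/andP; split; rewrite /v; lra.
have FN z : `|- F z| <= C by rewrite normrN.
have := lipschitz_axis_half i y cv lv v01 FN s02; rewrite /v; lra.
Qed.

(** The function is singular on the sphere [sq y = r], while [cvg_second_difference] wants
    derivatives on the whole line. The second difference along each axis is computed in closed form
    instead: it is a rational function [q] of the step, continuous at 0. *)
Lemma haslap_inv_sub_sq (r : R) x : sq x < r ->
  haslap (fun y => (r - sq y)^-1)
    ((2 * n%:R * (r - sq x) + 8 * sq x) / (r - sq x) ^+ 3) x.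
Proof.
move=> xr; set A := r - sq x; have A0 : 0 < A by rewrite subr_gt0.
have -> : (2 * n%:R * A + 8 * sq x) / A ^+ 3 =
    \sum_(i < n) (2 * (A - 0 ^+ 2) + 8 * x ord0 i ^+ 2) /
      (A * ((A - 0 ^+ 2) ^+ 2 - 4 * 0 ^+ 2 * x ord0 i ^+ 2)).
  rewrite (eq_bigr (fun i => (2 * A + 8 * x ord0 i ^+ 2) / A ^+ 3)); last first.
    by move=> i _; rewrite expr0n/= subr0 mulr0 mul0r subr0 -exprS.
  rewrite -big_distrl/= big_split/=.
  by rewrite sumr_const card_ord -big_distrr/= -mulr_natr; congr ((_ + _) / _); ring.
apply: haslap_slices => i; set s := x ord0 i.
pose q (h : R) := (2 * (A - h ^+ 2) + 8 * s ^+ 2) /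
      (A * ((A - h ^+ 2) ^+ 2 - 4 * h ^+ 2 * s ^+ 2)).
have qc : q h @[h --> 0] --> q 0.
  have c2 : continuous (fun h : R => h ^+ 2) by exact: exprn_continuous.
  have c1 : continuous (fun h : R => A - h ^+ 2).
    by apply: continuous_sub => //; exact: cst_continuous.
  have cnum : continuous (fun h : R => 2 * (A - h ^+ 2) + 8 * s ^+ 2).
    by apply: continuous_add; [exact: continuous_scale|exact: cst_continuous].
  have cden : continuous (fun h : R => A * ((A - h ^+ 2) ^+ 2 - 4 * h ^+ 2 * s ^+ 2)).
    apply: continuous_scale; apply: continuous_sub.
      exact: (continuous_compose c1 c2).
    by apply: continuous_mul; [exact: continuous_scale|exact: cst_continuous].
  have d0 : A * ((A - 0 ^+ 2) ^+ 2 - 4 * 0 ^+ 2 * s ^+ 2) != 0.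
    by rewrite expr0n/= subr0 mulr0 mul0r subr0 mulf_neq0 ?expf_neq0 ?gt_eqF.
  exact: (cvgM (cnum 0) (cvgV d0 (cden 0))).
have lin (c : R) : \forall m \near \oo, 0 < A - c * step m - step m ^+ 2.
  have cc : continuous (fun h : R => A - c * h - h ^+ 2).
    apply: continuous_sub; last exact: exprn_continuous.
    by apply: continuous_sub; [exact: cst_continuous|apply: continuous_scale; exact: continuous_idr].
  have /cvgr_gt : (A - c * step m - step m ^+ 2) @[m --> \oo] --> A - c * 0 - 0 ^+ 2.
    exact: (cvg_comp _ _ (@cvg_step R) (cc 0)).
  by apply; rewrite expr0n/= mulr0 !subr0.
have := cvg_comp _ _ (@cvg_step R) qc.
apply: cvg_trans; apply: near_eq_cvg; near=> m.
have p1 : 0 < A - 2 * s * step m - step m ^+ 2 by near: m; exact: lin.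
have p2 : 0 < A - - (2 * s) * step m - step m ^+ 2 by near: m; exact: lin.
rewrite /= -scaleNr !sqD_axis -/s.
have -> : r - (sq x + 2 * step m * s + step m ^+ 2) = A - 2 * s * step m - step m ^+ 2.
  by rewrite /A; ring.
have -> : r - (sq x + 2 * - step m * s + (- step m) ^+ 2) = A - - (2 * s) * step m - step m ^+ 2.
  by rewrite /A; ring.
rewrite -/A /q; have h0 := @step_gt0 R m.
have p3 : 0 < (A - step m ^+ 2) ^+ 2 - 4 * step m ^+ 2 * s ^+ 2.
  have := mulr_gt0 p1 p2; congr (0 < _); ring.
by field; rewrite !gt_eqF.
Unshelve. all: by end_near. Qed.

(* The barrier [k / (r - sq)] blows up on the sphere of radius [sqrt r]; the
   largest [k] for which it touches [w - 1] satisfies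
   [k ^+ 2 <= (2 * n%:R + 8) * r]. *)
Lemma keller_osserman w F : continuous w -> (forall x, haslap w (F x) x) ->
  (forall x, 0 <= w x) -> (forall x, w x ^+ 3 - w x <= F x) ->
  forall x, w x <= 1.
Proof.
move=> cw lw w0 wF x0; rewrite leNgt; apply/negP => w1.
pose v x := w (x + x0).
have cv : continuous v by exact: continuous_translate.
have lv x : haslap v (F (x + x0)) x by exact/haslap_shift.
pose d := w x0 - 1; have d0 : 0 < d by rewrite subr_gt0.
have nn : 0 <= n%:R :> R by [].
(* The value at the center gives [k >= r * d], hence [k ^+ 2 >= r * (2 * n%:R + 9)]. The barrier
   allows only [(2 * n%:R + 8) * r]. *)
pose r := (2 * n%:R + 9) / d ^+ 2.
have d20 : 0 < d ^+ 2 by rewrite exprn_gt0.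
have r0 : 0 < r by rewrite divr_gt0//; lra.
have rd : r * d ^+ 2 = 2 * n%:R + 9 by rewrite divfK// gt_eqF.
(* Maximizing this product on the closed ball determines the touching constant [k] without handling
   the singular barrier at the boundary: [P] vanishes there and is positive at the center. *)
pose P x := (r - sq x) * (v x - 1).
have cP : continuous P.
  apply: continuous_mul; apply: continuous_sub => //; try exact: cst_continuous.
  exact: continuous_sq.
have sq0 : sq (0 : X) = 0 by rewrite /sq big1// => i _; rewrite mxE expr0n.
have [||x|c0] := @compact_EVT_max _ R P [set y | sq y <= r].
- by exists 0; rewrite /= sq0 ltW.
- exact: compact_sq_le.
- by apply: continuous_subspaceT; exact: cP.
pose c : X := c0; rewrite inE/= -/c => cr cmax; set k := P c in cmax.
have kr : r * d <= k.
  have := cmax 0; rewrite inE/= sq0 (ltW r0) => /(_ isT).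
  by rewrite /P sq0 subr0 /v add0r.
have k0 : 0 < k by rewrite (lt_le_trans _ kr)// mulr_gt0.
have A0 : 0 < r - sq c.
  rewrite lt_neqAle subr_ge0 cr andbT eq_sym; apply/eqP => e0.
  by move: k0; rewrite /k /P e0 mul0r ltxx.
have cr' : sq c < r by rewrite -subr_gt0.
have vc : v c - 1 = k / (r - sq c) by rewrite /k /P mulrC mulKf// gt_eqF.
have vmax : nbhs c [set y : X | v y - k * (r - sq y)^-1 <= v c - k * (r - sq c)^-1].
  have cs : continuous (fun y : X => r - sq y).
    by apply: continuous_sub; [exact: cst_continuous|exact: continuous_sq].
  have h0 : nbhs (r - sq c) [set t : R | 0 < t].
    by apply: open_nbhs_nbhs; split; [exact: open_gt|].
  have h : nbhs c [set y : X | 0 < r - sq y] := cs c _ h0.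
  near=> y; have y0 : 0 < r - sq y by near: y.
  rewrite /=.
  have : P y <= k by apply: cmax; rewrite inE/= -subr_ge0 ltW.
  rewrite /P mulrC -ler_pdivlMr// => vy.
  by rewrite -vc; lra.
have := haslap_max vmax (haslapB (lv c) (@haslapZ _ _ _ _ k _ (haslap_inv_sub_sq cr'))).
set A := r - sq c in A0 vc *; have := wF (c + x0); rewrite -/(v c).
have -> : v c = 1 + k / A by rewrite -vc; ring.
set q := k / A => h2 h1.
have q0 : 0 < q by rewrite divr_gt0.
(* With [q = k / A] the excess over 1, the cubic growth produces [k ^+ 3 / A ^+ 3], the same power
   of [A] as in the Laplacian of the barrier, so that [A] cancels. *)
have : q ^+ 3 <= (1 + q) ^+ 3 - (1 + q).
  have := sqr_ge0 q; rewrite (_ : (1 + q) ^+ 3 - (1 + q) = q ^+ 3 + 3 * q ^+ 2 + 2 * q); [lra|ring].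
have qk : q ^+ 3 = k ^+ 3 / A ^+ 3 by rewrite exprMn exprVn.
have sc := sq_ge0 c.
have : k * ((2 * n%:R * A + 8 * sq c) / A ^+ 3) <= k * ((2 * n%:R + 8) * r) / A ^+ 3.
  rewrite -[leRHS]mulrA ler_pM2l// ler_pM2r ?invr_gt0 ?exprn_gt0//.
  have : 0 <= n%:R * sq c by rewrite mulr_ge0.
  by rewrite /A; lra.
move=> h3 h4.
have : k ^+ 3 / A ^+ 3 <= k * ((2 * n%:R + 8) * r) / A ^+ 3 by rewrite -qk; lra.
rewrite ler_pM2r ?invr_gt0 ?exprn_gt0// exprS ler_pM2l// => kk.
have : (r * d) ^+ 2 <= k ^+ 2 by rewrite ler_sqr ?nnegrE// ltW// mulr_gt0.
rewrite exprMn expr2 -mulrA rd => h5.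
have : r * (2 * n%:R + 9) <= (2 * n%:R + 8) * r by rewrite (le_trans h5).
by rewrite mulrC ler_pM2r//; lra.
Unshelve. all: by end_near. Qed.

End comparison_functions.

Section lipschitz.
Context {R : realType} {n : nat}.
Local Notation X := 'rV[R]_n.

Lemma norm_coord (x : X) i : `|x ord0 i| <= `|x|.
Proof.
rewrite [leRHS]/Num.norm/= mx_normrE.
exact: (@le_bigmax _ _ _ 0 (fun ij : 'I_1 * 'I_n => `|x ij.1 ij.2|) (ord0, i)).
Qed.

Lemma lipschitz_sum (f : X -> R) (K : R) :
  (forall x i t, `|f (x + t *: delta_mx 0 i) - f x| <= K * `|t|) ->
  forall x y, `|f x - f y| <= K * \sum_(i < n) `|(x - y) ord0 i|.
Proof.
move=> fK x y.
have H s (t : 'I_n -> R) z : `|f (z + \sum_(i <- s) t i *: delta_mx 0 i) - f z|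
    <= K * \sum_(i <- s) `|t i|.
  elim: s z => [|i s IH] z; first by rewrite !big_nil addr0 subrr normr0 mulr0.
  rewrite !big_cons addrA mulrDr.
  apply: le_trans (ler_distD (f (z + t i *: delta_mx 0 i)) _ _) _.
  by rewrite [leRHS]addrC lerD.
have := H (index_enum 'I_n) (fun i => (x - y) ord0 i) y.
by rewrite -row_sum_delta subrKC.
Qed.

Lemma lipschitz_norm (f : X -> R) (K : R) : 0 <= K ->
  (forall x i t, `|f (x + t *: delta_mx 0 i) - f x| <= K * `|t|) ->
  forall x y, `|f x - f y| <= K * n%:R * `|x - y|.
Proof.
move=> K0 fK x y; rewrite (le_trans (lipschitz_sum fK x y))// -mulrA ler_wpM2l//.
rewrite (le_trans (ler_sum _ (fun i _ => norm_coord (x - y) i)))//.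
by rewrite sumr_const card_ord mulr_natl.
Qed.

End lipschitz.

(** * The reaction term and the comparison principle *)

Section reaction.
Context {R : realType}.
Implicit Types a b L e : R.

(** Both equations have this right-hand side, the second one with the unknowns exchanged, so each
    estimate is proved once. *)
Definition reac L a b := a - a ^+ 3 - L * a * b ^+ 2.

(** This provides the hypothesis [F <= A * w] of [spread] for increments of ordered pairs, with
    [A = 2 + L]. Lowering [b] contributes with a favourable sign (cooperativity), and the slope
    [1 - 3 * a ^+ 2 - L * b ^+ 2] in the first variable is at least [- (2 + L)]. *)
Lemma reac_mono L a b a' b' : 0 <= L -> 0 <= a -> a <= a' -> a' <= 1 ->
  0 <= b' -> b' <= b -> b <= 1 ->
  reac L a b - reac L a' b' <= (2 + L) * (a' - a).
Proof.
move=> L0 a0 aa' a'1 b'0 b'b b1; rewrite -subr_ge0.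
have -> : (2 + L) * (a' - a) - (reac L a b - reac L a' b') =
   (a' - a) * ((1 - a' * a') + (1 - a * a') + (1 - a * a) + L * (1 - b * b)) +
   L * a' * (b - b') * (b + b') by rewrite /reac; ring.
have p1 : 0 <= 1 - a' * a' by rewrite subr_ge0 mulr_ile1//; lra.
have p2 : 0 <= 1 - a * a' by rewrite subr_ge0 mulr_ile1//; lra.
have p3 : 0 <= 1 - a * a by rewrite subr_ge0 mulr_ile1//; lra.
have p4 : 0 <= L * (1 - b * b) by rewrite mulr_ge0// subr_ge0 mulr_ile1//; lra.
rewrite addr_ge0//; first by rewrite mulr_ge0//; lra.
by rewrite !mulr_ge0//; lra.
Qed.

(* [th] is small enough for both phases to be uniformly linearly stable. *)
Lemma reac_gap L th a b a' b' e :
  1 < L -> 0 < th -> 6 * th * L <= L - 1 -> 6 * th * L <= 1 ->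
  0 <= a <= 1 -> 0 <= b <= 1 -> 0 <= a' <= 1 -> 0 <= b' <= 1 ->
  a <= th /\ 1 - th <= b \/ 1 - th <= a' /\ b' <= th ->
  a' < a -> 0 <= e -> a' - a - e <= b - b' ->
  2 * L * th * (a - a') - 2 * L * th * e <= reac L a' b' - reac L a b.
Proof.
move=> L1 th0 thL thL1 /andP[a0 a1] /andP[b0 b1] /andP[a'0 a'1] /andP[b'0 b'1] near aa e0 be.
have L0 : 0 < L by lra.
have Lt0 : 0 < L * th by rewrite mulr_gt0.
have tL : th <= th * L by rewrite ler_peMr// ltW.
(* Damping at rate at least [4 * L * th] beats the coupling, which is at most [2 * L * th] in the
   only case where it is adverse, [b < b']. In that case [b' - b] is at most [a - a' + e]. *)
have key (A B : R) : reac L a' b' - reac L a b = A * (a' - a) + B * (b - b') ->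
    A <= - (4 * L * th) -> 0 <= B -> (b < b' -> B <= 2 * L * th) ->
    2 * L * th * (a - a') - 2 * L * th * e <= reac L a' b' - reac L a b.
  move=> -> hA B0 hB.
  have h1 : 4 * L * th * (a - a') <= A * (a' - a).
    rewrite -[leRHS]mulrNN opprB ler_wpM2r//; lra.
  have Lta : 0 <= L * th * (a - a') by rewrite mulr_ge0//; lra.
  have Lte : 0 <= L * th * e by rewrite mulr_ge0// ltW.
  have [b'b|bb'] := lerP b' b.
    have : 0 <= B * (b - b') by rewrite mulr_ge0// subr_ge0.
    lra.
  have h2 : 2 * L * th * (b - b') <= B * (b - b').
    by rewrite ler_wnM2r ?hB//; lra.
  have h3 : 2 * L * th * (a' - a - e) <= 2 * L * th * (b - b').
    by rewrite ler_wpM2l//; lra.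
  lra.
(* The mixed term is split in a different order in each phase, so that the coupling coefficient is
   small: near the first phase it contains [a' < a <= th], near the second one [b + b'] with
   [b < b' <= th]. The hypothesis on [L - 1] gives the damping in the first phase, the other one in
   the second. *)
case: near => -[h1 h2].
- apply: (key (1 - (a' ^+ 2 + a * a' + a ^+ 2) - L * b ^+ 2) (L * a' * (b + b'))).
  + by rewrite /reac; ring.
  + have : L * (1 - 2 * th) <= L * b ^+ 2.
      rewrite ler_pM2l//; have : 0 <= (b - 1) ^+ 2 by exact: sqr_ge0.
      have : (1 - th) ^+ 2 <= b ^+ 2 by rewrite ler_sqr ?nnegrE//; lra.
      have : 0 <= th ^+ 2 by exact: sqr_ge0.
      lra.
    have := sqr_ge0 a; have := sqr_ge0 a'; have := mulr_ge0 a0 a'0.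
    lra.
  + by rewrite !mulr_ge0//; lra.
  + move=> _; rewrite -mulrA (_ : 2 * L * th = L * (th * 2)); last by ring.
    by rewrite ler_pM2l// ler_pM//; lra.
- apply: (key (1 - (a' ^+ 2 + a * a' + a ^+ 2) - L * b' ^+ 2) (L * a * (b + b'))).
  + by rewrite /reac; ring.
  + have t16 : 0 <= 1 - th by lra.
    have q1 : (1 - th) ^+ 2 <= a' ^+ 2 by rewrite ler_sqr ?nnegrE//; lra.
    have q2 : (1 - th) ^+ 2 <= a ^+ 2 by rewrite ler_sqr ?nnegrE//; lra.
    have q3 : (1 - th) ^+ 2 <= a * a' by rewrite expr2 ler_pM//; lra.
    have := sqr_ge0 th; have : 0 <= L * b' ^+ 2 by rewrite mulr_ge0 ?sqr_ge0 ?ltW.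
    lra.
  + by rewrite !mulr_ge0//; lra.
  + move=> bb'; rewrite -mulrA (_ : 2 * L * th = L * (1 * (2 * th))); last by ring.
    by rewrite ler_pM2l// ler_pM//; lra.
Qed.

End reaction.

Section comparison.
Context {R : realType} {n : nat}.
Local Notation X := 'rV[R]_n.
Implicit Types (U V : X -> R) (L th : R).

Definition entire_sol L U V := [/\ forall x, 0 <= U x <= 1, forall x, 0 <= V x <= 1,
  wlap U (fun x => - reac L (U x) (V x)) & wlap V (fun x => - reac L (V x) (U x))].

Lemma entire_sol_shift L U V (a : X) : entire_sol L U V ->
  entire_sol L (fun x => U (x + a)) (fun x => V (x + a)).
Proof.
move=> [U01 V01 lU lV]; split; [by move=> x|by move=> x|exact: (wlap_shift a lU)|].
exact: (wlap_shift a lV).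
Qed.

(** The maximum principle is applied to the pair [U - U'], [V' - V]. At a near-maximum point of the
    larger one the order fails, so a stable phase is near and [reac_gap] bounds the Laplacian below
    by a multiple of the violation [m], against the upper bound [e]. This yields order everywhere
    from order in the intermediate region alone. *)
Lemma comparison L th U V U' V' :
  1 < L -> 0 < th -> 6 * th * L <= L - 1 -> 6 * th * L <= 1 ->
  entire_sol L U V -> entire_sol L U' V' ->
  (forall x, U x <= U' x /\ V' x <= V x \/
     U x <= th /\ 1 - th <= V x \/ 1 - th <= U' x /\ V' x <= th) ->
  forall x, U x <= U' x /\ V' x <= V x.
Proof.
move=> L1 th0 thL thL1 [U01 V01 lU lV] [U'01 V'01 lU' lV'] H p.
pose g1 x := U x - U' x; pose g2 x := V' x - V x.
pose G1 x := - reac L (U x) (V x) - - reac L (U' x) (V' x).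
pose G2 x := - reac L (V' x) (U' x) - - reac L (V x) (U x).
have l1 : wlap g1 G1 by exact: wlapB.
have l2 : wlap g2 G2 by exact: wlapB.
pose m := Num.max (g1 p) (g2 p).
have [g1m g2m] : g1 p <= m /\ g2 p <= m by rewrite !le_max !lexx orbT.
suff m0 : m <= 0 by move: g1m g2m; rewrite /g1 /g2; split; lra.
rewrite leNgt; apply/negP => m0.
have Lt0 : 0 < L * th by rewrite mulr_gt0//; lra.
(* The two bounds on the Laplacian read [2 * L * th * (m - e) - 2 * L * th * e <= e], that is
   [2 * L * th * m <= e * (1 + 4 * L * th)]. The choice of [e] makes the right-hand side half of the
   left-hand side. *)
pose e := L * th * m / (1 + 4 * (L * th)).
have d0 : 0 < 1 + 4 * (L * th) by lra.
have Ltm := mulr_gt0 Lt0 m0.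
have e0 : 0 < e by rewrite divr_gt0.
have eE : e * (1 + 4 * (L * th)) = L * th * m by rewrite divfK// gt_eqF.
have em : e < m.
  rewrite -(ltr_pM2r Lt0); have := mulr_gt0 e0 Lt0; lra.
have gB x : setT x -> g1 x <= 1 /\ g2 x <= 1.
  move=> _; rewrite /g1 /g2; have /andP[? ?] := U01 x; have /andP[? ?] := V01 x.
  by have /andP[? ?] := U'01 x; have /andP[? ?] := V'01 x; split; lra.
have [x _ M] := max_principle (@closedT X) l1 l2 gB (I : setT p) e0.
have mE : m = g1 p \/ m = g2 p by rewrite /m; case: lerP => _; [right|left].
case: M => -[M1 M2 M3 [M4|/(_ (interiorT' x))//]].
- have gx : m - e <= g1 x by case: mE => ->.
  have gx0 : 0 < g1 x by lra.
  case: (H x) => [[Ux _]|nr]; first by move: gx0; rewrite /g1; lra.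
  have := @reac_gap _ L th (U x) (V x) (U' x) (V' x) e L1 th0 thL thL1 (U01 x) (V01 x) (U'01 x) (V'01 x) nr.
  have h : L * th * (m - e) <= L * th * g1 x by rewrite ler_pM2l.
  move: gx gx0 M1 M4 h; rewrite /G1 /g1 /g2 => gx gx0 M1 M4 h.
  have UU : U' x < U x by lra.
  have VV : U' x - U x - e <= V x - V' x by lra.
  by move=> /(_ UU (ltW e0) VV); lra.
- have gx : m - e <= g2 x by case: mE => ->.
  have gx0 : 0 < g2 x by lra.
  case: (H x) => [[_ Vx]|nr]; first by move: gx0; rewrite /g2; lra.
  (* Exchanging the species together with the two solutions preserves the system and interchanges
     the two phases. *)
  have nr' : V' x <= th /\ 1 - th <= U' x \/ 1 - th <= V x /\ U x <= th.
    by case: nr => -[? ?]; [right|left].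
  have h : L * th * (m - e) <= L * th * g2 x by rewrite ler_pM2l.
  have := @reac_gap _ L th (V' x) (U' x) (V x) (U x) e L1 th0 thL thL1 (V'01 x) (U'01 x) (V01 x) (U01 x) nr'.
  move: gx gx0 M1 M4 h; rewrite /G2 /g1 /g2 => gx gx0 M1 M4 h.
  have UU : V x < V' x by lra.
  have VV : V x - V' x - e <= U' x - U x by lra.
  by move=> /(_ UU (ltW e0) VV); lra.
Qed.

End comparison.

(** * Sliding method *)

Section sliding.
Context {R : realType} {n : nat}.
Local Notation X := 'rV[R]_n.+1.
Implicit Types (U V W : X -> R) (x y nu : X).

Lemma last_coordD x y : last_coord (x + y) = last_coord x + last_coord y.
Proof. by rewrite /last_coord mxE. Qed.

Lemma last_coordZ (t : R) x : last_coord (t *: x) = t * last_coord x.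
Proof. by rewrite /last_coord mxE. Qed.

Lemma sqZ (t : R) x : sq (t *: x) = t ^+ 2 * sq x.
Proof. by rewrite /sq big_distrr/=; apply: eq_bigr => i _; rewrite mxE exprMn. Qed.

Lemma exists_gaussian_rate (A r : R) : 0 < A -> 0 < r ->
  exists2 a : R, 0 <= a & A + 2 * a * n.+1%:R <= 4 * a ^+ 2 * r ^+ 2.
Proof.
move=> A0 r0; have r20 : 0 < r ^+ 2 by rewrite exprn_gt0.
have n0 : 0 <= n.+1%:R :> R by [].
have Ar : 0 < A * r ^+ 2 by rewrite mulr_gt0.
pose s : R := n.+1%:R + A * r ^+ 2 + 1.
have s1 : 1 <= s by rewrite /s; lra.
exists (s / r ^+ 2); first by rewrite divr_ge0 ?ltW//; lra.
rewrite -(ler_pM2r r20).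
have -> : 4 * (s / r ^+ 2) ^+ 2 * r ^+ 2 * r ^+ 2 = 4 * s ^+ 2.
  by field; rewrite gt_eqF.
have -> : (A + 2 * (s / r ^+ 2) * n.+1%:R) * r ^+ 2 = A * r ^+ 2 + 2 * s * n.+1%:R.
  by field; rewrite gt_eqF.
have h1 : s * n.+1%:R <= s * s by rewrite ler_wpM2l//; [lra|rewrite /s; lra].
have h2 : A * r ^+ 2 <= s * s.
  by rewrite (@le_trans _ _ (s * 1))// ?ler_wpM2l//; [rewrite mulr1 /s; lra|lra].
rewrite expr2; lra.
Qed.

(* Telescoping along the line through [x] gives a point at bounded distance
   where the increment is not small; [spread] carries this back to [x]. *)
Lemma increment_lower_bound W (K M M1 A t0 t1 : R) nu :
  0 < K -> (forall x y, `|W x - W y| <= K * `|x - y|) ->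
  (forall x, last_coord x <= - M1 -> W x <= 1 / 4) ->
  (forall x, M1 <= last_coord x -> 3 / 4 <= W x) ->
  0 < last_coord nu -> 0 < t0 -> 0 < A ->
  exists2 c : R, 0 < c & forall t, t0 <= t <= t1 ->
    (forall x, 0 <= W (x + t *: nu) - W x) ->
    (exists2 F, wlap (fun x => W (x + t *: nu) - W x) F &
       forall x, F x <= A * (W (x + t *: nu) - W x)) ->
    forall x, - M <= last_coord x <= M -> c <= W (x + t *: nu) - W x.
Proof.
move=> K0 WK Wm Wp nu0 t00 A0.
have tn0 : 0 < t0 * last_coord nu by rewrite mulr_gt0.
(* For every [t >= t0], [k] steps backwards and [k] steps forwards from a point with [|x_N| <= M]
   reach the regions [x_N <= - M1] and [x_N >= M1]. *)
pose k := (Num.truncn ((M + M1) / (t0 * last_coord nu))).+1.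
have kM : M + M1 < k%:R * (t0 * last_coord nu).
  by rewrite -ltr_pdivrMr// truncnS_gt.
have k0 : 0 < k%:R :> R by [].
(* The total rise over these [2 * k] steps is at least [3 / 4 - 1 / 4 = 1 / 2], so some step rises
   by at least [c1]. *)
pose c1 : R := (4 * k%:R)^-1.
have c10 : 0 < c1 by rewrite invr_gt0 mulr_gt0.
pose r := c1 / (4 * K).
(* The increment [w] is [2 * K]-Lipschitz, so within distance [r] of such a point it remains at
   least [c1 / 2]. *)
have r0 : 0 < r by rewrite divr_gt0// mulr_gt0.
have rK : 2 * K * r = c1 / 2 by rewrite /r; field; rewrite gt_eqF.
have [a a0 aP] := exists_gaussian_rate A0 r0.
(* The second factor is the least value of the Gaussian at the distances that occur: the center
   [pt j] differs from [x] by at most [k * t1] times [nu]. *)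
exists (c1 / 2 * expR (- a * ((k%:R * t1) ^+ 2 * sq nu))).
  by rewrite mulr_gt0 ?expR_gt0 ?divr_gt0.
move=> t /andP[t0t tt1] w0 [F wF FA] x /andP[xM Mx].
pose w y := W (y + t *: nu) - W y.
have tpos : 0 < t by rewrite (lt_le_trans t00).
have wK y z : `|w y - w z| <= 2 * K * `|y - z|.
  have -> : w y - w z = (W (y + t *: nu) - W (z + t *: nu)) - (W y - W z) by rewrite /w; ring.
  rewrite (le_trans (ler_normB _ _))// mulrAC -[2]/(1 + 1) mulrDl mul1r mulrDl lerD//; last by rewrite mulrC WK.
  by rewrite (le_trans (WK _ _))// opprD addrACA subrr addr0 mulrC.
have kt : k%:R * (t0 * last_coord nu) <= k%:R * (t * last_coord nu).
  by rewrite ler_pM2l// ler_pM2r.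
pose shf (j : nat) : R := (j%:R - k%:R) * t.
pose pt (j : nat) : X := x + shf j *: nu.
have ptS j : pt j.+1 = pt j + t *: nu.
  by rewrite /pt /shf -addrA -scalerDl; congr (_ + _ *: _); rewrite -natr1; ring.
have [j jk wj] : exists2 j, (j < k + k)%N & c1 <= w (pt j).
  apply: contrapT => H.
  have lt j : (j < k + k)%N -> w (pt j) <= c1.
    move=> jk; rewrite leNgt; apply/negP => h; apply: H; exists j => //; exact: ltW.
  have : \sum_(0 <= j < k + k) w (pt j) < 1 / 2.
    have E : \sum_(0 <= j < k + k) c1 = 1 / 2.
      rewrite sumr_const_nat subn0 -(mulr_natl c1 (k + k)) natrD /c1; field; exact: lt0r_neq0.
    rewrite -E; apply: ltr_sum_nat.
      by rewrite addn_gt0.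
    move=> j /andP[_ jk]; rewrite ltNge; apply/negP => h; apply: H; by exists j.
  under eq_bigr do rewrite /w -ptS.
  rewrite telescope_sumr//.
  have y0 : W (pt 0%N) <= 1 / 4.
    apply: Wm; rewrite /pt /shf last_coordD last_coordZ sub0r; lra.
  have y1 : 3 / 4 <= W (pt (k + k)%N).
    apply: Wp; rewrite /pt /shf last_coordD last_coordZ natrD addrK; lra.
  lra.
have ball q : sq (q - pt j) <= r ^+ 2 -> c1 / 2 <= w q.
  move=> /(norm_sq (ltW r0)) qr; have h := wK q (pt j).
  have : `|w q - w (pt j)| <= 2 * K * r by rewrite (le_trans h)// ler_pM2l// mulr_gt0.
  by rewrite rK ler_norml => /andP[? ?]; lra.
have c20 : 0 < c1 / 2 by rewrite divr_gt0.
apply: le_trans (spread wF w0 A0 FA c20 a0 aP ball x).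
rewrite ler_pM2l// /gaussian ler_expR !mulNr lerN2 ler_wpM2l//.
rewrite /pt /shf opprD addNKr -scaleNr sqZ ler_wpM2r ?sq_ge0//.
rewrite -mulNr opprB !exprMn ler_pM ?sqr_ge0//; last first.
  by rewrite ler_sqr ?nnegrE//; lra.
have jk' : (j%:R : R) <= k%:R + k%:R by rewrite -natrD ler_nat ltnW.
rewrite -subr_ge0 (_ : _ - _ = j%:R * (k%:R + k%:R - j%:R)); last by ring.
by rewrite mulr_ge0// subr_ge0.
Qed.

Definition transition_layer L K U V :=
  [/\ 1 < L, 0 < K, entire_sol L U V,
      (forall x y, `|U x - U y| <= K * `|x - y|) /\
      (forall x y, `|V x - V y| <= K * `|x - y|) &
      forall e : R, 0 < e -> exists M, forall x,
        (M <= last_coord x -> 1 - e <= U x /\ V x <= e) /\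
        (last_coord x <= - M -> U x <= e /\ 1 - e <= V x)].

(** Long translates [t *: nu] are ordered because they carry the layer past itself. From there [t]
    descends to 1 by steps of fixed length. Stopping at 1 keeps [t] away from 0, where the lower
    bound on the increments degenerates; as [nu] is arbitrary, this loses nothing. *)
Lemma slide_monotone L K U V nu : transition_layer L K U V ->
  0 < last_coord nu -> forall x, U x <= U (x + nu) /\ V (x + nu) <= V x.
Proof.
move=> [L1 K0 UV [UK VK] lim] nu0.
pose slid (nu : X) := forall x, U x <= U (x + nu) /\ V (x + nu) <= V x.
rewrite -/(slid nu).
(* Then [6 * th * L = (L - 1) / L], which is at most [L - 1] and at most 1, the two smallness
   conditions of [reac_gap]. *)
pose th := (L - 1) / (6 * L ^+ 2).
have L0 : 0 < L by apply: lt_trans L1.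
have L20 : 0 < L ^+ 2 by rewrite exprn_gt0.
have th0 : 0 < th by rewrite divr_gt0 ?mulr_gt0//; lra.
have thE : 6 * th * L = (L - 1) / L by rewrite /th; field; rewrite gt_eqF.
have thL : 6 * th * L <= L - 1.
  by rewrite thE ler_pdivrMr// ler_peMr//; lra.
have thL1 : 6 * th * L <= 1 by rewrite thE ler_pdivrMr//; lra.
have [M HM] := lim _ th0.
have q0 : 0 < 1 / 4 :> R by rewrite divr_gt0.
have [M1 HM1] := lim _ q0.
have [U01 V01 lU lV] := UV.
(* Below height [- M] the pair itself is near a stable phase, and when the translated point is above
   [M] the translate is. Order has to be checked only in between. *)
have cmp t : (forall x, - M <= last_coord x <= M ->
      last_coord (x + t *: nu) < M -> U x <= U (x + t *: nu) /\ V (x + t *: nu) <= V x) ->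
    0 <= t -> slid (t *: nu).
  move=> H tp; apply: (comparison L1 th0 thL thL1 UV (entire_sol_shift (t *: nu) UV)) => x.
  have [xM|xM] := lerP (last_coord x) (- M).
    by right; left; have [_ /(_ xM)] := HM x.
  have [tM|tM] := lerP M (last_coord (x + t *: nu)).
    by right; right; have [/(_ tM)] := HM (x + t *: nu).
  left; apply: H => //; rewrite ltW//=.
  move: tM; rewrite last_coordD last_coordZ => tM.
  have : 0 <= t * last_coord nu by rewrite mulr_ge0// ltW.
  lra.
(* From [T] on, a translation lifts every point above [- M] to height at least [M], so nothing is
   left to check. *)
pose T := Num.max 0 (2 * M / last_coord nu).
have T0 : 0 <= T by rewrite le_max lexx.
have far t : T <= t -> slid (t *: nu).
  move=> Tt; apply: cmp; last exact: le_trans Tt.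
  move=> x /andP[xM _]; rewrite last_coordD last_coordZ => h.
  exfalso; move: Tt; rewrite /T ge_max => /andP[_].
  by rewrite ler_pdivrMr//; lra.
have A0 : 0 < 2 + L by lra.
have t01 : 0 < 1 :> R by [].
have [cU cU0 cUP] := @increment_lower_bound U K M M1 (2 + L) 1 (T + 1) nu K0 UK
  (fun x h => ((HM1 x).2 h).1) (fun x h => ltac:(have := ((HM1 x).1 h).1; lra)) nu0 t01 A0.
have VK' x y : `|(1 - V x) - (1 - V y)| <= K * `|x - y|.
  by rewrite (_ : _ - _ = - (V x - V y)) ?normrN//; ring.
have [cV cV0 cVP] := @increment_lower_bound (fun x => 1 - V x) K M M1 (2 + L) 1 (T + 1) nu K0 VK'
  (fun x h => ltac:(have := ((HM1 x).2 h).2; lra)) (fun x h => ltac:(have := ((HM1 x).1 h).2; lra)) nu0 t01 A0.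
pose c := Num.min cU cV.
have c0 : 0 < c by rewrite lt_min cU0.
pose d := K * `|nu| + 1.
have d0 : 0 < d by rewrite ltr_wpDl// mulr_ge0// ltW.
(* Shortening the slide by [e] changes each component by at most [K * |nu| * e <= c], the lower
   bound for the increments. The bound [e <= 1] keeps [s + e] in the range [[1, T + 1]] where [c] is
   valid. *)
pose e := Num.min 1 (c / d).
have e0 : 0 < e by rewrite lt_min ltr01 divr_gt0.
have ed : K * `|nu| * e <= c.
  have : e <= c / d by rewrite ge_min lexx orbT.
  rewrite ler_pdivlMr// /d mulrDr mulr1 mulrC; lra.
have e1 : e <= 1 by rewrite ge_min lexx.
have down s : 1 <= s -> s <= T -> slid ((s + e) *: nu) -> slid (s *: nu).
  move=> s1 sT sl; apply: cmp; last by lra.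
  move=> x xM _.
  have st : 1 <= s + e <= T + 1 by apply/andP; split; lra.
  have cc : c <= cU /\ c <= cV by rewrite !ge_min !lexx orbT.
  have sh W : (forall x y, `|W x - W y| <= K * `|x - y|) ->
      `|W (x + (s + e) *: nu) - W (x + s *: nu)| <= c.
    move=> WK; rewrite (le_trans (WK _ _))// (le_trans _ ed)//.
    rewrite opprD addrACA subrr add0r -scalerBl addrAC subrr add0r normrZ gtr0_norm//.
    by rewrite [e * _]mulrC mulrA.
  have := sh U UK; have := sh V VK; rewrite !ler_norml => /andP[v1 v2] /andP[u1 u2].
  have hU : cU <= U (x + (s + e) *: nu) - U x.
    apply: cUP => //; first by move=> y; rewrite subr_ge0; have [] := sl y.
    exists (fun y => - reac L (U (y + (s + e) *: nu)) (V (y + (s + e) *: nu)) - - reac L (U y) (V y)).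
      by apply: wlapB => //; exact: (wlap_shift _ lU).
    move=> y; rewrite opprK addrC; have [h1 h2] := sl y.
    apply: reac_mono => //; first exact: ltW.
    - by have /andP[] := U01 y.
    - by have /andP[] := U01 (y + (s + e) *: nu).
    - by have /andP[] := V01 (y + (s + e) *: nu).
    - by have /andP[] := V01 y.
  have hV : cV <= (1 - V (x + (s + e) *: nu)) - (1 - V x).
    apply: cVP => //; first by move=> y; have [_] := sl y; lra.
    exists (fun y => (0 - - reac L (V (y + (s + e) *: nu)) (U (y + (s + e) *: nu))) - (0 - - reac L (V y) (U y))).
      have l1 : wlap (fun=> 1 : R) (fun _ : X => 0 : R).
        by apply: wlap_haslap => [|z]; [exact: cst_continuous|exact: haslap_cst].
      apply: wlapB; last exact: wlapB.
      by apply: wlapB => //; exact: (wlap_shift _ lV).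
    move=> y; have [h1 h2] := sl y.
    rewrite (_ : _ - _ = reac L (V (y + (s + e) *: nu)) (U (y + (s + e) *: nu)) - reac L (V y) (U y)); last by ring.
    rewrite (_ : 1 - _ - (1 - V y) = V y - V (y + (s + e) *: nu)); last by ring.
    apply: reac_mono => //; first exact: ltW.
    - by have /andP[] := V01 (y + (s + e) *: nu).
    - by have /andP[] := V01 y.
    - by have /andP[] := U01 y.
    - by have /andP[] := U01 (y + (s + e) *: nu).
  by split; lra.
have all k s : 1 <= s -> T <= s + k%:R * e -> slid (s *: nu).
  elim: k s => [|k IH] s s1; first by rewrite mul0r addr0 => /far.
  have [sT|Ts _] := lerP s T; last exact/far/ltW.
  move=> h; apply: down => //; apply: IH; first by lra.
  by move: h; rewrite -natr1; lra.
have := all (Num.truncn (T / e)).+1 1 (lexx _); rewrite scale1r; apply.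
have : T / e < (Num.truncn (T / e)).+1%:R by exact: truncnS_gt.
by rewrite ltr_pdivrMr//; lra.
Qed.

Lemma depends_only_on_last_sol L K U V : transition_layer L K U V ->
  depends_only_on_last U /\ depends_only_on_last V.
Proof.
move=> tl; have [L1 K0 UV [UK VK] _] := tl.
pose slid (nu : X) := forall x, U x <= U (x + nu) /\ V (x + nu) <= V x.
pose E : X := delta_mx 0 ord_max.
have E1 : last_coord E = 1 by rewrite /last_coord mxE !eqxx.
have flat tau : last_coord tau = 0 -> slid tau.
  move=> tau0 x.
  have near (W : X -> R) : (forall x y, `|W x - W y| <= K * `|x - y|) ->
      forall e : R, 0 < e -> exists2 d : R, 0 < d & `|W (x + (tau + d *: E)) - W (x + tau)| <= e.
    move=> WK e e0.
    have d0 : 0 < K * `|E| + 1 by rewrite ltr_wpDl// mulr_ge0// ltW.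
    have de : 0 < e / (K * `|E| + 1) by rewrite divr_gt0.
    exists (e / (K * `|E| + 1)) => //.
    rewrite (le_trans (WK _ _))// addrA [_ + _ *: E]addrC addrK normrZ gtr0_norm//.
    rewrite mulrCA mulrAC ler_pdivrMr// ler_pM2l//; lra.
  split; apply/ler_addgt0Pr => e e0.
    have [d d0] := near U UK e e0.
    have /(slide_monotone tl)/(_ x)[h _] : 0 < last_coord (tau + d *: E).
      by rewrite last_coordD tau0 last_coordZ E1 add0r mulr1.
    by rewrite ler_norml => /andP[? ?]; lra.
  have [d d0] := near V VK e e0.
  have /(slide_monotone tl)/(_ x)[_ h] : 0 < last_coord (tau + d *: E).
    by rewrite last_coordD tau0 last_coordZ E1 add0r mulr1.
  by rewrite ler_norml => /andP[? ?]; lra.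
(* Horizontal vectors come in opposite pairs, so [flat] applied to [y - x] and [x - y] gives
   equalities. *)
have lastB (x y : X) : last_coord x = last_coord y -> last_coord (y - x) = 0.
  by move=> xy; rewrite last_coordD -scaleN1r last_coordZ mulN1r xy subrr.
split=> x y xy.
  apply/eqP; rewrite eq_le; apply/andP; split.
    by have [] := flat _ (lastB _ _ xy) x; rewrite addrC subrK.
  by have [] := flat _ (lastB _ _ (esym xy)) y; rewrite addrC subrK.
apply/eqP; rewrite eq_le; apply/andP; split.
  by have [_] := flat _ (lastB _ _ (esym xy)) y; rewrite addrC subrK.
by have [_] := flat _ (lastB _ _ xy) x; rewrite addrC subrK.
Qed.

End sliding.

Lemma continuous_oppr {R : realType} {T : topologicalType} (f : T -> R) :
  continuous f -> continuous (fun x => - f x).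
Proof. by move=> cf x; exact: (cvgN (cf x)). Qed.

(** * One-dimensional profiles *)

Section antiderivative.
Context {R : realType}.
Implicit Types (f g : R -> R).

Lemma mvt_is_derive f f1 (a b : R) : (forall x : R, is_derive x 1 f (f1 x)) ->
  a < b -> exists2 c, a < c < b & f b - f a = f1 c * (b - a).
Proof.
move=> df ab; have [|c] := @MVT R f f1 _ _ ab (fun x _ => df x).
  by apply: continuous_subspaceT; exact: continuous_is_derive df.
by rewrite in_itv/= => cab E; exists c.
Qed.

Let antiderivative_gt f (a : R) : continuous f ->
  exists g, forall x : R, a < x -> is_derive x 1 g (f x).
Proof.
move=> cf; exists (fun x => \int[lebesgue_measure]_(t in `[a, x]) f t) => x ax.
have xx1 : x < x + 1 by rewrite ltrDl.
have [|d <-] := @continuous_FTC1_closed R f a x (x + 1) xx1 _ ax (cf x).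
  apply: continuous_compact_integrable; first exact: segment_compact.
  exact: continuous_subspaceT.
by rewrite derive1E; exact: DeriveDef.
Qed.

(** Integration from a base point gives a primitive on a right half-line only. A second one,
    obtained by reflection, covers a left half-line; on the overlap the two differ by a constant,
    and they are glued at 0. *)
Lemma antiderivative f : continuous f -> exists g, forall x : R, is_derive x 1 g (f x).
Proof.
move=> cf; have [A dA] := antiderivative_gt (-1) cf.
have cfN : continuous (fun x : R => f (- x)).
  exact: (continuous_compose (continuous_oppr continuous_idr) cf).
have [B0 dB0] := antiderivative_gt (-1) cfN.
pose B x := - B0 (- x).
have dB (x : R) : x < 1 -> is_derive x 1 B (f x).
  move=> x1; have h : is_derive (- x) 1 B0 (f (- - x)) by apply: dB0; rewrite ltrN2.
  rewrite opprK in h.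
  have hN : is_derive x 1 (-%R : R -> R) (-1) by apply: is_derive_eq.
  have := is_derive1_comp h hN; rewrite mulrN1 => hc.
  by have := is_deriveN hc; rewrite opprK.
have cst (x : R) : -1 < x -> x < 0 -> B x - B 0 = A x - A 0.
  move=> x1 x0.
  have dAB (y : R) : y \in `]x, 0[%R -> is_derive y 1 (fun y => A y - B y) 0.
    rewrite in_itv/= => /andP[xy y0].
    have hA : is_derive y 1 A (f y) by apply: dA; lra.
    have hB : is_derive y 1 B (f y) by apply: dB; lra.
    by apply: is_derive_eq; rewrite subrr.
  have cAB : {within `[x, 0], continuous (fun y => A y - B y)}.
    apply: derivable_within_continuous => y; rewrite in_itv/= => /andP[xy y0].
    have [hA _] : is_derive y 1 A (f y) by apply: dA; lra.
    have [hB _] : is_derive y 1 B (f y) by apply: dB; lra.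
    exact: derivableB.
  have [c _] := MVT x0 dAB cAB; rewrite mul0r; lra.
exists (fun x => if 0 <= x then A x - A 0 else B x - B 0) => x.
have [x0|x0] := ltrP x 0.
  apply: (@near_eq_is_derive _ _ _ (fun y => B y - B 0)).
    near=> y; rewrite ifF//; apply/negbTE; rewrite -ltNge; near: y.
    exact: lt_nbhsl.
  have hB : is_derive x 1 B (f x) by apply: dB; lra.
  by apply: is_derive_eq; rewrite subr0.
apply: (@near_eq_is_derive _ _ _ (fun y => A y - A 0)).
  near=> y; have [//|y0] := lerP 0 y; rewrite cst//; near: y.
  apply: lt_nbhsr; lra.
have hA : is_derive x 1 A (f x) by apply: dA; lra.
by apply: is_derive_eq; rewrite subr0.
Unshelve. all: by end_near. Qed.

(** The algebra generated by [fs]. If it contains the derivatives of its generators it is closed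
    under differentiation, which gives derivatives of all orders without formulas for them. *)
Inductive polynomial_in (fs : set (R -> R)) : (R -> R) -> Prop :=
| pi_cst c : polynomial_in fs (fun=> c)
| pi_base f : fs f -> polynomial_in fs f
| pi_add f g : polynomial_in fs f -> polynomial_in fs g ->
    polynomial_in fs (fun x => f x + g x)
| pi_mul f g : polynomial_in fs f -> polynomial_in fs g ->
    polynomial_in fs (fun x => f x * g x).

Lemma polynomial_in_derive fs :
  (forall f, fs f -> exists2 f1, polynomial_in fs f1 & forall x : R, is_derive x 1 f (f1 x)) ->
  forall f, polynomial_in fs f ->
    exists2 f1, polynomial_in fs f1 & forall x : R, is_derive x 1 f (f1 x).
Proof.
move=> H f; elim=> [c|{}f /H//|{}f g hf [f1 f1P df] hg [g1 g1P dg]|{}f g hf [f1 f1P df] hg [g1 g1P dg]].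
- by exists (fun=> 0); [exact: pi_cst|move=> x; exact: is_derive_cst].
- exists (fun x => f1 x + g1 x); first exact: pi_add.
  by move=> x; have ? := df x; have ? := dg x; apply: is_derive_eq.
- exists (fun x => f x * g1 x + g x * f1 x); first by apply: pi_add; exact: pi_mul.
  by move=> x; have ? := df x; have ? := dg x; apply: is_derive_eq.
Qed.

End antiderivative.

Section smoothness.
Context {R : realType} {n : nat}.
Local Notation X := 'rV[R]_n.

Lemma is_derive_slice (g : X -> R) (f : R -> R) (x : X) i (s d : R) :
  (forall t, g (x + t *: delta_mx 0 i) = f (s + t)) ->
  is_derive s 1 f d -> is_derive x (delta_mx 0 i : X) g d.
Proof.
move=> gf [df fd].
have E : (fun h : R => h^-1 *: ((g \o shift x) (h *: (delta_mx 0 i : X)) - g x)) =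
         (fun h : R => h^-1 *: ((f \o shift s) (h *: (1 : R)) - f s)).
  have gx : g x = f s by rewrite -[s]addr0 -gf scale0r addr0.
  apply/funext => h /=; rewrite [h *: _ + x]addrC gf gx.
  by rewrite [h *: _ + s]addrC [h *: (1 : R)]mulr1.
by apply: DeriveDef; rewrite /derivable/derive E.
Qed.

(** Iterated partial derivatives never leave [C]. The criterion is used for polynomials in the
    profiles and for products of one-variable bumps. *)
Lemma smooth_of_stable (C : set (X -> R)) :
  (forall g, C g -> continuous g /\
     forall i, exists2 g1, C g1 & forall x, is_derive x (delta_mx 0 i : X) g (g1 x)) ->
  forall g, C g -> smooth g.
Proof.
move=> H g Cg s.
have Cs : C (foldr (@partial R n) g s).
  elim: s => // i s /H[_ /(_ i)[g1 Cg1 dg1]] /=.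
  by rewrite (_ : partial _ _ = g1)//; apply/funext => x; have [_] := dg1 x.
have [cg dg] := H _ Cs; split=> // i x.
by have [g1 _ /(_ x)[]] := dg i.
Qed.

End smoothness.

Section layer.
Context {R : realType} {n : nat}.
Local Notation X := 'rV[R]_n.+1.
Implicit Types (f r p q : R -> R) (s : R).
Local Notation E := (delta_mx 0 ord_max : X).

Lemma last_coord_axis (x : X) i (t : R) :
  last_coord (x + t *: delta_mx 0 i) = last_coord x + (i == ord_max)%:R * t.
Proof. by rewrite /last_coord !mxE eqxx/= eq_sym mulrC. Qed.

Lemma last_coordE (s : R) : last_coord (s *: E) = s.
Proof. by rewrite /last_coord !mxE !eqxx mulr1. Qed.

Lemma continuous_last_coord : continuous (@last_coord R n).
Proof. by move=> x; exact: coord_continuous. Qed.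

Lemma is_derive_last f f1 i (x : X) : (forall s : R, is_derive s 1 f (f1 s)) ->
  is_derive x (delta_mx 0 i : X) (f \o last_coord) ((i == ord_max)%:R * f1 (last_coord x)).
Proof.
move=> df; apply: (@is_derive_slice _ _ _ (fun t => f ((i == ord_max)%:R * t + last_coord x)) _ _ 0).
  by move=> t; rewrite /= last_coord_axis add0r addrC.
by have := is_derive_comp_affine (i == ord_max)%:R (last_coord x) df 0; rewrite mulr0 add0r.
Qed.

Lemma smooth_last fs f :
  (forall f, fs f -> exists2 f1, polynomial_in fs f1 & forall x : R, is_derive x 1 f (f1 x)) ->
  fs f -> smooth (f \o @last_coord R n).
Proof.
move=> H ff.
apply: (@smooth_of_stable _ _ [set g | exists2 f, polynomial_in fs f & g = f \o last_coord]).
  move=> _ [{ff}f /(polynomial_in_derive H)[f1 f1P df] ->]; split.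
    exact: (continuous_compose continuous_last_coord (continuous_is_derive df)).
  move=> i; exists (fun x => (i == ord_max)%:R * f1 (last_coord x)).
    by exists (fun s => (i == ord_max)%:R * f1 s) => //; apply: pi_mul => //; exact: pi_cst.
  by move=> x; exact: is_derive_last.
by exists f => //; exact: pi_base.
Qed.

Lemma haslap_last f f1 f2 (x : X) :
  (forall s : R, is_derive s 1 f (f1 s)) ->
  (forall s : R, is_derive s 1 f1 (f2 s)) -> continuous f2 ->
  haslap (f \o last_coord) (f2 (last_coord x)) x.
Proof. exact: haslap_coord. Qed.

(** Adding [d * ((t - a) * (t - b))], which vanishes at both ends, to the difference of [r] and its
    chord makes the Laplacian [2 * d > 0]. The maximum principle on the strip then locates its
    near-maxima on the faces, where the sum is 0. *)
Let below_chord (r : R -> R) (a b s : R) : continuous r ->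
  wlap (r \o last_coord) (fun _ : X => 0) -> a < b -> a <= s <= b ->
  r s <= r a + (r b - r a) / (b - a) * (s - a).
Proof.
move=> cr lr ab /andP[as_ sb].
pose k := (r b - r a) / (b - a).
have kE : k * (b - a) = r b - r a by rewrite divfK// subr_eq0 gt_eqF.
rewrite -/k -subr_le0; apply/ler_addgt0Pr => e0 e00; rewrite add0r.
(* The added term is at least [- d * (b - a) ^+ 2 = - e0] on the interval, so removing it costs at
   most [e0]. *)
pose d := e0 / (b - a) ^+ 2.
have ba0 : 0 < (b - a) ^+ 2 by rewrite exprn_gt0// subr_gt0.
have d0 : 0 < d by rewrite divr_gt0.
have dE : d * (b - a) ^+ 2 = e0 by rewrite divfK// gt_eqF.
pose f t := d * ((t - a) * (t - b)) - (r a + k * (t - a)).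
pose f1 t := d * (2 * t - a - b) - k.
pose f2 (t : R) := 2 * d.
have df (t : R) : is_derive t 1 f (f1 t).
  by apply: is_derive_eq; rewrite /f1 /GRing.scale/= /GRing.scale/=; ring.
have df1 (t : R) : is_derive t 1 f1 (f2 t).
  by apply: is_derive_eq; rewrite /f2 /GRing.scale/= /GRing.scale/=; ring.
have cf := continuous_is_derive df.
pose g t := r t + f t.
have cg : continuous g by exact: continuous_add.
have lg : wlap (fun x : X => r (last_coord x) + f (last_coord x)) (fun _ : X => 0 + 2 * d).
  apply: wlapD => //; apply: wlap_haslap.
    exact: (continuous_compose continuous_last_coord cf).
  by move=> x; apply: (@haslap_last f f1 f2 x df df1); exact: cst_continuous.
have [c cab cmax] := EVT_max (ltW ab) (continuous_subspaceT cg).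
pose D : set X := strip ord_max a b.
have gB x : D x -> r (last_coord x) + f (last_coord x) <= g c /\ r (last_coord x) + f (last_coord x) <= g c.
  by move=> Dx; split; apply: cmax; rewrite in_itv.
have Ds : D (s *: E) by rewrite /D/strip/= -/(last_coord _) last_coordE as_.
have gs e : 0 < e -> e < 2 * d -> g s <= e.
  move=> e_0 ed.
  have [x Dx M] := max_principle (@closed_strip _ _ ord_max a b) lg lg gB Ds e_0.
  rewrite last_coordE -/(g s) -/(g _) in M.
  have [gx bx] : g s - e <= g (last_coord x) /\ (0 + 2 * d <= e \/ ~ D° x) by case: M => -[].
  have {bx} : last_coord x = a \/ last_coord x = b.
    by case: bx => [|nx]; [lra|exact: interior_strip Dx nx].
  case=> xE; move: gx; rewrite xE /g /f.
    by rewrite !subrr mul0r !mulr0; lra.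
  by rewrite !subrr !mulr0 kE; lra.
have g0 : g s <= 0.
  apply/ler_addgt0Pr => e e_0; rewrite add0r.
  have m0 : 0 < Num.min e d by rewrite lt_min e_0.
  have me : Num.min e d <= e by rewrite ge_min lexx.
  have md : Num.min e d <= d by rewrite ge_min lexx orbT.
  apply: le_trans me; apply: gs => //; lra.
have : (s - a) * (b - s) <= (b - a) ^+ 2 by rewrite expr2 ler_pM//; lra.
move=> /(ler_wpM2l (ltW d0)); rewrite dE; move: g0; rewrite /g /f; lra.
Qed.

(* Schwarz's theorem on functions with vanishing second difference. *)
Lemma wlap0_affine (r : R -> R) : continuous r -> wlap (r \o last_coord) (fun _ : X => 0) ->
  exists k : R, forall s : R, r s = r 0 + k * s.
Proof.
move=> cr lr.
have crN : continuous (fun s => 0 - r s) by apply: continuous_sub => //; exact: cst_continuous.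
have lrN : wlap ((fun s => 0 - r s) \o last_coord) (fun _ : X => 0).
  have := wlapN lr; rewrite oppr0.
  by rewrite (_ : (fun x => _) = (fun s => 0 - r s) \o last_coord)//; apply/funext => x; rewrite /= sub0r.
have chord a b s : a < b -> a <= s <= b -> (r s - r a) * (b - a) = (r b - r a) * (s - a).
  move=> ab asb; have ba : 0 < b - a by rewrite subr_gt0.
  have := below_chord cr lr ab asb; have := below_chord crN lrN ab asb.
  rewrite -(ler_pM2r ba) => h1; rewrite -(ler_pM2r ba) => h2.
  have E1 u : u / (b - a) * (s - a) * (b - a) = u * (s - a) by field; rewrite gt_eqF.
  by move: h1 h2; rewrite !mulrDl !E1; lra.
exists (r 1 - r 0) => s.
have [s0|s0] := ltrP s 0.
  have s01 : s <= 0 <= (1 : R) by rewrite ltW//=.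
  have s1 : s < 1 by lra.
  by have := chord s 1 0 s1 s01; lra.
have [s1|s1] := lerP s 1.
  have s01 : 0 <= s <= 1 by rewrite s0.
  by have := chord 0 1 s ltr01 s01; lra.
have s01 : 0 <= (1 : R) <= s by rewrite ler01 ltW.
have s0' : 0 < s by lra.
by have := chord 0 s 1 s0' s01; lra.
Qed.

(** Subtracting a second primitive of [f] leaves a function with weak Laplacian 0, hence affine.
    This is where the weak Laplacian becomes a classical second derivative. *)
Lemma wlap_last_C2 (p f : R -> R) : continuous p -> continuous f ->
  wlap (p \o last_coord) (f \o last_coord : X -> R) ->
  exists2 p1 : R -> R, forall s : R, is_derive s 1 p (p1 s) & forall s : R, is_derive s 1 p1 (f s).
Proof.
move=> cp cf lp.
have [h dh] := antiderivative cf.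
have [g dg] := antiderivative (continuous_is_derive dh).
have cg := continuous_is_derive dg.
pose r s := p s - g s.
have cr : continuous r by exact: continuous_sub.
have lr : wlap (r \o last_coord) (fun _ : X => 0).
  have lg : wlap (g \o last_coord) (f \o last_coord : X -> R).
    apply: wlap_haslap; first exact: (continuous_compose continuous_last_coord cg).
    by move=> x; exact: (@haslap_last g h f x dg dh).
  by have := wlapB lp lg; rewrite (_ : (fun x => _ - (f \o last_coord) x) = (fun=> 0))//; apply/funext => x; rewrite subrr.
have [k rk] := wlap0_affine cr lr.
have pE : p = (fun s => g s + (r 0 + k * s)).
  by apply/funext => s; rewrite -rk /r; ring.
exists (fun s => h s + k) => s; last first.
  by have ? := dh s; apply: is_derive_eq; rewrite addr0.
rewrite pE; have ? := dg s; apply: is_derive_eq.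
by rewrite /GRing.scale/=; ring.
Qed.

(** A quantitative strong maximum principle for increments in place of the derivative: around a
    point [s1] with [p1 s1 > 0] the increment over length [t] is at least [t * m], and [spread]
    carries this to every point with a Gaussian factor independent of [t]. Dividing by [t] bounds
    [p1] below. *)
Lemma derivative_gt0 (p p1 : R -> R) (A : R) : 0 < A -> continuous p1 ->
  (forall s : R, is_derive s 1 p (p1 s)) ->
  (forall t : R, 0 < t -> exists2 F : X -> R,
     wlap (fun x => p (last_coord (x + t *: E)) - p (last_coord x)) F &
     forall x, F x <= A * (p (last_coord (x + t *: E)) - p (last_coord x))) ->
  (forall s t, s <= t -> p s <= p t) -> (exists s t, p s < p t) ->
  forall s, 0 < p1 s.
Proof.
move=> A0 cp1 dp lp pm [a [b pab]].
have ab : a < b by rewrite ltNge; apply/negP => /pm; rewrite leNgt pab.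
have [s1 _ s1E] := mvt_is_derive dp ab.
have p1s1 : 0 < p1 s1.
  by rewrite -(@pmulr_lgt0 _ (b - a)) ?subr_gt0// -s1E subr_gt0.
pose m := p1 s1 / 2.
have m0 : 0 < m by rewrite divr_gt0.
have mE : p1 s1 = m + m by rewrite /m -splitr.
have /cvgrPdist_lt/(_ m m0)/nbhs_ballP[d /= d0 dP] := cp1 s1.
have near1 s : `|s - s1| < d -> m <= p1 s.
  move=> sd; have /= := dP s; rewrite /ball/= distrC => /(_ sd).
  by rewrite ltr_norml mE => /andP[? ?]; lra.
pose r := d / 2; have r0 : 0 < r by rewrite divr_gt0.
have [c c0 cP] := @exists_gaussian_rate R n A r A0 r0.
have lower t : 0 < t -> t < r -> forall x : X,
    t * m * gaussian c (s1 *: E) x <= p (last_coord (x + t *: E)) - p (last_coord x).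
  move=> t0 tr; have [F lF FA] := lp t t0.
  have lastt (x : X) : last_coord (x + t *: E) = last_coord x + t.
    by rewrite last_coordD last_coordE.
  apply: (spread lF _ A0 FA _ c0 cP).
  - by move=> x; rewrite subr_ge0 pm// lastt lerDl ltW.
  - by rewrite mulr_gt0.
  - move=> x /(norm_sq (ltW r0)) xr; rewrite lastt.
    have xs : `|last_coord x - s1| <= r.
      apply: le_trans xr; apply: le_trans (norm_coord _ ord_max).
      by rewrite !mxE !eqxx mulr1.
    have tt : last_coord x < last_coord x + t by rewrite ltrDl.
    have [z /andP[z1 z2] ->] := mvt_is_derive dp tt.
    rewrite [_ + t]addrC addrK mulrC ler_pM2r//; apply: near1.
    by move: xs tr; rewrite ler_norml ltr_norml /r => /andP[? ?] ?; apply/andP; split; lra.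
move=> s; pose k := m * gaussian c (s1 *: E) (s *: E).
have k0 : 0 < k by rewrite mulr_gt0// gaussian_gt0.
suff : k <= p1 s by apply: lt_le_trans.
rewrite leNgt; apply/negP => ks.
have pk0 : 0 < k - p1 s by rewrite subr_gt0.
have /cvgrPdist_lt/(_ _ pk0)/nbhs_ballP[e /= e0 eP] := cp1 s.
(* So short that [p1 < k] on the interval from [s] to [s + t], whereas the mean value theorem and
   [lower] give a point of it with [p1 >= k]. *)
pose t := Num.min (r / 2) e.
have t0 : 0 < t by rewrite lt_min e0 divr_gt0.
have tr : t <= r / 2 by rewrite ge_min lexx.
have te : t <= e by rewrite ge_min lexx orbT.
have tr' : t < r by lra.
have := lower t t0 tr' (s *: E).
rewrite last_coordD !last_coordE -mulrA -/k.
have tt : s < s + t by rewrite ltrDl.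
have [z /andP[z1 z2] ->] := mvt_is_derive dp tt.
rewrite [_ + t]addrC addrK mulrC ler_pM2r//.
have /= := eP z; rewrite /ball/= => H.
have : `|s - z| < e by rewrite ltr_norml; apply/andP; split; lra.
by move=> /H; rewrite ltr_norml => /andP[? ?]; lra.
Qed.

Lemma transition_layer_smooth_monotone L K (U V : X -> R) : transition_layer L K U V ->
  [/\ smooth U /\ smooth V, depends_only_on_last U /\ depends_only_on_last V &
      forall x, 0 < partial ord_max U x /\ partial ord_max V x < 0].
Proof.
move=> tl; have [L1 K0 [U01 V01 lU lV] [UK VK] lim] := tl.
have [dU dV] := depends_only_on_last_sol tl.
pose p s := U (s *: E); pose q s := V (s *: E).
have UE : U = p \o last_coord by apply/funext => x; apply: dU; rewrite last_coordE.
have VE : V = q \o last_coord by apply/funext => x; apply: dV; rewrite last_coordE.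
have cnt (W : X -> R) : (forall x y, `|W x - W y| <= K * `|x - y|) -> continuous (fun s : R => W (s *: E)).
  move=> WK s; apply/cvgrPdist_lt => e e0.
  have d0 : 0 < K * `|E| + 1 by rewrite ltr_wpDl// mulr_ge0// ltW.
  apply/nbhs_ballP; exists (e / (K * `|E| + 1)); first by rewrite /= divr_gt0.
  move=> t /=; rewrite /ball/= => st; rewrite (le_lt_trans (WK _ _))//.
  rewrite -scalerBl normrZ.
  have : `|s - t| * (K * `|E|) <= `|s - t| * (K * `|E| + 1) by rewrite ler_wpM2l// lerDl.
  by move: st; rewrite ltr_pdivlMr//; lra.
have cp := cnt U UK; have cq := cnt V VK.
have creac f g : continuous f -> continuous g -> continuous (fun s : R => - reac L (f s) (g s)).
  move=> cf cg; apply: continuous_oppr.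
  apply: continuous_sub; last first.
    apply: continuous_mul; first exact: continuous_scale.
    exact: (continuous_compose cg (@exprn_continuous R 2)).
  by apply: continuous_sub => //; exact: (continuous_compose cf (@exprn_continuous R 3)).
have [p1 dp dp1] : exists2 p1, forall s : R, is_derive s 1 p (p1 s) &
    forall s : R, is_derive s 1 p1 (- reac L (p s) (q s)).
  by apply: wlap_last_C2 => //; [exact: creac|rewrite UE VE in lU].
have [q1 dq dq1] : exists2 q1, forall s : R, is_derive s 1 q (q1 s) &
    forall s : R, is_derive s 1 q1 (- reac L (q s) (p s)).
  by apply: wlap_last_C2 => //; [exact: creac|rewrite UE VE in lV].
(* By the two second-order equations, the derivatives of these four functions are polynomials in
   them. *)
pose fs : set (R -> R) := [set f | [\/ f = p, f = q, f = p1 | f = q1]].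
have base f : fs f -> polynomial_in fs f by exact: pi_base.
have reacP f g : fs f -> fs g -> polynomial_in fs (fun s => - reac L (f s) (g s)).
  move=> /base ff /base gg.
  rewrite (_ : (fun s => _) = (fun s => -1 * f s + (f s * (f s * f s) + L * (f s * (g s * g s))))); last first.
    by apply/funext => s; rewrite /reac; ring.
  apply: pi_add; first by apply: pi_mul => //; exact: pi_cst.
  apply: pi_add; first by do 2! apply: pi_mul => //.
  by apply: pi_mul; [exact: pi_cst|do 2! apply: pi_mul => //].
have fsP f : fs f -> exists2 f1, polynomial_in fs f1 & forall x : R, is_derive x 1 f (f1 x).
  case=> ->.
  - by exists p1 => //; apply: base; exact: Or43.
  - by exists q1 => //; apply: base; exact: Or44.
  - by exists (fun s => - reac L (p s) (q s)) => //; apply: reacP; [exact: Or41|exact: Or42].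
  - by exists (fun s => - reac L (q s) (p s)) => //; apply: reacP; [exact: Or42|exact: Or41].
have slid (t : R) : 0 < t -> forall x, U x <= U (x + t *: E) /\ V (x + t *: E) <= V x.
  by move=> t0; apply: (slide_monotone tl); rewrite last_coordE.
have mono s t : s <= t -> p s <= p t /\ q t <= q s.
  rewrite le_eqVlt => /predU1P[->//|st].
  have ts : 0 < t - s by rewrite subr_gt0.
  have := slid _ ts (s *: E); rewrite -scalerDl.
  by rewrite (_ : s + (t - s) = t)//; ring.
have e4 : 0 < 1 / 4 :> R by rewrite divr_gt0.
have [M HM] := lim _ e4.
have [ups _] := HM (M *: E); have [_ downs] := HM ((- M) *: E).
have {ups} [pM qM] : 1 - 1 / 4 <= p M /\ q M <= 1 / 4 by apply: ups; rewrite last_coordE.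
have {downs} [pM' qM'] : p (- M) <= 1 / 4 /\ 1 - 1 / 4 <= q (- M) by apply: downs; rewrite last_coordE.
have A0 : 0 < 2 + L by lra.
have L0 : 0 <= L by lra.
have p1_gt0 : forall s, 0 < p1 s.
  apply: (@derivative_gt0 p p1 (2 + L) A0 (continuous_is_derive dp1) dp); last 2 first.
  - by move=> s t /mono[].
  - by exists (- M), M; lra.
  move=> t t0.
  exists (fun x => - reac L (U (x + t *: E)) (V (x + t *: E)) - - reac L (U x) (V x)).
    by rewrite -[fun x => p _ - p _]/(fun x => (p \o last_coord) (x + t *: E) - (p \o last_coord) x) -UE; apply: wlapB => //; exact: (wlap_shift _ lU).
  move=> x; rewrite opprK addrC -[p (last_coord (x + t *: E))]/((p \o last_coord) (x + t *: E)) -[p (last_coord x)]/((p \o last_coord) x) -UE.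
  have [h1 h2] := slid t t0 x; have /andP[? ?] := U01 x; have /andP[? ?] := U01 (x + t *: E).
  by have /andP[? ?] := V01 x; have /andP[? ?] := V01 (x + t *: E); exact: reac_mono.
(* The decreasing profile is treated through [- q], whose increments obey the same one-sided
   inequality with the species exchanged. *)
have dqN (s : R) : is_derive s 1 (fun s => - q s) (- q1 s) by exact: is_deriveN (dq s).
have q1_gt0 : forall s, 0 < - q1 s.
  apply: (@derivative_gt0 (fun s => - q s) (fun s => - q1 s) (2 + L) A0 _ dqN); last 2 first.
  - by move=> s t /mono[_]; rewrite lerN2.
  - by exists (- M), M; lra.
  - by apply: continuous_oppr; exact: continuous_is_derive dq1.
  move=> t t0.
  exists (fun x => - - reac L (V (x + t *: E)) (U (x + t *: E)) - - - reac L (V x) (U x)).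
    rewrite -[fun x => - q _ - - q _]/(fun x => - (q \o last_coord) (x + t *: E) - - (q \o last_coord) x) -VE.
    by apply: wlapB; apply: wlapN => //; exact: (wlap_shift _ lV).
  move=> x; rewrite !opprK addrC -[q (last_coord (x + t *: E))]/((q \o last_coord) (x + t *: E)) -[q (last_coord x)]/((q \o last_coord) x) -VE.
  have [h1 h2] := slid t t0 x; have /andP[? ?] := U01 x; have /andP[? ?] := U01 (x + t *: E).
  rewrite [X in _ <= _ * X]addrC [X in X <= _]addrC.
  by have /andP[? ?] := V01 x; have /andP[? ?] := V01 (x + t *: E); exact: reac_mono.
split.
- split; first by rewrite UE; apply: (smooth_last fsP); exact: Or41.
  by rewrite VE; apply: (smooth_last fsP); exact: Or42.
- by [].
- move=> x; rewrite /partial; split.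
    have [_ ->] : is_derive x E U ((ord_max == ord_max :> 'I_n.+1)%:R * p1 (last_coord x)).
      by rewrite UE; exact: is_derive_last.
    by rewrite eqxx mul1r.
  have [_ ->] : is_derive x E V ((ord_max == ord_max :> 'I_n.+1)%:R * q1 (last_coord x)).
    by rewrite VE; exact: is_derive_last.
  by rewrite eqxx mul1r -oppr_gt0.
Qed.

End layer.

(** * Mollifiers *)

Section smooth_bump.
Context {R : realType}.
Implicit Types (m : nat) (P : {poly R}) (t : R).

(** The parameters [m] and [P] make the family closed under differentiation. The standard bump is
    the member with [m = 0] and [P = 1]. *)
Definition smooth_bump m P t : R :=
  if `|t| < 1 then P.[t] / (1 - t ^+ 2) ^+ m * expR (- (1 - t ^+ 2)^-1) else 0.

Lemma bump_gt0 t : `|t| < 1 -> 0 < 1 - t ^+ 2.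
Proof.
by move=> t1; rewrite subr_gt0 -real_normK ?num_real// expr_lt1.
Qed.

Lemma bump_bound m P :
  exists2 C : R, 0 <= C & forall t, `|smooth_bump m P t| <= C * (1 - t ^+ 2) ^+ 2.
Proof.
pose CP := \sum_(i < size P) `|P`_i|.
have CP0 : 0 <= CP by exact: sumr_ge0.
have f0 : 0 < (m.+2)`!%:R :> R by rewrite ltr0n fact_gt0.
exists (CP * (m.+2)`!%:R) => [|t]; first by rewrite mulr_ge0// ltW.
rewrite /smooth_bump; case: ifPn => t1; last first.
  by rewrite normr0 mulr_ge0 ?sqr_ge0// mulr_ge0// ltW.
have d0 := bump_gt0 t1; set d := 1 - t ^+ 2 in d0 *.
have PC : `|P.[t]| <= CP.
  rewrite horner_coef (le_trans (ler_norm_sum _ _ _))// ler_sum// => i _.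
  by rewrite normrM normrX ler_piMr// exprn_ile1// ltW.
have dV0 : 0 < d^-1 by rewrite invr_gt0.
have e0 := expR_gt0 d^-1.
have eP : expR (- d^-1) <= (m.+2)`!%:R * d ^+ m.+2.
  have a0 : 0 < (m.+2)`!%:R * d ^+ m.+2 by rewrite mulr_gt0// exprn_gt0.
  rewrite expRN -[leRHS]invrK lef_pV2 ?posrE ?invr_gt0// invfM -exprVn mulrC.
  by apply: le_trans (expR_ge1Dxn m.+1 (ltW dV0)); rewrite lerDr.
rewrite normrM normf_div [in `|d ^+ m|]gtr0_norm ?exprn_gt0// [`|expR _|]gtr0_norm ?expR_gt0//.
apply: (@le_trans _ _ (CP / d ^+ m * ((m.+2)`!%:R * d ^+ m.+2))).
  apply: ler_pM => //; last by rewrite ler_pM2r// invr_gt0 exprn_gt0.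
  by rewrite divr_ge0// exprn_ge0// ltW.
rewrite le_eqVlt; apply/orP; left; apply/eqP.
have -> : d ^+ m.+2 = d ^+ m * d ^+ 2 by rewrite -exprD addn2.
by field; rewrite expf_neq0// gt_eqF.
Qed.

Lemma bump_bounded m P : exists2 C : R, 0 <= C & forall t, `|smooth_bump m P t| <= C.
Proof.
have [C C0 CP] := bump_bound m P; exists C => // t.
have [t1|t1] := boolP (`|t| < 1); last by rewrite /smooth_bump (negbTE t1) normr0.
have d0 := bump_gt0 t1; rewrite (le_trans (CP t))// ler_piMr// exprn_ile1 ?(ltW d0)//.
by have := sqr_ge0 t; lra.
Qed.

Let is_derive_quadratic (f : R -> R) t (C : R) :
  0 <= C -> (forall s, `|f s - f t| <= C * (s - t) ^+ 2) -> is_derive t 1 f 0.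
Proof.
move=> C0 fC.
have H : (fun h : R => h^-1 *: ((f \o shift t) (h *: (1 : R)) - f t)) h @[h --> 0^'] --> (0 : R).
  apply/cvgrPdist_le => e e0; near=> h.
  rewrite sub0r normrN /= [h *: (1 : R)]mulr1 normrM normfV.
  have h0 : 0 < `|h| by rewrite normr_gt0; near: h; exact: nbhs_dnbhs_neq.
  rewrite mulrC ler_pdivrMr// (le_trans (fC _))// addrK -real_normK ?num_real//.
  rewrite expr2 mulrA ler_pM2r//.
  have hC : `|h| <= e / (C + 1).
    near: h; apply: dnbhs0_le; rewrite divr_gt0// ltr_wpDl//.
  have C1 : 0 < C + 1 by rewrite ltr_wpDl.
  move: hC; rewrite ler_pdivlMr// mulrDr mulr1; have := normr_ge0 h; lra.
apply: DeriveDef; first by apply/cvg_ex; exists 0.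
exact: cvg_lim H.
Unshelve. all: by end_near. Qed.

(** Numerator of the derivative over [(1 - t ^+ 2) ^+ m.+2]; the three terms come from [P], from the
    power and from the exponential. *)
Definition bump_poly m P : {poly R} :=
  P^`() * (1%:P - 'X^2) ^+ 2 + (2 * m%:R)%:P * 'X * P * (1%:P - 'X^2) - 2%:P * 'X * P.

Lemma is_derive_bump m P t : is_derive t 1 (smooth_bump m P) (smooth_bump m.+2 (bump_poly m P) t).
Proof.
have [t1|t1|t1] := ltrgtP `|t| 1.
- pose u (s : R) := 1 - s ^+ 2; pose v (s : R) := (u s)^-1.
  pose g (s : R) := P.[s] * v s ^+ m * expR (- v s).
  apply: (@near_eq_is_derive _ _ _ g).
    near=> s; rewrite /g /v /u /smooth_bump ifT ?exprVn//; near: s.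
    exact: (@cvgr_norm_lt _ _ _ (nbhs t) _ id t cvg_id 1 t1).
  have u0 : u t != 0 by rewrite gt_eqF// bump_gt0.
  have v0 : v t != 0 by rewrite invr_eq0.
  have du : is_derive t 1 u (- (2 * t)).
    by apply: is_derive_eq; rewrite /GRing.scale/= /GRing.scale/=; ring.
  have dv : is_derive t 1 v (2 * t * v t ^+ 2).
    have := is_deriveV u0 du; rewrite /GRing.scale/= /v exprVn.
    by rewrite mulrNN mulrC.
  have de : is_derive t 1 (fun s => expR (- v s)) (- (2 * t * v t ^+ 2) * expR (- v t)).
    have := @is_derive1_comp _ expR (fun s => - v s) t _ _ (is_derive_expR (- v t)) (is_deriveN dv).
    by rewrite [expR _ * _]mulrC.
  have dvm : is_derive t 1 (fun s => v s ^+ m) (m%:R * (2 * t) * v t ^+ m.+1).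
    have := is_deriveX m dv; rewrite /GRing.scale/=; case: (m) => [|k].
      by rewrite /= !mul0r.
    have -> : v ^+ k.+1 = (fun s => v s ^+ k.+1).
      by apply/funext => s; elim: k.+1 => [//|j IH]; rewrite !exprS -IH.
    by move=> h; apply: is_derive_eq; rewrite /= !exprS; ring.
  have dP := is_derive_poly P t.
  have -> : smooth_bump m.+2 (bump_poly m P) t =
      P^`().[t] * v t ^+ m * expR (- v t) + P.[t] * (m%:R * (2 * t) * v t ^+ m.+1) * expR (- v t) +
      P.[t] * v t ^+ m * (- (2 * t * v t ^+ 2) * expR (- v t)).
    rewrite /smooth_bump t1 /bump_poly -exprVn.
    rewrite !(hornerD, hornerN, hornerM, hornerC, hornerX, hornerXn, horner_exp).
    rewrite -/(u t) -/(v t) -[u t]invrK -/(v t).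
    by rewrite !exprS; field.
  by apply: is_derive_eq; rewrite /GRing.scale/= /GRing.scale/=; ring.
- have -> : smooth_bump m.+2 (bump_poly m P) t = 0 by rewrite /smooth_bump ltNge ltW.
  apply: (@near_eq_is_derive _ _ _ (fun _ : R => 0 : R)).
    near=> s; rewrite /smooth_bump ifF//; apply/negbTE; rewrite -leNgt ltW//; near: s.
    exact: (@cvgr_norm_gt _ _ _ (nbhs t) _ id t cvg_id 1 t1).
- have b0 k Q : smooth_bump k Q t = 0 by rewrite /smooth_bump t1 ltxx.
  rewrite b0; have [C C0 CP] := bump_bound m P.
  (* As [t ^+ 2 = 1], [1 - s ^+ 2] factors as [(t - s) * (t + s)] with [|t + s| <= 2], and the
     square of 2 gives the factor 4. *)
  apply: (@is_derive_quadratic _ _ (C * 4)) => [|s]; first by rewrite mulr_ge0.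
  rewrite b0 subr0; have [s1|s1] := ltP `|s| 1; last first.
    have C4 : 0 <= C * 4 by rewrite mulr_ge0.
    by rewrite /smooth_bump ltNge s1/= normr0; exact: mulr_ge0 C4 (sqr_ge0 _).
  rewrite (le_trans (CP s))// -mulrA ler_wpM2l//.
  have t2 : t ^+ 2 = 1 by rewrite -real_normK ?num_real// t1 expr1n.
  rewrite -{1}t2 subr_sqr exprMn -[(t - s) ^+ 2]sqrrN opprB mulrC ler_wpM2r ?sqr_ge0//.
  have : `|t + s| ^+ 2 <= 2 ^+ 2.
    by rewrite ler_sqr ?nnegrE// (le_trans (ler_normD _ _))// t1; lra.
  by rewrite real_normK ?num_real// expr2 => /le_trans; apply; lra.
Unshelve. all: by end_near. Qed.

Lemma bumpN m P t : P \Po (- 'X) = P -> smooth_bump m P (- t) = smooth_bump m P t.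
Proof.
move=> PN; rewrite /smooth_bump normrN sqrrN; case: ifP => // _; congr (_ / _ * _).
by rewrite -[in RHS]PN horner_comp !hornerE.
Qed.

Lemma bump_out m P t : 1 <= `|t| -> smooth_bump m P t = 0.
Proof. by move=> t1; rewrite /smooth_bump ltNge t1. Qed.

Lemma continuous_bump m P : continuous (smooth_bump m P).
Proof. exact: continuous_is_derive (is_derive_bump m P). Qed.

End smooth_bump.

(** * Products of one-variable functions *)

Section product_functions.
Context {R : realType} {n : nat}.
Local Notation X := 'rV[R]_n.
Implicit Types (g : 'I_n -> R -> R) (x y : X).

(** Mollifiers are built as products over the coordinates rather than as radial functions, which
    reduces their derivatives, second differences and integrals to one variable. *)
Definition prodf g y : R := \prod_(i < n) g i (y ord0 i).

Definition upd g (i : 'I_n) (f : R -> R) (j : 'I_n) := if j == i then f else g j.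

Lemma prodf_axis g y i (t : R) :
  prodf g (y + t *: delta_mx 0 i) =
  (\prod_(j < n | j != i) g j (y ord0 j)) * g i (y ord0 i + t).
Proof.
rewrite /prodf (bigD1 i)//= mulrC !mxE !eqxx mulr1; congr (_ * _).
by apply: eq_bigr => j /negbTE ji; rewrite !mxE ji andbF mulr0 addr0.
Qed.

Lemma prodf_upd g y i f :
  prodf (upd g i f) y = (\prod_(j < n | j != i) g j (y ord0 j)) * f (y ord0 i).
Proof.
rewrite /prodf (bigD1 i)//= mulrC /upd eqxx; congr (_ * _).
by apply: eq_bigr => j /negbTE ->.
Qed.

Lemma is_derive_prodf g y i f : (forall s : R, is_derive s 1 (g i) (f s)) ->
  is_derive y (delta_mx 0 i : X) (prodf g) (prodf (upd g i f) y).
Proof.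
move=> df; set c := \prod_(j < n | j != i) g j (y ord0 j).
apply: (@is_derive_slice _ _ _ (fun s => c * g i s) _ _ (y ord0 i)).
  by move=> t; rewrite prodf_axis.
rewrite prodf_upd -/c; have ? := df (y ord0 i).
by apply: is_derive_eq; rewrite /GRing.scale/=; ring.
Qed.

Let cvg_prod_ord T (F : set_system T) (f : 'I_n -> T -> R) (a : 'I_n -> R) :
  Filter F -> (forall i, f i x @[x --> F] --> a i) ->
  \prod_(i < n) f i x @[x --> F] --> \prod_(i < n) a i.
Proof.
move=> FF fa; elim: (index_enum 'I_n) => [|i s IH].
  rewrite big_nil (_ : (fun z => \prod_(j <- [::]) f j z) = cst 1); first exact: cvg_cst.
  by apply/funext => z; rewrite big_nil.
rewrite big_cons (_ : (fun z => \prod_(j <- i :: s) f j z) = (fun z => f i z * \prod_(j <- s) f j z)).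
  exact: cvgM (fa i) IH.
by apply/funext => z; rewrite big_cons.
Qed.

Lemma continuous_prodf g : (forall i, continuous (g i)) -> continuous (prodf g).
Proof.
move=> cg y; apply: (@cvg_prod_ord _ (nbhs y) (fun i (y : X) => g i (y ord0 i))) => i.
by apply: (@cvg_comp _ _ _ (fun y : X => y ord0 i) (g i)); [exact: coord_continuous|exact: cg].
Qed.

Lemma smooth_prodf (S : 'I_n -> set (R -> R)) g :
  (forall i f, S i f -> exists2 f1, S i f1 & forall s : R, is_derive s 1 f (f1 s)) ->
  (forall i, S i (g i)) -> smooth (prodf g).
Proof.
move=> H Sg.
apply: (@smooth_of_stable _ _ [set w | exists2 g, (forall i, S i (g i)) & w = prodf g]); last by exists g.
move=> _ [{Sg}g Sg ->]; split.
  by apply: continuous_prodf => i; have [f1 _ df] := H _ _ (Sg i); exact: continuous_is_derive df.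
move=> i; have [f1 Sf1 df] := H _ _ (Sg i); exists (prodf (upd g i f1)).
  by exists (upd g i f1) => // j; rewrite /upd; case: eqP => [->|].
by move=> y; exact: is_derive_prodf.
Qed.

Lemma partial2_prodf g y i f1 f2 : (forall s : R, is_derive s 1 (g i) (f1 s)) ->
  (forall s : R, is_derive s 1 f1 (f2 s)) ->
  partial i (partial i (prodf g)) y = (\prod_(j < n | j != i) g j (y ord0 j)) * f2 (y ord0 i).
Proof.
move=> df df1.
have -> : partial i (prodf g) = prodf (upd g i f1).
  by apply/funext => z; have [_] := is_derive_prodf z df.
have df1' s : is_derive (s : R) 1 (upd g i f1 i) (f2 s) by rewrite /upd eqxx.
have [_] := is_derive_prodf y df1'; rewrite /partial => ->.
by rewrite prodf_upd; congr (_ * _); apply: eq_bigr => j /negbTE ji; rewrite /upd ji.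
Qed.

Lemma haslap_prodf g (g1 g2 : 'I_n -> R -> R) y :
  (forall i (s : R), is_derive s 1 (g i) (g1 i s)) ->
  (forall i (s : R), is_derive s 1 (g1 i) (g2 i s)) ->
  (forall i, continuous (g2 i)) -> haslap (prodf g) (laplacian (prodf g) y) y.
Proof.
move=> dg dg1 cg2; rewrite /laplacian; apply: haslap_slices => i.
rewrite (partial2_prodf y (dg i) (dg1 i)); set c := \prod_(j < n | j != i) _.
pose D m := (g i (y ord0 i + step m) + g i (y ord0 i - step m) - 2 * g i (y ord0 i)) / step m ^+ 2.
rewrite (_ : (fun m => _) = (fun m => c * D m)); last first.
  apply/funext => m; rewrite -scaleNr !prodf_axis -/c.
  have -> : prodf g y = c * g i (y ord0 i + 0).
    by rewrite -prodf_axis scale0r addr0.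
  by rewrite /D addr0; ring.
have h := cvg_second_difference (dg i) (dg1 i) (cg2 i (y ord0 i)).
exact: (@cvgMl_tmp _ _ _ _ _ c _ h).
Qed.

(** A second difference quotient is a value of the second derivative, so the bound is uniform in the
    step. It provides the domination in [haslap_convol]. *)
Lemma lapdisc_prodf_bounded g (g1 g2 : 'I_n -> R -> R) (M : R) :
  (forall i (s : R), is_derive s 1 (g i) (g1 i s)) ->
  (forall i (s : R), is_derive s 1 (g1 i) (g2 i s)) ->
  (forall i (s : R), `|g i s| <= M) -> (forall i s, `|g2 i s| <= M) ->
  forall m y, `|lapdisc (step m) (prodf g) y| <= \sum_(i < n) (\prod_(j < n | j != i) M) * M.
Proof.
move=> dg dg1 gM g2M m y; rewrite (le_trans (ler_norm_sum _ _ _))//.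
apply: ler_sum => i _; rewrite -scaleNr !prodf_axis.
set c := \prod_(j < n | j != i) _.
have -> : prodf g y = c * g i (y ord0 i + 0).
  by rewrite -prodf_axis scale0r addr0.
have [z _ zE] := second_difference_mvt (y ord0 i) (dg i) (dg1 i) (step_gt0 m).
have -> : (c * g i (y ord0 i + step m) + c * g i (y ord0 i - step m) -
   2 * (c * g i (y ord0 i + 0))) / step m ^+ 2 = c * g2 i z.
  rewrite addr0 -(mulfK (_ : step m ^+ 2 != 0) (c * g2 i z)); last first.
    by rewrite expf_neq0// gt_eqF ?step_gt0.
  by congr (_ / _); rewrite -mulrA -zE; ring.
rewrite normrM ler_pM// normr_prod; apply: ler_prod => j _.
by rewrite normr_ge0/=.
Qed.

Lemma bounded_derive_lipschitz (f f1 : R -> R) (M : R) :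
  (forall s : R, is_derive s 1 f (f1 s)) -> (forall s, `|f1 s| <= M) ->
  forall s t, `|f s - f t| <= M * `|s - t|.
Proof.
move=> df f1M s t; wlog st : s t / s < t => [H|].
  have [/H//|/H|->] := ltgtP s t; last by rewrite !subrr !normr0 mulr0.
  by rewrite distrC [`|s - t|]distrC.
have [c _ cE] := mvt_is_derive df st.
by rewrite distrC cE normrM [`|s - t|]distrC ler_wpM2r.
Qed.

Lemma prodf_lipschitz g (g1 : 'I_n -> R -> R) (M : R) :
  (forall i (s : R), is_derive s 1 (g i) (g1 i s)) ->
  (forall i (s : R), `|g i s| <= M) -> (forall i s, `|g1 i s| <= M) -> 0 <= M ->
  exists2 K : R, 0 <= K & forall x y, `|prodf g x - prodf g y| <= K * `|x - y|.
Proof.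
move=> dg gM g1M M0; pose K := \sum_(i < n) (\prod_(j < n | j != i) M) * M.
have p0 i : 0 <= (\prod_(j < n | j != i) M) * M by rewrite mulr_ge0// prodr_ge0.
have K0 : 0 <= K by apply: sumr_ge0.
exists (K * n%:R); first by rewrite mulr_ge0.
apply: lipschitz_norm => // y i t; rewrite prodf_axis.
have -> : prodf g y = (\prod_(j < n | j != i) g j (y ord0 j)) * g i (y ord0 i).
  by rewrite -[in RHS](addr0 (y ord0 i)) -prodf_axis scale0r addr0.
rewrite -mulrBr normrM.
apply: (@le_trans _ _ ((\prod_(j < n | j != i) M) * M * `|t|)).
  rewrite -mulrA ler_pM//.
    by rewrite normr_prod; apply: ler_prod => j _; rewrite normr_ge0/=.
  have := bounded_derive_lipschitz (dg i) (g1M i) (y ord0 i + t) (y ord0 i).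
  by rewrite addrAC subrr add0r.
rewrite ler_wpM2r// /K [leRHS](bigD1 i)//= lerDl; apply: sumr_ge0 => j _; exact: p0.
Qed.

End product_functions.

(** * Cubes, open sets and product integrals for Lebesgue measure *)

Section lebesgue_measure_rV_theory.
Context {R : realType}.

Lemma continuous_measurable_rV n (f : 'rV[R]_n -> R) :
  continuous f -> measurable_fun [set: 'rV[R]_n] f.
Proof.
move=> cf; apply: (measurability _ (RGenOpens.measurableE R)) => _ [_ [a [b ->] <-]].
rewrite setTI; apply: open_measurable_rV.
by apply: open_comp => [x _|]; [exact: cf|exact: itv_open].
Qed.

Definition cube n (r : R) : set 'rV[R]_n := [set x | forall i, `[- r, r]%classic (x ord0 i)].

Lemma cubeP n (r : R) (x : 'rV[R]_n) : 0 <= r -> cube r x <-> `|x| <= r.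
Proof.
move=> r0; split=> [xr|xr i].
  rewrite /Num.norm/= mx_normrE; apply/bigmax_leP; split => // -[i j] _/=.
  by rewrite ord1 ler_norml; have := xr j; rewrite /= in_itv.
by rewrite /= in_itv/= -ler_norml (le_trans (norm_coord x i)).
Qed.

Lemma measurable_cube n (r : R) : measurable (@cube n r).
Proof. exact: (@measurable_box R n (fun=> `[- r, r]%classic)). Qed.

Lemma compact_cube n (r : R) : compact (@cube n r).
Proof.
apply: (@rV_compact R n (fun=> `[- r, r]%classic)) => _; exact: segment_compact.
Qed.

Lemma lebesgue_measure_rV_cube n (r : R) : (lebesgue_measure_rV (@cube n r) < +oo)%E.
Proof.
rewrite (@lebesgue_measure_rV_box R n (fun=> `[- r, r]%classic))// ltey_eq.
apply/orP; left; elim/big_ind : _ => // [x y xf yf|i _]; first exact: fin_numM.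
by rewrite lebesgue_measure_itv/=; case: ifP.
Qed.

Lemma lebesgue_measure_rV_sigma_finite n : sigma_finite setT (@lebesgue_measure_rV R n).
Proof.
exists (fun k : nat => @cube n k%:R).
  apply/seteqP; split => // x _; exists (Num.truncn `|x|).+1 => //.
  by apply/cubeP => //; apply/ltW/truncnS_gt.
by move=> k; split; [exact: measurable_cube|exact: lebesgue_measure_rV_cube].
Qed.

HB.instance Definition _ n := @Measure_isSigmaFinite.Build _ _ _ (@lebesgue_measure_rV R n)
  (lebesgue_measure_rV_sigma_finite n).

Lemma lebesgue_measure_rV_open_gt0 n (A : set 'rV[R]_n) :
  open A -> A !=set0 -> (0 < lebesgue_measure_rV A)%E.
Proof.
move=> oA [x Ax].
have /nbhs_ballP[e /= e0 eA] := open_nbhs_nbhs (conj oA Ax).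
pose B i := ball (x ord0 i) e.
have mB i : measurable (B i) by apply: open_measurable; exact: ball_open.
have sub : [set y : 'rV[R]_n | forall i, B i (y ord0 i)] `<=` A.
  move=> y yB; apply: eA; split=> // i j; rewrite ord1; exact: yB.
have : (0 < lebesgue_measure_rV [set y : 'rV[R]_n | forall i, B i (y ord0 i)])%E.
  rewrite (lebesgue_measure_rV_box mB); elim/big_ind : _ => // [a b|i _].
    exact: mule_gt0.
  by rewrite lebesgue_measure_ball ?ltW// lte_fin mulrn_wgt0.
move=> /lt_le_trans; apply; apply: le_measure sub; rewrite inE.
  exact: (measurable_box mB).
exact: open_measurable_rV.
Qed.

(** The complement is open, and a nonempty open set is not negligible. Closed conditions on
    continuous representatives thereby hold at every point. *)
Lemma ae_closed n (A : set 'rV[R]_n) : closed A ->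
  (\forall x \ae lebesgue_measure_rV, A x) -> forall x, A x.
Proof.
move=> clA [N [mN N0 AN]] x; apply: contrapT => nAx.
have : (0 < @lebesgue_measure_rV R n (~` A))%E.
  by apply: lebesgue_measure_rV_open_gt0; [exact: closed_openC|exists x].
apply/negP; rewrite -leNgt -N0; apply: le_measure => //; rewrite inE//.
by apply: open_measurable_rV; exact: closed_openC.
Qed.

Lemma integral_affine (g : R -> R) (a b : R) : continuous g -> (forall t, 0 <= g t) ->
  0 < a -> (\int[lebesgue_measure]_t (g t)%:E = \int[lebesgue_measure]_t (g (a * t + b) * a)%:E)%E.
Proof.
move=> cg g0 a0; pose F (t : R) := a * t + b.
have dF (t : R) : is_derive t 1 F a.
  by apply: is_derive_eq; rewrite addr0 /GRing.scale/= mulr1.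
have F'E : (F^`())%classic = cst a by apply/funext => t; rewrite derive1E; have [] := dF t.
rewrite (@increasing_ge0_integration_by_substitutionT R F g)//.
- by apply: eq_integral => t _; rewrite F'E.
- by move=> s t st; rewrite /F ltrD2r ltr_pM2l.
- by rewrite F'E; exact: cst_continuous.
- by rewrite F'E; exact: is_cvg_cst.
- by rewrite F'E; exact: is_cvg_cst.
- apply/cvgrNyPle => A.
  have h : \forall t \near -oo, t <= (A - b) / a by exact: nbhs_ninfty_le.
  by apply: filterS h => t; rewrite /F -lerBrDr ler_pdivlMr// mulrC.
- apply/cvgryPge => A.
  have h : \forall t \near +oo, (A - b) / a <= t by exact: nbhs_pinfty_ge.
  by apply: filterS h => t; rewrite /F -lerBlDr ler_pdivrMr// mulrC.
Qed.

Lemma measurable_prodf n (g : 'I_n -> R -> R) : (forall i, measurable_fun setT (g i)) ->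
  measurable_fun setT (prodf g).
Proof.
move=> mg; apply: measurable_prod => i _.
exact: measurableT_comp (mg i) (measurable_coord i).
Qed.

Lemma integral_prodf n (g : 'I_n -> R -> R) :
  (forall i, measurable_fun setT (g i)) -> (forall i t, 0 <= g i t) ->
  (forall i, \int[lebesgue_measure]_t (g i t)%:E = 1)%E ->
  (\int[lebesgue_measure_rV]_y (prodf g y)%:E = 1)%E.
Proof.
elim: n g => [|n IH] g mg g0 g1.
  rewrite (@integral_dirac _ _ (0 : 'rV[R]_0) R) ?diracT//.
    by rewrite /prodf big_ord0 mul1e.
  by apply/measurable_EFinP; exact: measurable_prodf.
have mp : measurable_fun setT (EFin \o prodf g) by apply/measurable_EFinP; exact: measurable_prodf.
pose m : {measure set ('rV[R]_n * measurableTypeR R) -> \bar R} :=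
  (lebesgue_measure_rV \x lebesgue_measure)%E.
have mr : measurable_fun [set: ('rV[R]_n * measurableTypeR R)%type] (@rcons_rV R n).
  exact: measurable_rcons_rV.
have := ge0_integral_pushforward mr m measurableT mp.
move=> ->; last by move=> y _ /=; rewrite lee_fin; apply: prodr_ge0 => i _.
rewrite preimage_setT.
pose h i := g (widen_ord (leqnSn n) i).
have E p : (EFin \o prodf g \o @rcons_rV R n) p = (prodf h p.1 * g ord_max p.2)%:E.
  rewrite /= /prodf big_ord_recr/= !mxE; congr (_ * g _ _)%:E; last by rewrite unlift_none.
  apply: eq_bigr => i _; rewrite mxE /h; congr (g _ _).
  have -> : widen_ord (leqnSn n) i = lift ord_max i by apply/val_inj; exact/esym/lift_max.
  by rewrite liftK.
pose f (p : 'rV[R]_n * measurableTypeR R) : \bar R := (prodf h p.1 * g ord_max p.2)%:E.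
have mh : measurable_fun setT (prodf h) by apply: measurable_prodf => i; exact: mg.
have mf : measurable_fun [set: ('rV[R]_n * measurableTypeR R)%type] f.
  apply/measurable_EFinP; apply: measurable_funM.
    exact: measurableT_comp mh measurable_fst.
  exact: measurableT_comp (mg ord_max) measurable_snd.
have h0 y : 0 <= prodf h y by apply: prodr_ge0 => i _; exact: g0.
have f0 p : (0 <= f p)%E by rewrite lee_fin mulr_ge0.
transitivity (\int[lebesgue_measure_rV]_y (\int[lebesgue_measure]_t f (y, t)))%E.
  transitivity (\int[m]_p f p)%E; first by apply: eq_integral => p _; exact: E.
  exact: (fubini_tonelli1 (m1 := (@lebesgue_measure_rV R n : {sigma_finite_measure set 'rV[R]_n -> \bar R}))
    (m2 := (@lebesgue_measure R : {sigma_finite_measure set (measurableTypeR R) -> \bar R})) f mf f0).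
rewrite -[RHS](IH h) => [|i|i t|i]; last 3 first; [exact: mg|exact: g0|exact: g1|].
apply: eq_integral => y _; rewrite /f/=.
under eq_integral do rewrite EFinM.
rewrite ge0_integralZl ?lee_fin//; last 2 first.
- by apply/measurable_EFinP; exact: mg.
- by move=> t _; rewrite lee_fin.
by rewrite g1 mule1.
Qed.

End lebesgue_measure_rV_theory.

Section mollifier.
Context {R : realType}.
Implicit Types (m : nat) (P : {poly R}) (t : R).

Lemma bumpZ (c : R) m P t : c * smooth_bump m P t = smooth_bump m (c%:P * P) t.
Proof.
by rewrite /smooth_bump; case: ifP => _; rewrite ?mulr0// hornerM hornerC !mulrA.
Qed.

Lemma bump1_ge0 t : 0 <= smooth_bump 0 1 t.
Proof.
by rewrite /smooth_bump; case: ifP => // _; rewrite hornerC expr0 divr1 mul1r expR_ge0.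
Qed.

Lemma bump1_mass : exists2 B : R, 0 < B &
  (\int[lebesgue_measure]_t (smooth_bump 0 1 t)%:E = B%:E)%E.
Proof.
set I := (\int[_]_t _)%E.
have mb : measurable_fun setT (fun t => (smooth_bump 0 1 t : R)%:E).
  apply/measurable_EFinP; apply: continuous_measurable_fun; exact: continuous_bump.
have b0 t : (0 <= (smooth_bump 0 1 t : R)%:E)%E by rewrite lee_fin bump1_ge0.
have [C C0 CP] := @bump_bounded R 0 1.
have Ilt : (I < +oo)%E.
  apply: (@le_lt_trans _ _ (\int[lebesgue_measure]_(t in `[(-1)%R, 1%R]) C%:E)%E).
    rewrite integral_mkcond; apply: ge0_le_integral => //.
    - apply/(measurable_restrictT _ _).1 => //; exact: measurable_cst.
    - move=> t _; rewrite patchE; case: ifPn => [_|].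
        by rewrite lee_fin (le_trans (ler_norm _))// CP.
      rewrite notin_setE/= in_itv/= -ler_norml => /negP; rewrite -ltNge.
      by move=> t1; rewrite bump_out// ltW.
  rewrite integral_cst//= lebesgue_measure_itv/=; case: ifP => _.
    by rewrite -EFinD -EFinM ltry.
  by rewrite mule0.
(* A lower bound for the bump on [[- 1 / 2, 1 / 2]], where [1 - t ^+ 2 >= 3 / 4]. *)
pose q : R := expR (- (4 / 3)).
have Igt : (0 < I)%E.
  apply: (@lt_le_trans _ _ (\int[lebesgue_measure]_(t in `[(- (1 / 2))%R, (1 / 2)%R]) q%:E)%E).
    rewrite integral_cst//= lebesgue_measure_itv/= lte_fin ifT; last by lra.
    by rewrite -EFinD -EFinM lte_fin mulr_gt0 ?expR_gt0//; lra.
  rewrite integral_mkcond; apply: ge0_le_integral => //.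
  - by move=> t _; rewrite patchE; case: ifP => // _; rewrite lee_fin expR_ge0.
  - apply/(measurable_restrictT _ _).1 => //; exact: measurable_cst.
  - move=> t _; rewrite patchE; case: ifPn => [|//].
    rewrite inE/= in_itv/= -ler_norml => t2.
    have t1 : `|t| < 1 by lra.
    rewrite lee_fin /smooth_bump t1 hornerC expr0 divr1 mul1r ler_expR lerN2.
    have d0 := bump_gt0 t1.
    rewrite -[leRHS]invrK lef_pV2 ?posrE//.
    have : `|t| ^+ 2 <= (1 / 2) ^+ 2 by rewrite ler_sqr ?nnegrE//; lra.
    rewrite real_normK ?num_real// => t4.
    have -> : (4 / 3)^-1 = 3 / 4 :> R by rewrite invf_div.
    lra.
exists (fine I); last by rewrite fineK// ge0_fin_numE// ltW.
by rewrite -lte_fin fineK// ge0_fin_numE// ltW.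
Qed.

Context {n : nat}.
Local Notation X := 'rV[R]_n.
Implicit Types (x y z : X).

(** The mass is prescribed for the kernels [y |-> rho (x - y)], the form in which convolution uses
    it. The norm is the sup norm, so the support lies in a cube. *)
Definition mollifier (rho : X -> R) (e : R) :=
  [/\ (forall z, 0 <= rho z), (forall z, e < `|z| -> rho z = 0),
      (forall z, rho (- z) = rho z),
      (exists2 K : R, 0 <= K & (forall z, rho z <= K) /\
         (forall x y, `|rho x - rho y| <= K * `|x - y|)) &
      forall x, (\int[lebesgue_measure_rV]_y (rho (x - y))%:E = 1)%E].

(** What carries a distributional equation over to a mollification: the kernel is a test function,
    its second differences converge to its Laplacian, and they are uniformly bounded. *)
Definition smooth_kernel (rho : X -> R) :=
  [/\ forall x, test_function (fun y => rho (x - y)),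
      forall x y, haslap (fun y => rho (x - y)) (laplacian (fun y => rho (x - y)) y) y &
      exists2 K : R, 0 <= K & forall x m y, `|lapdisc (step m) (fun y => rho (x - y)) y| <= K].

Lemma exists_mollifier (e : R) : 0 < e -> exists2 rho, mollifier rho e & smooth_kernel rho.
Proof.
move=> e0; have [B B0 BI] := bump1_mass.
pose a := e^-1; have a0 : 0 < a by rewrite invr_gt0.
(* Scaling by [a = e^-1] shrinks the support to [[- e, e]] and divides the mass [B] by [a]; the
   factor [c] makes it 1 in each coordinate. *)
pose c := a / B; have c0 : 0 < c by rewrite divr_gt0.
pose b t := c * smooth_bump 0 1 (a * t).
pose rho := prodf (fun (_ : 'I_n) => b).
have b_ge0 t : 0 <= b t by rewrite mulr_ge0 ?bump1_ge0// ltW.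
have bN t : b (- t) = b t.
  by rewrite /b mulrN bumpN// comp_polyC.
have b_out t : e < `|t| -> b t = 0.
  move=> et; rewrite /b bump_out ?mulr0// normrM gtr0_norm// /a mulrC.
  by rewrite ler_pdivlMr// mul1r ltW.
(* The [i]-th factors of [y |-> rho (x - y)] and of all its derivatives lie in this class. The inner
   slope is [- a] because the kernel is differentiated in [y]. *)
pose S x i : set (R -> R) := [set f | exists m P, f = (fun t => smooth_bump m P (- a * t + a * x ord0 i))].
have dS m P (s t : R) : is_derive t 1 (fun t => smooth_bump m P (- a * t + s))
    (smooth_bump m.+2 ((- a)%:P * bump_poly m P) (- a * t + s)).
  have := is_derive_comp_affine (- a) s (is_derive_bump m P) t.
  by rewrite bumpZ.
pose g x (i : 'I_n) t := smooth_bump 0 c%:P (- a * t + a * x ord0 i).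
pose P1 : {poly R} := (- a)%:P * bump_poly 0 c%:P.
pose P2 : {poly R} := (- a)%:P * bump_poly 2 P1.
pose g1 x (i : 'I_n) t := smooth_bump 2 P1 (- a * t + a * x ord0 i).
pose g2 x (i : 'I_n) t := smooth_bump 4 P2 (- a * t + a * x ord0 i).
have rhoE x y : rho (x - y) = prodf (g x) y.
  apply: eq_bigr => i _; rewrite /b /g bumpZ mulr1 !mxE; congr smooth_bump; ring.
have dg x i t : is_derive (t : R) 1 (g x i) (g1 x i t) by exact: dS.
have dg1 x i t : is_derive (t : R) 1 (g1 x i) (g2 x i t) by exact: dS.
have cg2 x i : continuous (g2 x i).
  apply: (@continuous_compose R R (fun t => - a * t + a * x ord0 i)); last exact: continuous_bump.
  apply: continuous_add; last exact: cst_continuous.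
  by apply: continuous_scale; exact: continuous_idr.
have rhofE x : (fun y => rho (x - y)) = prodf (g x) by apply/funext => y; exact: rhoE.
have [M0 M00 M0P] := @bump_bounded R 0 c%:P.
have [M1 M10 M1P] := @bump_bounded R 2 P1.
have [M2 M20 M2P] := @bump_bounded R 4 P2.
pose M := M0 + M1 + M2.
have gM x i t : `|g x i t| <= M by rewrite (le_trans (M0P _))// /M; lra.
have g1M x i t : `|g1 x i t| <= M by rewrite (le_trans (M1P _))// /M; lra.
have g2M x i t : `|g2 x i t| <= M by rewrite (le_trans (M2P _))// /M; lra.
have MM : 0 <= M by rewrite /M; lra.
have rho0 z : 0 <= rho z by apply: prodr_ge0 => i _; exact: b_ge0.
have rhoN z : rho (- z) = rho z by apply: eq_bigr => i _; rewrite mxE bN.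
have rho_out z : e < `|z| -> rho z = 0.
  move=> ez; have [i zi] : exists i, e < `|z ord0 i|.
    apply: contrapT => H; move: ez; apply/negP; rewrite -leNgt.
    apply/cubeP => [|i]; first exact: ltW.
    rewrite /= in_itv/= -ler_norml leNgt; apply/negP => zi; apply: H; by exists i.
  by rewrite /rho /prodf (bigD1 i)//= b_out// mul0r.
exists rho.
  split=> //.
    have [K K0 KP] := prodf_lipschitz (dg 0) (gM 0) (g1M 0) MM.
    have rE z : rho z = prodf (g 0) (- z) by rewrite -rhoE sub0r opprK.
    have p0 : 0 <= \prod_(i < n) M by exact: prodr_ge0.
    exists (K + \prod_(i < n) M); first by rewrite addr_ge0.
    split=> [z|x y].
      rewrite rE (le_trans (ler_norm _))// normr_prod.
      by rewrite (@le_trans _ _ (\prod_(i < n) M)) ?lerDr//; apply: ler_prod => i _; rewrite normr_ge0/=.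
    rewrite !rE (le_trans (KP _ _))// -opprD normrN ler_wpM2r// lerDl//.
  move=> x; under eq_integral do rewrite rhoE.
  apply: integral_prodf => [i|i t|i].
  - apply: continuous_measurable_fun; exact: continuous_is_derive (dg x i).
  - by rewrite /g -[c%:P]mulr1 -bumpZ mulr_ge0 ?bump1_ge0// ltW.
  - have cb : continuous (smooth_bump 0 1 : R -> R) by exact: continuous_bump.
    have := @integral_affine R (smooth_bump 0 1) a (- a * x ord0 i) cb bump1_ge0 a0.
    rewrite BI => E.
    have mb : measurable_fun setT (fun t => (smooth_bump 0 1 (a * t + - a * x ord0 i) * a)%:E).
      apply/measurable_EFinP; apply: measurable_funM => //.
      apply: continuous_measurable_fun.
      apply: (@continuous_compose R R (fun t => a * t + - a * x ord0 i)) => //.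
      apply: continuous_add; last exact: cst_continuous.
      by apply: continuous_scale; exact: continuous_idr.
    transitivity (\int[lebesgue_measure]_t (B^-1%:E * (smooth_bump 0 1 (a * t + - a * x ord0 i) * a)%:E))%E.
      apply: eq_integral => t _; rewrite -EFinM; congr EFin.
      rewrite /g -[c%:P]mulr1 -bumpZ -[X in _ * smooth_bump _ _ X]opprK bumpN ?comp_polyC//.
      rewrite /c (_ : - (- a * t + a * x ord0 i) = a * t + - a * x ord0 i); last by ring.
      ring.
    rewrite ge0_integralZl//; last 2 first.
    - by move=> t _; rewrite lee_fin mulr_ge0 ?bump1_ge0// ltW.
    - by rewrite lee_fin invr_ge0 ltW.
    by rewrite -E -EFinM mulVf// gt_eqF.
split.
- move=> x; split.
    rewrite rhofE; apply: (@smooth_prodf R n (S x)) => [i _ [m [P ->]]|i].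
      exists (fun t => smooth_bump m.+2 ((- a)%:P * bump_poly m P) (- a * t + a * x ord0 i)).
        by exists m.+2, ((- a)%:P * bump_poly m P).
      by move=> s; exact: dS.
    by exists 0%N, c%:P.
  have r0 : 0 <= `|x| + e by rewrite addr_ge0// ltW.
  apply: subclosed_compact (@compact_cube R n (`|x| + e)) _; first exact: closed_closure.
  have clc : closed (@cube R n (`|x| + e)).
    by apply: compact_closed; [exact: norm_hausdorff|exact: compact_cube].
  move/closure_id: clc => ->; apply: closure_subset => y /= ry.
  apply/cubeP => //; have xy : `|x - y| <= e.
    by rewrite leNgt; apply/negP => /rho_out /eqP; apply/negP.
  by rewrite -[X in `|X| <= _](subKr x y) (le_trans (ler_normB _ _))// lerD2l.
- move=> x y; rewrite rhofE; exact: haslap_prodf (dg x) (dg1 x) (cg2 x).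
- exists (\sum_(i < n) (\prod_(j < n | j != i) M) * M).
    by apply: sumr_ge0 => i _; rewrite mulr_ge0// prodr_ge0.
  move=> x m y; rewrite rhofE.
  exact: lapdisc_prodf_bounded (dg x) (dg1 x) (gM x) (g2M x) m y.
Qed.

End mollifier.

(** * Convolution and L^1 approximation *)

Section convolution.
Context {R : realType} {n : nat}.
Local Notation X := 'rV[R]_n.
Local Notation mu := (@lebesgue_measure_rV R n).
Implicit Types (f g phi : X -> R) (x y z : X) (rho : X -> R) (r e K : R).

Lemma measurable_sub_rV : measurable_fun [set: X * X] (fun p : X * X => p.1 - p.2).
Proof.
apply: measurable_fun_rVP => i; under eq_fun do rewrite !mxE.
apply: measurable_funB.
- exact: (measurableT_comp (measurable_coord i) measurable_fst).
- exact: (measurableT_comp (measurable_coord i) measurable_snd).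
Qed.

Lemma measurable_kernel phi x : measurable_fun setT phi ->
  measurable_fun setT (fun y => phi (x - y)).
Proof.
move=> mphi; apply: (measurableT_comp mphi).
exact: (measurableT_comp measurable_sub_rV (measurable_pair1 x)).
Qed.

Lemma measurable_kernelr phi y : measurable_fun setT phi ->
  measurable_fun setT (fun x => phi (x - y)).
Proof.
move=> mphi; apply: (measurableT_comp mphi).
exact: (measurableT_comp measurable_sub_rV (measurable_pair2 y)).
Qed.

Lemma measurable_kernel2 phi : measurable_fun setT phi ->
  measurable_fun [set: X * X] (fun p : X * X => phi (p.1 - p.2)).
Proof. by move=> mphi; apply: (measurableT_comp mphi measurable_sub_rV). Qed.

Lemma continuous_local_lipschitz (w : X -> R) (C : X -> R) :
  (forall x y, `|x - y| <= 1 -> `|w x - w y| <= C x * `|x - y|) -> continuous w.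
Proof.
move=> wC x; apply/(@cvgrPdist_le R R^o _ _ (nbhs_filter (x : X))) => d d0.
have C1 : 0 < `|C x| + 1 by rewrite ltr_wpDl.
have m0 : 0 < Num.min 1 (d / (`|C x| + 1)) by rewrite lt_min ltr01 divr_gt0.
apply/nbhs_ballP; exists (Num.min 1 (d / (`|C x| + 1))) => // y; rewrite -ball_normE /= lt_min => /andP[h1 h2].
rewrite (le_trans (wC _ _ (ltW h1)))//.
rewrite (@le_trans _ _ ((`|C x| + 1) * `|x - y|))//.
  by rewrite ler_wpM2r// (le_trans (ler_norm _))// lerDl.
by rewrite mulrC -ler_pdivlMr// ltW.
Qed.

Lemma continuous_lipschitz (w : X -> R) K : (forall x y, `|w x - w y| <= K * `|x - y|) ->
  continuous w.
Proof. by move=> wK; apply: (@continuous_local_lipschitz _ (fun=> K)) => x y _. Qed.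

Lemma EFin_integrableD (D : set X) f g : measurable D -> mu.-integrable D (EFin \o f) ->
  mu.-integrable D (EFin \o g) -> mu.-integrable D (fun x => (f x + g x)%:E).
Proof. by move=> mD If Ig; under eq_fun do rewrite EFinD; exact: integrableD. Qed.

Lemma EFin_integrableB (D : set X) f g : measurable D -> mu.-integrable D (EFin \o f) ->
  mu.-integrable D (EFin \o g) -> mu.-integrable D (fun x => (f x - g x)%:E).
Proof. by move=> mD If Ig; under eq_fun do rewrite EFinB; exact: integrableB. Qed.

Lemma EFin_integrableZ (D : set X) f (k : R) : measurable D -> mu.-integrable D (EFin \o f) ->
  mu.-integrable D (fun x => (k * f x)%:E).
Proof. by move=> mD If; under eq_fun do rewrite EFinM; exact: integrableZl. Qed.

Lemma measurable_lipschitz phi K : (forall x y, `|phi x - phi y| <= K * `|x - y|) ->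
  measurable_fun setT phi.
Proof. by move=> h; apply: continuous_measurable_rV; exact: continuous_lipschitz h. Qed.

Definition Lloc1 f := measurable_fun setT f /\ forall r, mu.-integrable (@cube R n r) (EFin \o f).

Lemma Lloc1_integrable f : mu.-integrable setT (EFin \o f) -> Lloc1 f.
Proof.
move=> If; split; first by have := measurable_int mu If; move/measurable_EFinP.
by move=> r; apply: integrableS If => //; exact: measurable_cube.
Qed.

Lemma Lloc1_bounded f K : measurable_fun setT f -> (forall x, `|f x| <= K) -> Lloc1 f.
Proof.
move=> mf fK; split=> // r; apply: measurable_bounded_integrable => //.
- exact: measurable_cube.
- exact: lebesgue_measure_rV_cube.
- exact: measurable_funTS.
- exists K; split; first exact: num_real.
  by move=> M KM x _; apply: le_trans (fK x) _; exact: ltW.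
Qed.

Lemma Lloc1_le f g : measurable_fun setT f -> Lloc1 g -> (forall x, `|f x| <= `|g x|) -> Lloc1 f.
Proof.
move=> mf [mg Ig] fg; split=> // r; apply: le_integrable (Ig r) => //.
- exact: measurable_cube.
- apply/measurable_EFinP; exact: measurable_funTS.
- by move=> x _; rewrite lee_fin.
Qed.

Lemma Lloc1D f g : Lloc1 f -> Lloc1 g -> Lloc1 (fun x => f x + g x).
Proof.
move=> [mf If] [mg Ig]; split=> [|r]; first exact: measurable_funD.
by apply: EFin_integrableD; [exact: measurable_cube|exact: If|exact: Ig].
Qed.

Lemma Lloc1Z (k : R) f : Lloc1 f -> Lloc1 (fun x => k * f x).
Proof.
move=> [mf If]; split=> [|r]; first exact: measurable_funM.
by apply: EFin_integrableZ => //; exact: measurable_cube.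
Qed.

Lemma Lloc1B f g : Lloc1 f -> Lloc1 g -> Lloc1 (fun x => f x - g x).
Proof.
move=> If Ig; have := Lloc1D If (Lloc1Z (-1) Ig).
by congr Lloc1; apply/funext => x; rewrite mulN1r.
Qed.

Definition bounded_supp phi r K := [/\ measurable_fun setT phi, forall y, `|phi y| <= K &
  forall y, ~ cube r y -> phi y = 0].

Lemma integrable_mul_supp f phi r K : Lloc1 f -> bounded_supp phi r K ->
  mu.-integrable setT (fun y => (f y * phi y)%:E).
Proof.
move=> [mf If] [mp pK p0].
have -> : (fun y => (f y * phi y)%:E) = (fun y => (f y * phi y)%:E) \_ (cube r).
  by apply/funext => y; rewrite patchE; case: ifPn => //; rewrite notin_setE => /p0 ->; rewrite mulr0.
apply: (integrable_mkcond _ (measurable_cube r)).1.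
apply: (@le_integrable _ _ _ mu _ _ _ (fun y => (K%:E * (f y)%:E)%E)).
- exact: measurable_cube.
- by apply/measurable_EFinP/measurable_funM; exact: measurable_funTS.
- move=> y _; rewrite lee_fin mulrC !normrM ler_wpM2r//.
  by rewrite (le_trans (pK y))// ler_norm.
- by apply: integrableZl; [exact: measurable_cube|exact: If].
Qed.

Lemma integral_mul_supp_le f phi r K : Lloc1 f -> bounded_supp phi r K ->
  (`|\int[mu]_y (f y * phi y)|%:E <= K%:E * \int[mu]_(y in cube r) `|f y|%:E)%E.
Proof.
move=> lf bp; have [[mf If] [mp pK p0]] := (lf, bp).
have K0 : 0 <= K by rewrite (le_trans _ (pK 0)).
have mabs : measurable_fun (@cube R n r) (fun y => (`|f y|)%:E).
  by apply/measurable_EFinP; apply: measurableT_comp => //; exact: measurable_funTS.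
rewrite EFin_normr_Rintegral//; last exact: integrable_mul_supp bp.
apply: (le_trans (le_abse_integral _ _ _)) => //.
  by apply/measurable_EFinP; exact: measurable_funM.
rewrite -ge0_integralZl//; last exact: measurable_cube.
rewrite [leRHS]integral_mkcond; apply: ge0_le_integral => //.
- by apply: measurableT_comp => //; apply/measurable_EFinP; exact: measurable_funM.
- apply/(measurable_restrictT _ _).1 => //; first exact: measurable_cube.
  exact: measurable_funeM.
- move=> y _; rewrite patchE; case: ifPn => [_|]; last first.
    by rewrite notin_setE => /p0 ->; rewrite mulr0 /= normr0.
  by rewrite -EFinM lee_fin normrM mulrC ler_wpM2r.
Qed.

Definition convol rho f x := \int[mu]_y (f y * rho (x - y)).

Lemma mollifier_measurable rho e : mollifier rho e -> measurable_fun setT rho.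
Proof. by case=> _ _ _ [K _ [_ /measurable_lipschitz]]. Qed.

Lemma cube_out r y : 0 <= r -> ~ cube r y -> r < `|y|.
Proof. by move=> r0 yr; rewrite ltNge; apply/negP => yr'; apply: yr; apply/cubeP. Qed.

Lemma mollifier_supp rho e x : mollifier rho e -> 0 <= e -> exists2 K, 0 <= K &
  bounded_supp (fun y => rho (x - y)) (`|x| + e) K.
Proof.
move=> M e0; have mr := mollifier_measurable M.
have [r0 rout _ [K K0 [rK _]] _] := M; exists K => //; split=> [|y|y yr].
- exact: measurable_kernel.
- by rewrite ger0_norm.
- apply: rout; have := cube_out (addr_ge0 (normr_ge0 x) e0) yr.
  have := lerB_dist y x; rewrite distrC; lra.
Qed.

Lemma integrable_convol rho e f x : mollifier rho e -> 0 <= e -> Lloc1 f ->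
  mu.-integrable setT (fun y => (f y * rho (x - y))%:E).
Proof.
move=> M e0 lf; have [K _ bK] := mollifier_supp x M e0.
exact: integrable_mul_supp bK.
Qed.

Lemma convolD rho e f g x : mollifier rho e -> 0 <= e -> Lloc1 f -> Lloc1 g ->
  convol rho (fun y => f y + g y) x = convol rho f x + convol rho g x.
Proof.
move=> M e0 lf lg; rewrite -RintegralD//; try exact: integrable_convol M e0 _.
by apply: eq_Rintegral => y _; rewrite mulrDl.
Qed.

Lemma convolZ rho e f (k : R) x : mollifier rho e -> 0 <= e -> Lloc1 f ->
  convol rho (fun y => k * f y) x = k * convol rho f x.
Proof.
move=> M e0 lf; rewrite -RintegralZl//; last exact: integrable_convol M e0 _.
by apply: eq_Rintegral => y _; rewrite mulrA.
Qed.

Lemma convolB rho e f g x : mollifier rho e -> 0 <= e -> Lloc1 f -> Lloc1 g ->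
  convol rho (fun y => f y - g y) x = convol rho f x - convol rho g x.
Proof.
move=> M e0 lf lg; rewrite -RintegralB//; try exact: integrable_convol M e0 _.
by apply: eq_Rintegral => y _; rewrite mulrBl.
Qed.

Lemma convol_cst rho e (c : R) x : mollifier rho e -> 0 <= e -> convol rho (fun=> c) x = c.
Proof.
move=> M e0; have lc : Lloc1 (fun=> 1 : R) by apply: (@Lloc1_bounded _ 1) => // y; rewrite normr1.
rewrite (_ : (fun=> c) = (fun y : X => c * 1)); last by apply/funext => y; rewrite mulr1.
rewrite (convolZ c x M e0 lc) /convol /Rintegral; under eq_integral do rewrite mul1r.
by have [_ _ _ _ ->] := M; rewrite mulr1.
Qed.

Lemma convol_le rho e f g x : mollifier rho e -> 0 <= e -> Lloc1 f -> Lloc1 g ->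
  (forall y, `|x - y| <= e -> f y <= g y) -> convol rho f x <= convol rho g x.
Proof.
move=> M e0 lf lg fg; apply: le_Rintegral => //; try exact: integrable_convol M e0 _.
move=> y _; have [r0 rout _ _ _] := M.
have [xy|/rout ->] := leP `|x - y| e; last by rewrite !mulr0.
by rewrite ler_wpM2r// fg.
Qed.

Lemma convol_near rho e f x (a d : R) : mollifier rho e -> 0 <= e -> Lloc1 f ->
  (forall y, `|x - y| <= e -> `|f y - a| <= d) -> `|convol rho f x - a| <= d.
Proof.
move=> M e0 lf fa; have lc (c : R) : Lloc1 (fun=> c : R) by exact: (@Lloc1_bounded _ `|c|).
have h1 : convol rho (fun=> a - d) x <= convol rho f x.
  by apply: convol_le M e0 _ lf _ => // y /fa; rewrite ler_norml; lra.
have h2 : convol rho f x <= convol rho (fun=> a + d) x.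
  by apply: convol_le M e0 lf _ _ => // y /fa; rewrite ler_norml; lra.
move: h1 h2; rewrite !(convol_cst _ _ M e0) ler_norml; lra.
Qed.

Lemma convol_eq rho e f g x : mollifier rho e ->
  (forall y, `|x - y| <= e -> f y = g y) -> convol rho f x = convol rho g x.
Proof.
move=> M fg; apply: eq_Rintegral => y _; have [r0 rout _ _ _] := M.
by have [/fg ->//|/rout ->] := leP `|x - y| e; rewrite !mulr0.
Qed.

Lemma continuous_convol rho e f : mollifier rho e -> 0 <= e -> Lloc1 f -> continuous (convol rho f).
Proof.
move=> M e0 lf; have mr := mollifier_measurable M.
have [r0 rout _ [K K0 [rK rL]] _] := M.
pose I (r : R) : R := fine (\int[mu]_(y in cube r) `|f y|%:E).
have If r : (\int[mu]_(y in cube r) `|f y|%:E)%E = (I r)%:E.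
  rewrite fineK//; apply: integrable_fin_num; first exact: measurable_cube.
  by apply: (integrable_abse (f := EFin \o f)); have [_] := lf; apply.
apply: (@continuous_local_lipschitz _ (fun x => K * I (`|x| + e + 1))) => x x' xx'.
pose phi y := rho (x - y) - rho (x' - y).
have bp : bounded_supp phi (`|x| + e + 1) (K * `|x - x'|).
  split=> [|y|y].
  - by apply: measurable_funB; exact: measurable_kernel.
  - by rewrite (le_trans (rL _ _))// opprB addrA subrK.
  - move=> /(cube_out (addr_ge0 (addr_ge0 (normr_ge0 x) e0) ler01)) yr.
    have h1 := lerB_dist y x; have h2 := lerB_dist y x'; have h3 := lerB_dist x' x.
    rewrite (distrC y) in h1; rewrite (distrC y) in h2; rewrite (distrC x' x) in h3.
    by rewrite /phi !rout ?subrr//; lra.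
rewrite -lee_fin; apply: le_trans (_ : (K * `|x - x'|)%:E * (I (`|x| + e + 1))%:E <= _)%E.
  rewrite -If -RintegralB//; try exact: integrable_convol M e0 _.
  have := integral_mul_supp_le lf bp; congr (_ <= _)%E; congr (`|_|%:E).
  by apply: eq_Rintegral => y _; rewrite mulrBr.
by rewrite -EFinM lee_fin mulrAC.
Qed.

(** The discrete Laplacian in [x] is moved onto the kernel, where it is a discrete Laplacian in [y].
    Dominated convergence turns it into the Laplacian of the kernel, and the equation is tested with
    [y |-> rho (x - y)]. *)
Lemma haslap_convol rho e u g : mollifier rho e -> smooth_kernel rho -> 0 <= e -> Lloc1 u ->
  distributional_poisson u g -> forall x, haslap (convol rho u) (- convol rho g x) x.
Proof.
move=> M [tk hk [K K0 lK]] e0 lu up x; have mr := mollifier_measurable M.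
have [r0 rout _ _ _] := M.
pose k m y := lapdisc (step m) (fun z => rho (x - z)) y.
have kE m y : k m y = \sum_(i < n) (rho (x - step m *: delta_mx 0 i - y) +
    rho (x + step m *: delta_mx 0 i - y) - 2 * rho (x - y)) / step m ^+ 2.
  by apply: eq_bigr => i _; rewrite !opprD !addrA opprK; congr ((rho _ + rho _ - _) / _);
    rewrite addrAC.
have Ik z : mu.-integrable setT (fun y => (u y * rho (z - y))%:E).
  exact: integrable_convol M e0 lu.
have kint m : lapdisc (step m) (convol rho u) x = \int[mu]_y (u y * k m y).
  pose F (i : 'I_n) y := (step m ^+ 2)^-1 * (u y * rho (x - step m *: delta_mx 0 i - y) +
    u y * rho (x + step m *: delta_mx 0 i - y) - 2 * (u y * rho (x - y))).
  have IF1 i : mu.-integrable setT (fun y => (u y * rho (x - step m *: delta_mx 0 i - y) +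
    u y * rho (x + step m *: delta_mx 0 i - y))%:E).
    exact: EFin_integrableD measurableT (Ik _) (Ik _).
  have IF2 : mu.-integrable setT (fun y => (2 * (u y * rho (x - y)))%:E).
    exact: EFin_integrableZ 2 measurableT (Ik _).
  have IF3 i : mu.-integrable setT (fun y => (u y * rho (x - step m *: delta_mx 0 i - y) +
    u y * rho (x + step m *: delta_mx 0 i - y) - 2 * (u y * rho (x - y)))%:E).
    exact: EFin_integrableB measurableT (IF1 i) IF2.
  have IF i : mu.-integrable setT (EFin \o F i).
    exact: EFin_integrableZ measurableT (IF3 i).
  rewrite /Rintegral; under eq_integral => y _.
    rewrite kE mulr_sumr (_ : \sum_(i < n) _ = \sum_(i < n) F i y); last first.
      by apply: eq_bigr => i _; rewrite /F; ring.
    rewrite -sumEFin; over.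
  rewrite integral_sum// -sum_fine; last by move=> i _; exact: (integrable_fin_num measurableT (IF i)).
  apply: eq_bigr => i _; rewrite -[RHS]/(\int[mu]_y F i y).
  rewrite /F (RintegralZl _ measurableT (IF3 i)) (RintegralB measurableT (IF1 i) IF2).
  rewrite (RintegralD measurableT (Ik _) (Ik _)) (RintegralZl _ measurableT (Ik _)).
  by rewrite mulrC addrC [X in _ * (X - _)]addrC addrC.
(* As [step m <= 1], the cube of this radius contains the supports of all the kernels [k m], and
   [K * |u|] on it is the dominating function. *)
pose r := `|x| + e + 1.
have rr0 : 0 <= r by rewrite /r; have := normr_ge0 x; lra.
have bk m : bounded_supp (k m) r K.
  split=> [|y|y /(cube_out rr0) yr].
  - have -> : k m = fun y => \sum_(i < n) (rho (x - step m *: delta_mx 0 i - y) +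
        rho (x + step m *: delta_mx 0 i - y) - 2 * rho (x - y)) / step m ^+ 2.
      by apply/funext => y; exact: kE.
    apply: measurable_sum => i; apply: measurable_funM => //; apply: measurable_funB.
      by apply: measurable_funD; exact: measurable_kernel.
    by apply: measurable_funM => //; exact: measurable_kernel.
  - exact: lK.
  - have h z : `|z| <= 1 -> rho (x + z - y) = 0.
      move=> z1; apply: rout; have h1 := lerB_dist y (x + z); rewrite distrC in h1.
      by have := ler_normD x z; move: yr; rewrite /r; lra.
    have s1 (i : 'I_n) : `|step m *: delta_mx 0 i : X| <= 1.
      rewrite normrZ ger0_norm ?(ltW (step_gt0 _))// mulr_ile1 ?(ltW (step_gt0 _)) ?step_le1//.
      apply/cubeP => // j; rewrite /= in_itv/= mxE eqxx/=.
      by case: (_ == _) => /=; rewrite ?mulr1n ?mulr0n; lra.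
    rewrite kE big1// => i _; rewrite !h ?normrN//.
    by have := h 0; rewrite addr0 normr0 => ->; rewrite // mulr0 !addr0 subr0 mul0r.
pose k0 y := laplacian (fun z => rho (x - z)) y.
have kk0 y : k m y @[m --> \oo] --> k0 y by exact: hk.
have mk0 : measurable_fun setT k0.
  apply: (measurable_fun_cvg (h := k)) => [m|y _]; first by case: (bk m).
  exact: kk0.
have [mu_ _] := lu.
have := @dominated_convergence _ _ _ mu setT measurableT (fun m y => (u y * k m y)%:E)
  (fun y => (u y * k0 y)%:E) (fun y => `|u y * (K * \1_(cube r) y)|%:E).
case.
- by move=> m; apply/measurable_EFinP/measurable_funM => //; case: (bk m).
- by apply/measurable_EFinP/measurable_funM.
- apply: aeW => y _; apply: cvg_EFin; first by apply: nearW.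
  by apply: (@cvgMl_tmp _ _ _ _ _ (u y) _ (kk0 y)).
- apply: (integrable_abse (f := fun y => (u y * (K * \1_(cube r) y))%:E)).
  apply: (@integrable_mul_supp _ _ r K) => //; split=> [|y|y yr].
  + by apply: measurable_funM => //; apply: measurable_indic; exact: measurable_cube.
  + by rewrite indicE; case: (_ \in _); rewrite /= ?mulr1 ?mulr0 ?normr0// ger0_norm.
  + by rewrite indicE memNset// mulr0.
- apply: aeW => y m _; rewrite lee_fin !normrM ler_wpM2l//.
  have [_ h1 h2] := bk m; rewrite indicE; case: (boolP (y \in _)) => [_|].
    by rewrite normr1 mulr1 (ger0_norm K0).
  by rewrite notin_setE => /h2 ->; rewrite normr0 mulr_ge0.
move=> Ik0 _ C.
have -> : - convol rho g x = \int[mu]_y (u y * k0 y).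
  have := up _ (tk x); rewrite -/(convol rho g x) => <-.
  have := RintegralZl (-1) measurableT Ik0; rewrite mulN1r => E.
  apply: oppr_inj; rewrite opprK -E.
  by apply: eq_Rintegral => y _; rewrite mulrN mulN1r.
rewrite /haslap; under eq_fun do rewrite kint.
apply: fine_cvg; rewrite fineK; last exact: integrable_fin_num.
exact: C.
Qed.

Lemma convol_le1 rho e (L : R) (u v : X -> R) : mollifier rho e -> smooth_kernel rho -> 0 <= e ->
  0 <= L -> (forall x, 0 <= u x) ->
  Lloc1 u -> Lloc1 (fun x => u x ^+ 3) -> Lloc1 (fun x => L * u x * v x ^+ 2) ->
  distributional_poisson u (fun x => reac L (u x) (v x)) -> forall x, convol rho u x <= 1.
Proof.
move=> M Sk e0 L0 u0 lu lu3 luv up.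
have lc (c : R) : Lloc1 (fun=> c : R) by exact: (@Lloc1_bounded _ `|c|).
have c0 x : 0 <= convol rho u x by apply: Rintegral_ge0 => y _; case: M => r0 *; rewrite mulr_ge0.
apply: (@keller_osserman _ _ (convol rho u) (fun x => - convol rho (fun x => reac L (u x) (v x)) x)) => //.
- exact: continuous_convol M e0 lu.
- exact: haslap_convol M Sk e0 lu up.
move=> x; have := convolB x M e0 (Lloc1B lu lu3) luv; rewrite (convolB x M e0 lu lu3).
rewrite /reac => ->.
(* Jensen's inequality through the tangent line of the cube at [m]: for [t, m >= 0] the difference
   [t ^+ 3 - (3 * m ^+ 2 * t - 2 * m ^+ 3)] is [(t - m) ^+ 2 * (t + 2 * m)]. *)
have c3 : convol rho u x ^+ 3 <= convol rho (fun y => u y ^+ 3) x.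
  set m := convol rho u x.
  have := convolB x M e0 (Lloc1Z (3 * m ^+ 2) lu) (lc (2 * m ^+ 3)).
  rewrite (convolZ _ x M e0 lu) (convol_cst _ x M e0) -/m => E.
  have -> : m ^+ 3 = 3 * m ^+ 2 * m - 2 * m ^+ 3 by ring.
  rewrite -E; apply: convol_le M e0 _ lu3 _; first exact: Lloc1B (Lloc1Z _ lu) (lc _).
  move=> y _; rewrite -subr_ge0.
  have -> : u y ^+ 3 - (3 * m ^+ 2 * u y - 2 * m ^+ 3) = (u y - m) ^+ 2 * (u y + 2 * m) by ring.
  by rewrite mulr_ge0 ?sqr_ge0// addr_ge0// mulr_ge0// c0.
have c4 : 0 <= convol rho (fun y => L * u y * v y ^+ 2) x.
  apply: Rintegral_ge0 => y _; case: M => r0 *; rewrite mulr_ge0// mulr_ge0 ?sqr_ge0//.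
  exact: mulr_ge0.
lra.
Qed.

End convolution.

(** * Mollifications converge in L^1 *)

Section approximate_identity.
Context {R : realType} {n : nat}.
Local Notation X := 'rV[R]_n.
Local Notation mu := (@lebesgue_measure_rV R n).
Implicit Types (f g : X -> R) (x y z : X) (r e : R) (A : set X).

Definition norm1 f : \bar R := (\int[mu]_x `|f x|%:E)%E.

Lemma norm1D f g : measurable_fun setT f -> measurable_fun setT g ->
  (norm1 (fun x => (f x + g x)%R) <= norm1 f + norm1 g)%E.
Proof.
move=> mf mg; have ma (h : X -> R) : measurable_fun setT h -> measurable_fun setT (fun x => `|h x|%:E).
  by move=> mh; apply/measurable_EFinP; exact: measurableT_comp.
rewrite /norm1 -ge0_integralD//; try exact: ma.
apply: ge0_le_integral => //.
- by apply: ma; exact: measurable_funD.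
- by apply: emeasurable_funD; exact: ma.
- by move=> x _; rewrite -EFinD lee_fin ler_normD.
Qed.

Lemma norm1N f : norm1 (fun x => - f x) = norm1 f.
Proof. by apply: eq_integral => x _; rewrite normrN. Qed.

Lemma norm1Z (k : R) f : measurable_fun setT f ->
  norm1 (fun x => k * f x) = (`|k|%:E * norm1 f)%E.
Proof.
move=> mf; rewrite /norm1 -ge0_integralZl//; last first.
  by apply/measurable_EFinP; exact: measurableT_comp.
by apply: eq_integral => x _; rewrite normrM EFinM.
Qed.

Lemma measurable_convol rho e f : mollifier rho e -> 0 <= e -> Lloc1 f ->
  measurable_fun setT (convol rho f).
Proof. by move=> M e0 lf; apply: continuous_measurable_rV; exact: continuous_convol M e0 lf. Qed.

Lemma EFin_convol rho e f x : mollifier rho e -> 0 <= e -> Lloc1 f ->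
  ((convol rho f x)%:E = \int[mu]_y (f y * rho (x - y))%:E)%E.
Proof.
move=> M e0 lf; rewrite fineK//.
exact: (integrable_fin_num measurableT (integrable_convol x M e0 lf)).
Qed.

(** By Tonelli's theorem the kernel is integrated in its first variable; its evenness reduces this
    to the mass condition, which concerns the second one. *)
Lemma integral_convol rho e f : mollifier rho e -> 0 <= e -> Lloc1 f -> (forall x, 0 <= f x) ->
  (\int[mu]_x (convol rho f x)%:E = \int[mu]_x (f x)%:E)%E.
Proof.
move=> M e0 lf f0; have mr := mollifier_measurable M; have [mf _] := lf.
have [r0 _ rN _ r1] := M.
pose F (p : X * X) := ((f p.2 * rho (p.1 - p.2))%:E : \bar R).
have mF : measurable_fun setT F.
  apply/measurable_EFinP; apply: measurable_funM; last exact: measurable_kernel2.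
  exact: (measurableT_comp mf measurable_snd).
have F0 p : (0 <= F p)%E by rewrite lee_fin mulr_ge0.
under eq_integral do rewrite (EFin_convol _ M e0 lf).
have := fubini_tonelli (m1 := (@lebesgue_measure_rV R n : {sigma_finite_measure set X -> \bar R}))
  (m2 := (@lebesgue_measure_rV R n : {sigma_finite_measure set X -> \bar R})) F mF F0.
rewrite /F/= => ->; apply: eq_integral => y _.
under eq_integral do rewrite EFinM.
rewrite ge0_integralZl ?lee_fin//; last 2 first.
- by apply/measurable_EFinP; exact: measurable_kernelr.
- by move=> x _; rewrite lee_fin.
under eq_integral do rewrite -rN opprB.
by rewrite r1 mule1.
Qed.

Lemma norm1_convol rho e f : mollifier rho e -> 0 <= e -> Lloc1 f ->
  (norm1 (convol rho f) <= norm1 f)%E.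
Proof.
move=> M e0 lf; have [mf If] := lf.
have la : Lloc1 (fun x => `|f x|).
  by apply: Lloc1_le lf _ => [|x]; [exact: measurableT_comp|rewrite normr_id].
rewrite /norm1 -(integral_convol M e0 la)//; apply: ge0_le_integral => //.
- by apply/measurable_EFinP; apply: measurableT_comp => //; exact: measurable_convol M e0 lf.
- by apply/measurable_EFinP; exact: measurable_convol M e0 la.
- move=> x _; rewrite lee_fin.
  apply: le_trans (le_normr_Rintegral measurableT (integrable_convol x M e0 lf)) _.
  apply: le_Rintegral => //.
  + apply: (integrable_abse (f := fun y => (f y * rho (x - y))%:E)).
    exact: integrable_convol M e0 lf.
  + exact: integrable_convol M e0 la.
  + by move=> y _; rewrite normrM; case: M => r0 *; rewrite (ger0_norm (r0 _)).
Qed.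

Variable rho : nat -> X -> R.
Hypothesis rhoM : forall k, mollifier (rho k) (step k).

Let s0 k : 0 <= step k :> R. Proof. exact/ltW/step_gt0. Qed.

(** This class is closed under linear combinations and L^1 limits, and contains the indicators of
    open sets of finite measure. A Dynkin argument extends it to measurable sets, simple functions
    follow by linearity, and integrable functions by approximation. *)
Definition regularized f := mu.-integrable setT (EFin \o f) /\
  forall d : R, 0 < d -> \forall k \near \oo, (norm1 (fun x => (convol (rho k) f x - f x)%R) <= d%:E)%E.

Let mi f : mu.-integrable setT (EFin \o f) -> measurable_fun setT f.
Proof. by move/(measurable_int mu)/measurable_EFinP. Qed.

Let mc k f : mu.-integrable setT (EFin \o f) -> measurable_fun setT (convol (rho k) f).
Proof. by move/Lloc1_integrable; exact: measurable_convol. Qed.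

Lemma regularizedD f g : regularized f -> regularized g -> regularized (fun x => f x + g x).
Proof.
move=> [If cf] [Ig cg]; split; first exact: EFin_integrableD.
move=> d d0; have d2 : 0 < d / 2 by rewrite divr_gt0.
apply: filterS2 (cf _ d2) (cg _ d2) => k fk gk.
rewrite (_ : (fun x => _) = (fun x => (convol (rho k) f x - f x) + (convol (rho k) g x - g x))).
  apply: le_trans (norm1D _ _) _; try by apply: measurable_funB; [exact: mc|exact: mi].
  by rewrite [d]splitr EFinD leeD.
apply/funext => x.
rewrite (convolD x (rhoM k) (s0 k) (Lloc1_integrable If) (Lloc1_integrable Ig)); ring.
Qed.

Lemma regularizedZ (c : R) f : regularized f -> regularized (fun x => c * f x).
Proof.
move=> [If cf]; split; first exact: EFin_integrableZ.
move=> d d0; have c1 : 0 < `|c| + 1 by rewrite ltr_wpDl.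
have d1 : 0 < d / (`|c| + 1) by rewrite divr_gt0.
apply: filterS (cf _ d1) => k fk.
rewrite (_ : (fun x => _) = (fun x => c * (convol (rho k) f x - f x))).
  rewrite norm1Z; last by apply: measurable_funB; [exact: mc|exact: mi].
  apply: (@le_trans _ _ (`|c|%:E * (d / (`|c| + 1))%:E)%E); first by rewrite lee_wpmul2l.
  by rewrite -EFinM lee_fin mulrCA ger_pMr// ler_pdivrMr// mul1r lerDl.
apply/funext => x; rewrite (convolZ c x (rhoM k) (s0 k) (Lloc1_integrable If)); ring.
Qed.

Lemma regularizedB f g : regularized f -> regularized g -> regularized (fun x => f x - g x).
Proof.
move=> rf rg; have := regularizedD rf (regularizedZ (-1) rg).
by congr regularized; apply/funext => x; rewrite mulN1r.
Qed.

Lemma regularized_sum (I : Type) (s : seq I) (F : I -> X -> R) :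
  (forall i, regularized (F i)) -> regularized (fun x => \sum_(i <- s) F i x).
Proof.
move=> rF; elim: s => [|i s IH].
  rewrite (_ : (fun x => _) = (fun x : X => 0 * 0)).
    apply: regularizedZ; split=> [|d d0]; first exact: integrable0.
    apply: nearW => k; rewrite (_ : (fun x => _) = (fun=> 0)).
      by rewrite /norm1; under eq_integral do rewrite normr0; rewrite integral0 lee_fin ltW.
    by apply/funext => x; rewrite (convol_cst _ _ (rhoM k) (s0 k)) subr0.
  by apply/funext => x; rewrite big_nil mul0r.
rewrite (_ : (fun x => _) = (fun x => F i x + \sum_(j <- s) F j x)); first exact: regularizedD.
by apply/funext => x; rewrite big_cons.
Qed.

(** Three-term splitting, in which the term [convol (rho k) (f - g)] is controlled because
    convolution contracts the L^1 norm. *)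
Lemma regularized_closed f : mu.-integrable setT (EFin \o f) ->
  (forall d, 0 < d -> exists2 g, regularized g & (norm1 (fun x => (f x - g x)%R) <= d%:E)%E) ->
  regularized f.
Proof.
move=> If fg; split=> // d d0; have d3 : 0 < d / 3 by rewrite divr_gt0.
have [g [Ig cg] gd] := fg _ d3.
apply: filterS (cg _ d3) => k gk.
have mfg : measurable_fun setT (fun x => f x - g x) by apply: measurable_funB; exact: mi.
have Ifg : mu.-integrable setT (EFin \o (fun x => f x - g x)) by exact: EFin_integrableB.
have mcg : measurable_fun setT (fun x => convol (rho k) g x - g x).
  by apply: measurable_funB; [exact: mc|exact: mi].
rewrite (_ : (fun x => _) = (fun x => (convol (rho k) (fun x => f x - g x) x +
  (convol (rho k) g x - g x)) + - (f x - g x))).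
  apply: le_trans (norm1D _ _) _.
  - by apply: measurable_funD => //; exact: mc.
  - exact: measurableT_comp.
  rewrite norm1N (_ : d = (d / 3 + d / 3) + d / 3); last by field.
  rewrite EFinD leeD// EFinD; apply: le_trans (norm1D _ _) _ => //; first exact: mc.
  by rewrite leeD// (le_trans _ gd)// (norm1_convol (rhoM k) (s0 k))//; exact: Lloc1_integrable.
apply/funext => x.
rewrite (convolB x (rhoM k) (s0 k) (Lloc1_integrable If) (Lloc1_integrable Ig)); ring.
Qed.

Let integrable1 A : measurable A -> (mu A < +oo)%E ->
  mu.-integrable setT (EFin \o (\1_A : X -> R)).
Proof.
move=> mA Aoo; apply/integrableP; split.
  by apply/measurable_EFinP; exact: measurable_indic.
under eq_integral do rewrite /= ger0_norm//.
by rewrite integral_indic// setIT.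
Qed.

(* [|h - 1_O| = h + 1_O - 2 h 1_O] for [0 <= h <= 1], and [h = convol 1_O] has the same integral as [1_O] *)
Lemma regularized_open A : open A -> (mu A < +oo)%E -> regularized (\1_A : X -> R).
Proof.
move=> oA Aoo; have mA := open_measurable_rV oA.
have I1 := integrable1 mA Aoo; have l1 := Lloc1_integrable I1.
split=> //; pose h k := convol (rho k) (\1_A : X -> R).
have l_cst (c : R) : Lloc1 (fun _ : X => c) by exact: (@Lloc1_bounded _ _ _ `|c|).
have h0 k x : 0 <= h k x.
  have := @convol_le _ _ (rho k) (step k) (fun=> 0) (\1_A) x (rhoM k) (s0 k) (l_cst 0) l1.
  by rewrite (convol_cst _ _ (rhoM k) (s0 k)); apply=> y _.
have h1 k x : h k x <= 1.
  have := @convol_le _ _ (rho k) (step k) (\1_A) (fun=> 1) x (rhoM k) (s0 k) l1 (l_cst 1).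
  by rewrite (convol_cst _ _ (rhoM k) (s0 k)); apply=> y _; rewrite indicE lern1 leq_b1.
have mh k : measurable_fun setT (h k) by exact: mc.
have m1 : measurable_fun setT (\1_A : X -> R) by exact: mi.
pose m : R := fine (mu A); have mE : mu A = m%:E by rewrite fineK// ge0_fin_numE.
have e2 : (\int[mu]_x (\1_A x)%:E = m%:E)%E by rewrite integral_indic// setIT -mE.
(* A ball around [x] lies in the open set, so [h k x] equals 1 once [step k] is below its radius. By
   dominated convergence the integral of [h k * \1_A] tends to the measure of [A]. *)
have ha x : A x -> h k x @[k --> \oo] --> (1 : R).
  move=> Ax; have /nbhs_ballP[t /= t0 tA] := open_nbhs_nbhs (conj oA Ax).
  have : \forall k \near \oo, step k < t.
    have /cvgrPdist_lt/(_ _ t0) := @cvg_step R; apply: filterS => k.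
    by rewrite sub0r normrN ger0_norm.
  move=> H; apply/cvgrPdist_le => d d0; apply: filterS H => k kt.
  rewrite distrC; apply: (convol_near (rhoM k) (s0 k) l1) => y xy.
  rewrite indicE mem_set ?subrr ?normr0 ?ltW//; apply: tA.
  by rewrite -ball_normE /=; exact: le_lt_trans xy kt.
have := @dominated_convergence _ _ _ mu setT measurableT (fun k x => (h k x * \1_A x)%:E)
  (fun x => (\1_A x)%:E) (fun x => (\1_A x)%:E).
case.
- by move=> k; apply/measurable_EFinP; exact: measurable_funM.
- exact/measurable_EFinP.
- apply: aeW => x _; apply: cvg_EFin; first exact: nearW.
  rewrite indicE; have [xA|xA] := boolP (x \in A).
    by under eq_fun do rewrite mulr1; apply: ha; rewrite inE in xA.
  by under eq_fun do rewrite mulr0; exact: cvg_cst.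
- exact: I1.
- apply: aeW => x k _; rewrite lee_fin normrM (ger0_norm (h0 _ _)) ger0_norm//.
  by rewrite ler_piMl.
move=> _ _; rewrite e2 => C.
move=> d d0; have d2 : 0 < d / 2 by rewrite divr_gt0.
have C' : fine (\int[mu]_x (h k x * \1_A x)%:E)%E @[k --> \oo] --> m.
  by apply: fine_cvg; exact: C.
have /cvgrPdist_le/(_ _ d2) := C'.
apply: filterS => k /=; set J := (\int[mu]_x _)%E => Jd.
have J0 : (0 <= J)%E by apply: integral_ge0 => x _; rewrite lee_fin mulr_ge0.
have ma : measurable_fun setT (fun x => `|h k x - \1_A x|).
  by apply: measurableT_comp => //; exact: measurable_funB.
have mJ : measurable_fun setT (fun x => (h k x * \1_A x)%:E).
  by apply/measurable_EFinP; exact: measurable_funM.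
have j0 x : (0 <= (h k x * \1_A x)%:E)%E by rewrite lee_fin mulr_ge0.
have E : (norm1 (fun x => (h k x - \1_A x)%R) + (J + J) = m%:E + m%:E)%E.
  have e1 : (\int[mu]_x (h k x)%:E = m%:E)%E.
    by rewrite (integral_convol (rhoM k) (s0 k) l1).
  have mhE : measurable_fun setT (fun x => (h k x)%:E) by exact/measurable_EFinP.
  have m1E : measurable_fun setT (fun x : X => (\1_A x)%:E : \bar R) by exact/measurable_EFinP.
  have maE : measurable_fun setT (fun x => (`|h k x - \1_A x|)%:E) by exact/measurable_EFinP.
  have h0E x : (0 <= (h k x)%:E)%E by rewrite lee_fin.
  have o0E x : (0 <= (\1_A x)%:E :> \bar R)%E by rewrite lee_fin.
  have a0E x : (0 <= `|h k x - \1_A x|%:E)%E by rewrite lee_fin.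
  have jj0 x : (0 <= (h k x * \1_A x)%:E + (h k x * \1_A x)%:E)%E by rewrite adde_ge0.
  rewrite -{1}e1 -e2 /norm1 /J.
  rewrite -(ge0_integralD mu measurableT (fun x _ => h0E x) mhE (fun x _ => o0E x) m1E).
  rewrite -(ge0_integralD mu measurableT (fun x _ => j0 x) mJ (fun x _ => j0 x) mJ).
  rewrite -(ge0_integralD mu measurableT (fun x _ => a0E x) maE (fun x _ => jj0 x)
    (emeasurable_funD mJ mJ)).
  apply: eq_integral => x _; rewrite -!EFinD; congr EFin.
  have := h0 k x; have := h1 k x; rewrite indicE; case: (_ \in _) => /= u1 u0.
    by rewrite ler0_norm; lra.
  by rewrite subr0 ger0_norm//; lra.
have N0 : (0 <= norm1 (fun x => (h k x - \1_A x)%R))%E by exact: integral_ge0.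
move: E N0 J0 Jd; case: (norm1 _) => [a| |]; case: J => [j| |] //= -[E] _ _.
rewrite ler_norml lee_fin; lra.
Qed.

End approximate_identity.

Section approximate_identity_L1.
Context {R : realType} {n : nat}.
Local Notation X := 'rV[R]_n.
Local Notation mu := (@lebesgue_measure_rV R n).
Implicit Types (f g : X -> R) (x y z : X) (r e : R) (A : set X).

Lemma cvge0_le (u : nat -> \bar R) (d : R) : u @ \oo --> 0%E -> 0 < d ->
  \forall k \near \oo, (u k <= d%:E)%E.
Proof.
move=> /fine_cvgP[uf /cvgrPdist_le u0] d0; apply: filterS2 uf (u0 _ d0) => k uk /=.
by rewrite sub0r normrN -[in X in _ -> X](fineK uk) lee_fin; apply: le_trans (ler_norm _).
Qed.

(** The Dynkin argument below starts from the open sets, which are stable under intersection and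
    must generate the sigma-algebra. *)
Lemma measurable_rV_open : @measurable _ X = <<s (@open X)>>.
Proof.
apply/seteqP; split; last first.
  apply: smallest_sub; first exact: sigma_algebra_measurable.
  by move=> A; exact: open_measurable_rV.
have salg : sigma_algebra setT <<s (@open X)>> by exact: smallest_sigma_algebra.
apply: smallest_sub => //; rewrite -bigcup_seq; apply: bigcup_sub => i _ A [B mB <-].
pose T := g_sigma_algebraType (@open X).
have mi : measurable_fun [set: T] (fun x : T => (x : X) ord0 i).
  apply: (measurability _ (RGenOpens.measurableE R)) => _ [_ [a [b ->] <-]].
  rewrite setTI; apply: sub_sigma_algebra; apply: open_comp => [x _|]; last exact: itv_open.
  exact: coord_continuous.
exact: mi.
Qed.

Variable rho : nat -> X -> R.
Hypothesis rhoM : forall k, mollifier (rho k) (step k).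

Let s0 k : 0 <= step k :> R. Proof. exact/ltW/step_gt0. Qed.

Let B r : set X := ball (0 : X) r.

Let BE r x : B r x <-> `|x| < r.
Proof. by rewrite /B -ball_normE /= sub0r normrN. Qed.

Let oB r : open (B r). Proof. exact: ball_open. Qed.

Let mB r : measurable (B r). Proof. by apply: open_measurable_rV; exact: oB. Qed.

Let Boo r : (mu (B r) < +oo)%E.
Proof.
apply: le_lt_trans (lebesgue_measure_rV_cube n r); apply: le_measure; rewrite ?inE; [exact: mB|exact: measurable_cube|].
move=> x /BE xr; apply/cubeP; last exact: ltW.
by rewrite (le_trans (normr_ge0 x))// ltW.
Qed.

Let int1 r A : measurable A -> mu.-integrable setT (EFin \o (fun x => \1_A x * \1_(B r) x : R)).
Proof.
move=> mA; rewrite (_ : (fun x => _) = \1_(A `&` B r)); last first.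
  by apply/funext => x; rewrite indicI.
have mAB : measurable (A `&` B r) by apply: measurableI; [exact: mA|exact: mB].
apply/integrableP; split; first by apply/measurable_EFinP; exact: measurable_indic.
under eq_integral do rewrite /= ger0_norm//.
rewrite integral_indic// setIT; apply: le_lt_trans (Boo r).
by apply: le_measure; rewrite ?inE; [exact: mAB|exact: mB|exact: subIsetr].
Qed.

(** Cutting off by a ball keeps all indicators integrable, so complements become differences.
    Disjoint unions are L^1 limits of finite ones by dominated convergence. *)
Let regularized_indic r A : measurable A -> regularized rho (fun x => \1_A x * \1_(B r) x).
Proof.
have rB O : open O -> regularized rho (fun x => \1_O x * \1_(B r) x).
  move=> oO; rewrite (_ : (fun x => _) = \1_(O `&` B r)); last first.
    by apply/funext => x; rewrite indicI.
  apply: regularized_open => //; first exact: openI.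
  apply: le_lt_trans (Boo r); apply: le_measure; rewrite ?inE; last exact: subIsetr.
    by apply: open_measurable_rV; exact: openI.
  exact: mB.
move=> mA; have := mA; rewrite measurable_rV_open.
apply: (@dynkin_induction _ _ _ (fun A => regularized rho (fun x => \1_A x * \1_(B r) x))).
- exact: measurable_rV_open.
- by move=> ? ?; exact: openI.
- exact/rB/openT.
- exact: rB.
- move=> S mS rS.
  rewrite (_ : (fun x => _) = (fun x => \1_[set: X] x * \1_(B r) x - \1_S x * \1_(B r) x)).
    by apply: regularizedB => //; exact/rB/openT.
  apply/funext => x; rewrite !indicE in_setC in_setT.
  by case: (x \in S) => /=; rewrite ?mul0r ?mul1r ?subr0 ?subrr.
- move=> F mF tF rF.
  pose U N := \big[setU/set0]_(i < N) F i.
  have UE N x : U N x <-> exists2 i, (i < N)%N & F i x.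
    by rewrite /U -bigcup_mkord; split=> -[i]; exists i.
  have mU N : measurable (U N) by exact: bigsetU_measurable.
  have rU N : regularized rho (fun x => \1_(U N) x * \1_(B r) x).
    elim: N => [|N IH].
      by rewrite /U big_ord0; exact/rB/open0.
    rewrite (_ : (fun x => _) = (fun x => \1_(U N) x * \1_(B r) x + \1_(F N) x * \1_(B r) x)).
      exact: regularizedD.
    apply/funext => x; rewrite -mulrDl; congr (_ * _).
    rewrite /U big_ord_recr/= -/(U N) !indicE in_setU.
    have [xU|] := boolP (x \in U N); have [xF|] := boolP (x \in F N); rewrite /= ?addr0 ?add0r//.
    exfalso; move: xU xF; rewrite !inE => /UE[i iN Fi] FN.
    by have := tF i N I I (ex_intro _ x (conj Fi FN)) => iE; move: iN; rewrite iE ltnn.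
  have mUF : measurable (\bigcup_k F k) by exact: bigcup_measurable.
  apply: regularized_closed => //; first exact: int1.
  move=> d d0.
  have := @dominated_convergence _ _ _ mu setT measurableT
    (fun k x => (\1_(U k) x * \1_(B r) x)%:E)
    (fun x => (\1_(\bigcup_k F k) x * \1_(B r) x)%:E) (fun x => (\1_(B r) x)%:E).
  case.
  + by move=> k; apply: measurable_int (int1 r (mU k)).
  + by apply: measurable_int (int1 r mUF).
  + apply: aeW => x _; apply: cvg_EFin; first exact: nearW.
    have C : (\1_(U k) x : R) @[k --> \oo] --> (\1_(\bigcup_k F k) x : R).
      have [xF|xF] := pselect ((\bigcup_k F k) x).
        have [i _ Fi] := xF; apply: cvg_near_cst; exists i.+1 => // k /= ik.
        by rewrite !indicE !mem_set//; apply: (UE k x).2; exists i.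
      apply: cvg_near_cst; apply: nearW => k; rewrite !indicE !memNset// => /(UE k x).1[i _ Fi].
      by apply: xF; exists i.
    by apply: (cvgM C); exact: cvg_cst.
  + have := int1 r measurableT; congr (integrable _ _ _); apply/funext => x /=.
    by rewrite indicT mul1r.
  + apply: aeW => x k _; rewrite lee_fin ger0_norm ?mulr_ge0//.
    by rewrite ler_piMl// indicE lern1 leq_b1.
  move=> _ C _.
  have [k _ kP] := cvge0_le C d0; exists (fun x => \1_(U k) x * \1_(B r) x) => //.
  apply: le_trans (kP k (leqnn k)); rewrite le_eqVlt; apply/orP; left; apply/eqP; apply: eq_integral => x _.
  by rewrite -EFinB abse_EFin distrC.
Qed.

Let regularized_simple r (h : {sfun X >-> R}) : regularized rho (fun x => h x * \1_(B r) x).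
Proof.
have [s hs] : exists s : seq R, forall x, h x = \sum_(y <- s) y * \1_(h @^-1` [set y]) x.
  by eexists => x; rewrite [in LHS]fimfunE fsbig_finite//=.
rewrite (_ : (fun x => _) = (fun x => \sum_(y <- s) y * (\1_(h @^-1` [set y]) x * \1_(B r) x))).
  apply: regularized_sum => // y; apply: regularizedZ => //.
  by apply: regularized_indic; exact: measurable_sfunP.
apply/funext => x; rewrite hs mulr_suml.
by apply: eq_bigr => y _; rewrite mulrA.
Qed.

Let regularized_Lloc1 r f : Lloc1 f -> regularized rho (fun x => f x * \1_(B r) x).
Proof.
move=> lf; have [mf If] := lf.
have IB : mu.-integrable setT (EFin \o (fun x => f x * \1_(B r) x)).
  apply: (@integrable_mul_supp _ _ _ _ `|r| 1) => //; split=> [|y|y yr].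
  - by apply: measurable_indic; exact: mB.
  - by rewrite indicE ger0_norm// lern1 leq_b1.
  - rewrite indicE memNset// => /BE yr'; apply: yr; apply/cubeP => //.
    by rewrite (le_trans (ltW yr'))// ler_norm.
have IBf : mu.-integrable (B r) (EFin \o f).
  apply: integrableS (If `|r|); [exact: measurable_cube|exact: mB|].
  by move=> y /BE yr; apply/cubeP => //; rewrite (le_trans (ltW yr))// ler_norm.
have [g [Ig _ g0]] := approximation_sfun_integrable (mB r) IBf.
apply: regularized_closed => // d d0; have [k _ kP] := cvge0_le g0 d0.
exists (fun x => g k x * \1_(B r) x); first exact: regularized_simple.
apply: le_trans (kP k (leqnn k)); rewrite le_eqVlt; apply/orP; left; apply/eqP.
rewrite [RHS]integral_mkcond; apply: eq_integral => x _.
rewrite patchE indicE; case: (x \in B r); last by rewrite !mulr0 subr0 normr0.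
by rewrite /= !mulr1.
Qed.

Lemma convol_cvg_L1 r f (d : R) : Lloc1 f -> 0 <= r -> 0 < d ->
  \forall k \near \oo, (\int[mu]_(x in cube r) `|convol (rho k) f x - f x|%:E <= d%:E)%E.
Proof.
(* Convolution on the cube of radius [r] sees [f] only up to distance [step k <= 1], hence strictly
   inside the ball of radius [r + 2], where [F = f]. *)
move=> lf r0 d0; pose F x := f x * \1_(B (r + 2)) x.
have [IF cF] := @regularized_Lloc1 (r + 2) f lf.
have lF : Lloc1 F by exact: Lloc1_integrable.
have FE x y k : cube r x -> `|x - y| <= step k -> F y = f y.
  move=> /(cubeP _ r0) xr xy; rewrite /F indicE mem_set ?mulr1//; apply/BE.
  by have := lerB_dist y x; have := @step_le1 R k; rewrite distrC; lra.
apply: filterS (cF _ d0) => k; apply: le_trans.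
have ma : measurable_fun setT (fun x => `|convol (rho k) F x - F x|%:E).
  apply/measurable_EFinP; apply: measurableT_comp => //; apply: measurable_funB.
    exact: measurable_convol (rhoM k) (s0 k) lF.
  by have [] := lF.
apply: (@le_trans _ _ (\int[mu]_(x in cube r) `|convol (rho k) F x - F x|%:E)%E).
  rewrite le_eqVlt; apply/orP; left; apply/eqP; apply: eq_integral => x; rewrite inE => xr.
  rewrite (FE x x k xr) ?subrr ?normr0//.
  by rewrite -(@convol_eq _ _ (rho k) (step k) F f x (rhoM k) (fun y => FE x y k xr)).
by apply: ge0_subset_integral => //; exact: measurable_cube.
Qed.

End approximate_identity_L1.

(** * Regularity of weak solutions *)

Section weak_solutions.
Context {R : realType} {n : nat}.
Local Notation X := 'rV[R]_n.
Local Notation mu := (@lebesgue_measure_rV R n).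
Implicit Types (f g u v : X -> R) (x y z : X) (r e K L : R).

Lemma Lloc_Lloc1 p u : Lloc p u -> Lloc1 (fun x => u x ^+ p).
Proof.
move=> [mu_ Iu]; split; first exact: measurable_funX.
move=> r; apply/integrableP; split.
  by apply/measurable_EFinP; apply: measurable_funTS; exact: measurable_funX.
by under eq_integral do rewrite /= normrX; apply: Iu; exact: compact_cube.
Qed.

Lemma smooth_measurable phi : smooth phi -> measurable_fun setT (phi : X -> R).
Proof. by move=> /(_ [::])[cphi _]; exact: continuous_measurable_rV. Qed.

Lemma smooth_measurable_laplacian phi : smooth phi -> measurable_fun setT (laplacian phi : X -> R).
Proof.
move=> sphi; apply: measurable_sum => i; apply: continuous_measurable_rV.
by have [] := sphi [:: i; i].
Qed.

Lemma distributional_poisson_ae u g u' g' : measurable_fun setT u -> measurable_fun setT g ->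
  measurable_fun setT u' -> measurable_fun setT g' ->
  (\forall x \ae mu, u x = u' x) -> (\forall x \ae mu, g x = g' x) ->
  distributional_poisson u g -> distributional_poisson u' g'.
Proof.
move=> m1 m2 m1' m2' uu gg ug phi tphi.
have mp := smooth_measurable tphi.1; have ml := smooth_measurable_laplacian tphi.1.
have mN : measurable_fun setT (fun x => - laplacian phi x) by exact: measurableT_comp.
have E (h h' q : X -> R) : measurable_fun setT h -> measurable_fun setT h' ->
    measurable_fun setT q -> (\forall x \ae mu, h x = h' x) ->
    \int[mu]_x (h x * q x) = \int[mu]_x (h' x * q x).
  move=> mh mh' mq hh; congr fine; apply: ae_eq_integral => //.
  - by apply/measurable_EFinP; exact: measurable_funM.
  - by apply/measurable_EFinP; exact: measurable_funM.
  - by apply: filterS hh => y -> _.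
by rewrite -(E _ _ _ m1 m1' mN uu) -(E _ _ _ m2 m2' mp gg); exact: ug.
Qed.

Lemma ae_cube (P : set X) : (forall k : nat, \forall x \ae mu, cube k%:R x -> P x) ->
  \forall x \ae mu, P x.
Proof.
move=> /ae_foralln; apply: filterS => x xP; apply: (xP (Num.truncn `|x|).+1).
by apply/cubeP => //; apply/ltW/truncnS_gt.
Qed.

Lemma ae_eq0_cube f : measurable_fun setT f ->
  (forall r e, 0 <= r -> 0 < e -> (\int[mu]_(x in cube r) `|f x|%:E <= e%:E)%E) ->
  \forall x \ae mu, f x = 0.
Proof.
move=> mf fe; apply: ae_cube => k.
have mfc : measurable_fun (cube k%:R) (EFin \o f).
  by apply/measurable_EFinP; exact: measurable_funTS.
have : ae_eq mu (cube k%:R) (EFin \o f) (cst 0%E).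
  apply/(ae_eq_integral_abs mu (measurable_cube k%:R) mfc).
  apply/eqP; rewrite eq_le; apply/andP; split; last exact: integral_ge0.
  by apply/lee_addgt0Pr => e e0; rewrite add0e; exact: fe.
by apply: filterS => x xP xk; have [] := xP xk.
Qed.

Lemma exists_mollifiers : exists rho : nat -> X -> R,
  (forall k, mollifier (rho k) (step k)) /\ forall k, smooth_kernel (rho k).
Proof.
have : forall k, exists rho : X -> R, mollifier rho (step k) /\ smooth_kernel rho.
  by move=> k; have [rho] := @exists_mollifier R n _ (step_gt0 k); exists rho.
by move=> /choice[rho h]; exists rho; split=> k; have [] := h k.
Qed.

(** The mollifications are at most 1, so the positive part of [u - 1] is bounded by
    [|convol (rho k) u - u|], whose integral over any cube becomes arbitrarily small. *)
Lemma weak_sol_le1 L u v : 0 <= L -> (forall x, 0 <= u x) ->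
  Lloc1 u -> Lloc1 (fun x => u x ^+ 3) -> Lloc1 (fun x => L * u x * v x ^+ 2) ->
  distributional_poisson u (fun x => reac L (u x) (v x)) -> \forall x \ae mu, u x <= 1.
Proof.
move=> L0 u0 lu lu3 luv up; have [rho [rM rS]] := exists_mollifiers.
have s0 k : 0 <= step k :> R by exact/ltW/step_gt0.
have [mu_ _] := lu.
pose f x := Num.max (u x - 1) 0.
have mf : measurable_fun setT f.
  by apply: measurable_maxr => //; exact: measurable_funB.
suff : \forall x \ae mu, f x = 0.
  apply: filterS => x fx; have : u x - 1 <= f x by rewrite le_max lexx.
  by rewrite fx; lra.
apply: ae_eq0_cube => // r e r0 e0.
have [k _ kP] := @convol_cvg_L1 R n rho rM r u e lu r0 e0.
apply: le_trans (kP k (leqnn k)).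
have w1 := convol_le1 (rM k) (rS k) (s0 k) L0 u0 lu lu3 luv up.
apply: ge0_le_integral => //.
- exact: measurable_cube.
- by apply/measurable_EFinP; apply: measurable_funTS; exact: measurableT_comp.
- apply/measurable_EFinP; apply: measurable_funTS; apply: measurableT_comp => //.
  by apply: measurable_funB => //; exact: measurable_convol (rM k) (s0 k) lu.
- move=> x _; have f0 : 0 <= f x by rewrite le_max lexx orbT.
  rewrite lee_fin (ger0_norm f0) /f ge_max normr_ge0 andbT.
  by have := w1 x; have := ler_norm (u x - convol (rho k) u x); rewrite distrC; lra.
Qed.

Lemma cvg_lipschitz_step K : K * step m @[m --> \oo] --> (0 : R).
Proof. by rewrite -(mulr0 K); apply: (@cvgMl_tmp _ _ _ _ _ K _ (@cvg_step R)). Qed.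

Lemma near_step K e : 0 < e -> \forall m \near \oo, K * step m <= e.
Proof.
move=> e0; have /cvgrPdist_le/(_ _ e0) := cvg_lipschitz_step K; apply: filterS => m.
by rewrite sub0r normrN; apply: le_trans; exact: ler_norm.
Qed.

(* equi-Lipschitz mollifications converge: [rho_m * u_j] is within [K step m] of [u_j],
   while it tends to [u_m] by the L^1 convergence of [u_j] *)
Lemma lipschitz_representative f K (rho : nat -> X -> R) : 0 <= K -> Lloc1 f ->
  (forall k, mollifier (rho k) (step k)) ->
  (forall k x y, `|convol (rho k) f x - convol (rho k) f y| <= K * `|x - y|) ->
  exists2 F : X -> R, forall x y, `|F x - F y| <= K * `|x - y| & \forall x \ae mu, f x = F x.
Proof.
move=> K0 lf rM wK; have s0 k : 0 <= step k :> R by exact/ltW/step_gt0.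
pose w k := convol (rho k) f.
have lw k : Lloc1 (w k).
  have cw : continuous (w k) by exact: continuous_lipschitz (wK k).
  split=> [|r]; first exact: continuous_measurable_rV.
  have mw : measurable_fun setT (w k) by exact: continuous_measurable_rV.
  apply: measurable_bounded_integrable.
  - exact: measurable_cube.
  - exact: lebesgue_measure_rV_cube.
  - exact: measurable_funTS.
  - exists (`|w k 0| + K * `|r|); split; first exact: num_real.
    move=> M KM x xr; apply: le_trans (ltW KM).
    have xr' : `|x| <= `|r|.
      apply/cubeP => // i; have := xr i; rewrite /= !in_itv/= => /andP[h1 h2].
      by have := ler_norm r; lra.
    have := wK k x 0; rewrite subr0 -/(w k x) -/(w k 0) => h.
    have := ler_normD (w k x - w k 0) (w k 0); rewrite subrK.
    have : K * `|x| <= K * `|r| by rewrite ler_wpM2l.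
    lra.
have mf : measurable_fun setT f by case: lf.
have mw k : measurable_fun setT (w k) by case: (lw k).
have key m x (d : R) : 0 < d -> \forall j \near \oo, `|w m x - w j x| <= K * step m + d.
  move=> d0; have [C C0 bC] := mollifier_supp x (rM m) (s0 m).
  have C1 : 0 < d / (C + 1) by rewrite divr_gt0// ltr_wpDl.
  have r0 : 0 <= `|x| + step m by rewrite addr_ge0.
  apply: filterS (@convol_cvg_L1 R n rho rM _ f _ lf r0 C1) => j jP.
  have h1 : `|convol (rho m) (w j) x - w j x| <= K * step m.
    apply: (convol_near (rM m) (s0 m) (lw j)) => y xy.
    by rewrite distrC (le_trans (wK j x y))// ler_wpM2l.
  have h2 : `|convol (rho m) (fun y => f y - w j y) x| <= d.
    rewrite -lee_fin; apply: le_trans (integral_mul_supp_le (Lloc1B lf (lw j)) bC) _.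
    apply: (@le_trans _ _ (C%:E * (d / (C + 1))%:E)%E).
      rewrite lee_wpmul2l ?lee_fin//; apply: le_trans jP.
      by rewrite le_eqVlt; apply/orP; left; apply/eqP; apply: eq_integral => y _; rewrite distrC.
    by rewrite -EFinM lee_fin mulrCA ger_pMr// ler_pdivrMr ?ltr_wpDl// mul1r lerDl.
  move: h2; rewrite (convolB x (rM m) (s0 m) lf (lw j)) -/(w m x) => h2.
  have -> : w m x - w j x = (w m x - convol (rho m) (w j) x) + (convol (rho m) (w j) x - w j x) by ring.
  by rewrite (le_trans (ler_normD _ _))// addrC lerD.
have cw x : cvgn (fun k => w k x).
  apply/cauchy_cvgP; apply: cauchy_exP => e e0; have e4 : 0 < e / 4 by rewrite divr_gt0.
  have [m _ mP] := near_step K e4; have h := mP m (leqnn m).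
  exists (w m x); apply: filterS (key m x _ e4) => j hj.
  by rewrite /ball/=; apply: le_lt_trans hj _; lra.
pose F x : R := limn (fun k => w k x).
have wF x : w k x @[k --> \oo] --> F x by exact: cw.
have wFs m x : `|w m x - F x| <= K * step m.
  apply/ler_addgt0Pr => d d0.
  have c : `|w m x - w j x| @[j --> \oo] --> `|w m x - F x|.
    by apply: cvg_norm; apply: cvgB; [exact: cvg_cst|exact: wF].
  exact: (cvgr_to_le c (key m x d d0)).
have FK x y : `|F x - F y| <= K * `|x - y|.
  have c : `|w k x - w k y| @[k --> \oo] --> `|F x - F y|.
    by apply: cvg_norm; apply: cvgB; exact: wF.
  by apply: (cvgr_to_le c); apply: nearW => k; exact: wK.
exists F => //.
have mF : measurable_fun setT F by exact: measurable_lipschitz FK.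
suff : \forall x \ae mu, f x - F x = 0 by apply: filterS => x /eqP; rewrite subr_eq0 => /eqP.
apply: ae_eq0_cube => [|r e r0 e0]; first exact: measurable_funB.
have e2 : 0 < e / 2 by rewrite divr_gt0.
pose c : R := fine (mu (cube r)).
have cE : mu (cube r) = c%:E by rewrite fineK// ge0_fin_numE// lebesgue_measure_rV_cube.
have c0 : 0 <= c by rewrite fine_ge0.
have [m _ mP] := filterI (near_step (K * c) e2) (@convol_cvg_L1 R n rho rM r f _ lf r0 e2).
have [h1 h2] := mP m (leqnn m).
have mc := @measurable_cube R n r.
have ma (g : X -> R) : measurable_fun setT g -> measurable_fun (@cube R n r) (fun x => `|g x|%:E).
  by move=> mg; apply/measurable_EFinP; apply: measurable_funTS; exact: measurableT_comp.
apply: (@le_trans _ _ (\int[mu]_(x in cube r) (`|w m x - f x|%:E + (K * step m)%:E))%E).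
  apply: ge0_le_integral => //.
  - by apply: ma; exact: measurable_funB.
  - by apply: emeasurable_funD => //; apply: ma; exact: measurable_funB.
  - move=> x _; rewrite -EFinD lee_fin distrC.
    have -> : F x - f x = (w m x - f x) + - (w m x - F x) by ring.
    by rewrite (le_trans (ler_normD _ _))// normrN lerD2l.
rewrite ge0_integralD//; last 2 first.
- by apply: ma; exact: measurable_funB.
- by move=> x _; rewrite lee_fin mulr_ge0.
have IC : (\int[mu]_(x in cube r) (K * step m)%:E = (K * step m)%:E * c%:E)%E.
  by rewrite integral_cst// -cE.
rewrite IC [leRHS](_ : _ = (e / 2)%:E + (e / 2)%:E)%E; last first.
  by rewrite -EFinD -splitr.
by rewrite leeD// -EFinM lee_fin mulrAC.
Qed.

Lemma measurable_reac L u v : measurable_fun setT u -> measurable_fun setT v ->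
  measurable_fun setT (fun x => reac L (u x) (v x)).
Proof.
move=> mu_ mv.
apply: measurable_funB; first by apply: measurable_funB => //; exact: measurable_funX.
by apply: measurable_funM; [exact: measurable_funM|exact: measurable_funX].
Qed.

Lemma reac_bound L a b : 0 <= L -> 0 <= a <= 1 -> 0 <= b <= 1 -> `|reac L a b| <= 1 + L.
Proof.
move=> L0 /andP[a0 a1] /andP[b0 b1]; rewrite /reac.
have h1 : 0 <= a - a ^+ 3 by rewrite subr_ge0 exprS ler_piMr// exprn_ile1.
have h2 : 0 <= a ^+ 3 by rewrite exprn_ge0.
have h3 : L * a * b ^+ 2 <= L.
  by rewrite -mulrA ler_piMr// mulr_ile1 ?exprn_ge0 ?exprn_ile1.
have h4 : 0 <= L * a * b ^+ 2 by rewrite mulr_ge0 ?exprn_ge0// mulr_ge0.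
rewrite ler_norml; lra.
Qed.

Lemma reac_lipschitz L a b a' b' (d : R) : 0 <= L -> 0 <= a <= 1 -> 0 <= b <= 1 ->
  0 <= a' <= 1 -> 0 <= b' <= 1 -> `|a - a'| <= d -> `|b - b'| <= d ->
  `|reac L a b - reac L a' b'| <= (4 + 3 * L) * d.
Proof.
move=> L0 /andP[a0 a1] /andP[b0 b1] /andP[a0' a1'] /andP[b0' b1'] ad bd.
have -> : reac L a b - reac L a' b' = (a - a') * (1 - (a ^+ 2 + a * a' + a' ^+ 2) - L * b ^+ 2)
  - (b - b') * (L * a' * (b + b')) by rewrite /reac; ring.
have d0 : 0 <= d by exact: le_trans ad.
have sq01 (t : R) : 0 <= t -> t <= 1 -> 0 <= t ^+ 2 <= 1 by move=> *; rewrite exprn_ge0// exprn_ile1.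
have /andP[p1 p2] := sq01 _ a0 a1; have /andP[p3 p4] := sq01 _ a0' a1'.
have /andP[p5 p6] := sq01 _ b0 b1.
have p7 : 0 <= a * a' <= 1 by rewrite mulr_ge0// mulr_ile1.
have p8 : 0 <= L * b ^+ 2 <= L by rewrite mulr_ge0//= ler_piMr.
have p9 : 0 <= L * a' * (b + b') <= L * 2.
  by rewrite !mulr_ge0 ?addr_ge0//= -mulrA ler_wpM2l//; nra.
move: p7 p8 p9 => /andP[p7 p7'] /andP[p8 p8'] /andP[p9 p9'].
apply: le_trans (ler_normB _ _) _; rewrite (normrM (a - a')) (normrM (b - b')).
have q1 : `|1 - (a ^+ 2 + a * a' + a' ^+ 2) - L * b ^+ 2| <= 4 + L by rewrite ler_norml; lra.
have q2 : `|L * a' * (b + b')| <= 2 * L by rewrite ger0_norm//; lra.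
rewrite (_ : (4 + 3 * L) * d = d * (4 + L) + d * (2 * L)); last by ring.
by apply: lerD; apply: ler_pM.
Qed.

(** The reaction is bounded by [1 + L], [lipschitz_axis] adds 1 to this bound, and passing from
    single axes to the sup norm costs the factor [n]. None of this depends on the mollifier. *)
Lemma bounded_sol_lipschitz L u v : 0 <= L -> measurable_fun setT u -> measurable_fun setT v ->
  (forall x, 0 <= u x <= 1) -> (forall x, 0 <= v x <= 1) ->
  distributional_poisson u (fun x => reac L (u x) (v x)) ->
  exists2 U : X -> R, forall x y, `|U x - U y| <= (2 + L) * n%:R * `|x - y| &
    \forall x \ae mu, u x = U x.
Proof.
move=> L0 mu_ mv u01 v01 up; have [rho [rM rS]] := exists_mollifiers.
have s0 k : 0 <= step k :> R by exact/ltW/step_gt0.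
have lu : Lloc1 u.
  by apply: (@Lloc1_bounded _ _ _ 1) => // x; have /andP[h1 h2] := u01 x; rewrite ger0_norm.
pose g x := reac L (u x) (v x).
have gL x : `|g x| <= 1 + L by exact: reac_bound.
have mg : measurable_fun setT g by exact: measurable_reac.
have lg : Lloc1 g by exact: Lloc1_bounded gL.
apply: (@lipschitz_representative _ _ rho) => // [|k x y].
  by rewrite mulr_ge0// addr_ge0.
apply: (@lipschitz_norm R n); first by rewrite addr_ge0.
move=> i z t; rewrite (_ : 2 + L = (1 + L) + 1); last by ring.
apply: (@lipschitz_axis R n _ (fun x => - convol (rho k) g x)) => //.
- exact: continuous_convol (rM k) (s0 k) lu.
- exact: haslap_convol (rM k) (rS k) (s0 k) lu up.
- move=> {}x; apply/andP; split.
    by apply: Rintegral_ge0 => y' _; have [r0 _ _ _ _] := rM k; have /andP[h _] := u01 y'; rewrite mulr_ge0.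
  have := @convol_near _ _ _ _ _ x (1 / 2) (1 / 2) (rM k) (s0 k) lu.
  rewrite ler_norml => H; have /andP[_] : - (1 / 2) <= convol (rho k) u x - 1 / 2 <= 1 / 2.
    by apply: H => y' _; have := u01 y'; rewrite ler_norml; lra.
  lra.
- move=> {}x; rewrite normrN -[convol _ _ _]subr0.
  by apply: (convol_near (rM k) (s0 k) lg) => y' _; rewrite subr0.
Qed.

(** Mollifications of [U] and of the reaction serve as the approximations: both functions are
    Lipschitz, so mollifying at radius [step m] moves them uniformly by at most a multiple of
    [step m]. *)
Lemma wlap_lipschitz_sol L K U V : 0 <= L -> 0 <= K ->
  (forall x, 0 <= U x <= 1) -> (forall x, 0 <= V x <= 1) ->
  (forall x y, `|U x - U y| <= K * `|x - y|) -> (forall x y, `|V x - V y| <= K * `|x - y|) ->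
  distributional_poisson U (fun x => reac L (U x) (V x)) ->
  wlap U (fun x => - reac L (U x) (V x)).
Proof.
move=> L0 K0 U01 V01 UK VK up e e0; have [rho [rM rS]] := exists_mollifiers.
have s0 k : 0 <= step k :> R by exact/ltW/step_gt0.
have mU := measurable_lipschitz UK; have mV := measurable_lipschitz VK.
have lU : Lloc1 U.
  by apply: (@Lloc1_bounded _ _ _ 1) => // x; have /andP[h1 h2] := U01 x; rewrite ger0_norm.
pose g x := reac L (U x) (V x).
have gL x : `|g x| <= 1 + L by exact: reac_bound.
have mg : measurable_fun setT g by exact: measurable_reac.
have lg : Lloc1 g by exact: Lloc1_bounded gL.
have [m _ mP] := filterI (near_step K e0) (near_step ((4 + 3 * L) * K) e0).
have [h1 h2] := mP m (leqnn m).
exists (convol (rho m) U), (fun x => - convol (rho m) g x); split.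
- exact: continuous_convol (rM m) (s0 m) lU.
- exact: haslap_convol (rM m) (rS m) (s0 m) lU up.
- move=> x; rewrite distrC (le_trans _ h1)//.
  apply: (convol_near (rM m) (s0 m) lU) => y xy.
  by rewrite distrC (le_trans (UK x y))// ler_wpM2l.
- move=> x; rewrite -opprD normrN distrC (le_trans _ h2)//.
  apply: (convol_near (rM m) (s0 m) lg) => y xy; rewrite distrC -mulrA.
  by apply: reac_lipschitz => //; [rewrite (le_trans (UK x y))|rewrite (le_trans (VK x y))];
    rewrite ?ler_wpM2l.
Qed.

End weak_solutions.

Section representatives.
Context {R : realType} {n : nat}.
Local Notation X := 'rV[R]_n.
Local Notation mu := (@lebesgue_measure_rV R n).
Implicit Types (u v U V : X -> R) (x : X) (L : R).

Lemma reac_sol_ae L u v u' v' : measurable_fun setT u -> measurable_fun setT v ->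
  measurable_fun setT u' -> measurable_fun setT v' ->
  (\forall x \ae mu, u x = u' x) -> (\forall x \ae mu, v x = v' x) ->
  distributional_poisson u (fun x => reac L (u x) (v x)) ->
  distributional_poisson u' (fun x => reac L (u' x) (v' x)).
Proof.
move=> mu_ mv mu' mv' uu vv; apply: distributional_poisson_ae => //; try exact: measurable_reac.
by apply: filterS2 uu vv => x -> ->.
Qed.

(** Local integrability of the cubes controls every term of the system: for nonnegative values
    [u <= 1 + u ^+ 3] and [u * v ^+ 2 <= u ^+ 3 + v ^+ 3]. *)
Lemma Lloc1_cubic L u v : measurable_fun setT u -> measurable_fun setT v ->
  (forall x, 0 <= u x) -> (forall x, 0 <= v x) ->
  Lloc1 (fun x => u x ^+ 3) -> Lloc1 (fun x => v x ^+ 3) ->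
  Lloc1 u /\ Lloc1 (fun x => L * u x * v x ^+ 2).
Proof.
move=> mu_ mv u0 v0 lu lv.
have l1 : Lloc1 (fun _ : X => 1 : R) by apply: (@Lloc1_bounded _ _ _ 1) => // x; rewrite normr1.
have u3 x : 0 <= u x ^+ 3 by rewrite exprn_ge0.
have v3 x : 0 <= v x ^+ 3 by rewrite exprn_ge0.
split.
  apply: (Lloc1_le mu_ (Lloc1D l1 lu)) => x; rewrite !ger0_norm ?addr_ge0//.
  have [u1|u1] := leP (u x) 1; first by have := u3 x; lra.
  suff : u x <= u x ^+ 3 by lra.
  by rewrite exprS ler_peMr// exprn_ege1// ltW.
apply: (Lloc1_le _ (Lloc1Z L (Lloc1D lu lv))) => [|x].
  by apply: measurable_funM; [exact: measurable_funM|exact: measurable_funX].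
rewrite -mulrA !normrM ler_wpM2l// !ger0_norm ?mulr_ge0 ?sqr_ge0 ?addr_ge0//.
have [uv|vu] := leP (u x) (v x).
  suff : u x * v x ^+ 2 <= v x ^+ 3 by have := u3 x; lra.
  by rewrite [leRHS]exprS ler_wpM2r// sqr_ge0.
suff : u x * v x ^+ 2 <= u x ^+ 3 by have := v3 x; lra.
by rewrite [leRHS]exprS ler_wpM2l// ler_sqr ?nnegrE// ltW.
Qed.

Lemma ae_unit_interval u U : continuous U -> (forall x, 0 <= u x <= 1) ->
  (\forall x \ae mu, u x = U x) -> forall x, 0 <= U x <= 1.
Proof.
move=> cU u01 uU; apply: (@ae_closed R n [set x | 0 <= U x <= 1]).
  rewrite (_ : mkset _ = U @^-1` `[0, 1]%classic); last by apply/seteqP; split=> x; rewrite /= in_itv.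
  by apply: closed_comp => [x _|]; [exact: cU|exact: itv_closed].
by apply: filterS uU => x /= <-.
Qed.

End representatives.

(** * Continuous representatives as transition layers *)

Section limits.
Context {R : realType} {n : nat}.
Local Notation X := 'rV[R]_n.+1.
Local Notation mu := (@lebesgue_measure_rV R n.+1).
Implicit Types (u U : X -> R) (x : X) (l e : R).

Let continuous_dist l : continuous (fun t : R => `|t - l|).
Proof. by move=> t; apply: cvg_norm; apply: cvgB; [exact: cvg_id|exact: cvg_cst]. Qed.

(** The union of the half-space [x_N <= M + 1] with the set where [|U - l| <= e] is closed and of
    full measure, hence it is the whole space. *)
Lemma unif_cvg_pinfty_repr u U l e : continuous U -> (\forall x \ae mu, u x = U x) ->
  unif_cvg_pinfty u l -> 0 < e -> exists M : R, forall x, M < last_coord x -> `|U x - l| <= e.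
Proof.
move=> cU uU ul e0; have [M [_ MP]] := ul e e0.
have M1 : M < M + 1 by rewrite ltrDl.
exists (M + 1) => x xM.
have cn : continuous (fun y => `|U y - l|) by exact: (continuous_compose cU (@continuous_dist l)).
have cl : closed ([set y : X | last_coord y <= M + 1] `|` [set y : X | `|U y - l| <= e]).
  apply: closedU.
    apply: (@closed_comp _ _ (@last_coord R n) [set t | t <= M + 1]); last exact: closed_le.
    by move=> y _; exact: continuous_last_coord.
  apply: (@closed_comp _ _ (fun y => `|U y - l|) [set t | t <= e]); last exact: closed_le.
  by move=> y _; exact: cn.
have := ae_closed cl _ x; case=> //; last by rewrite /= leNgt xM.
apply: filterS2 uU (MP _ M1) => y uy yP; have [yM|yM] := leP (last_coord y) (M + 1); first by left.
by right; rewrite /= -uy ltW// yP.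
Qed.

Lemma unif_cvg_ninfty_repr u U l e : continuous U -> (\forall x \ae mu, u x = U x) ->
  unif_cvg_ninfty u l -> 0 < e -> exists M : R, forall x, last_coord x < M -> `|U x - l| <= e.
Proof.
move=> cU uU ul e0; have [M [_ MP]] := ul e e0.
have M1 : M - 1 < M by rewrite ltrBlDr ltrDl.
exists (M - 1) => x xM.
have cn : continuous (fun y => `|U y - l|) by exact: (continuous_compose cU (@continuous_dist l)).
have cl : closed ([set y : X | M - 1 <= last_coord y] `|` [set y : X | `|U y - l| <= e]).
  apply: closedU.
    apply: (@closed_comp _ _ (@last_coord R n) [set t | M - 1 <= t]); last exact: closed_ge.
    by move=> y _; exact: continuous_last_coord.
  apply: (@closed_comp _ _ (fun y => `|U y - l|) [set t | t <= e]); last exact: closed_le.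
  by move=> y _; exact: cn.
have := ae_closed cl _ x; case=> //; last by rewrite /= leNgt xM.
apply: filterS2 uU (MP _ M1) => y uy yP; have [yM|yM] := leP (M - 1) (last_coord y); first by left.
by right; rewrite /= -uy ltW// yP.
Qed.

Lemma weak_sol_transition_layer (L : R) (u v : X -> R) : 1 < L ->
  Lloc 3 u -> Lloc 3 v ->
  distributional_poisson u (fun x => u x - u x ^+ 3 - L * u x * v x ^+ 2) ->
  distributional_poisson v (fun x => v x - v x ^+ 3 - L * u x ^+ 2 * v x) ->
  (\forall x \ae mu, 0 <= u x) -> (\forall x \ae mu, 0 <= v x) ->
  unif_cvg_pinfty u 1 -> unif_cvg_pinfty v 0 ->
  unif_cvg_ninfty u 0 -> unif_cvg_ninfty v 1 ->
  exists U V K, [/\ (\forall x \ae mu, u x = U x), (\forall x \ae mu, v x = V x) &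
    transition_layer L K U V].
Proof.
move=> L1 lu lv pu pv u0 v0 up vp un vn; have L0 : 0 <= L by lra.
have [mu_ _] := lu; have [mv _] := lv.
have {}pv : distributional_poisson v (fun x => reac L (v x) (u x)).
  move=> phi /pv ->; apply: eq_Rintegral => x _; congr (_ * _); rewrite /reac; ring.
(* Signs are known almost everywhere only, while the bounds above assume them at every point. The
   positive part is a version of [w] with the sign everywhere. *)
pose pos (w : X -> R) x := Num.max (w x) 0.
have posm w : measurable_fun setT w -> measurable_fun setT (pos w).
  by move=> mw; apply: measurable_maxr.
have pos0 w x : 0 <= pos w x by rewrite le_max lexx orbT.
have posE w : (\forall x \ae mu, 0 <= w x) -> \forall x \ae mu, w x = pos w x.
  by apply: filterS => x wx; rewrite /pos max_l.
have pos3 w : Lloc 3 w -> Lloc1 (fun x => pos w x ^+ 3).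
  move=> lw; apply: (Lloc1_le _ (Lloc_Lloc1 lw)) => [|x].
    by apply: measurable_funX; apply: posm; case: lw.
  rewrite !normrX lerXn2r ?nnegrE// ger0_norm// /pos ge_max normr_ge0 andbT; exact: ler_norm.
(* Truncating the positive part at 1 gives a version with values in [[0, 1]]. Stated for a generic
   ordered pair, this serves both equations. *)
have bounded (a b : X -> R) : Lloc 3 a -> Lloc 3 b ->
    (\forall x \ae mu, 0 <= a x) -> (\forall x \ae mu, 0 <= b x) ->
    distributional_poisson a (fun x => reac L (a x) (b x)) ->
    exists2 a' : X -> R, measurable_fun setT a' /\ (forall x, 0 <= a' x <= 1) &
      \forall x \ae mu, a x = a' x.
  move=> la lb a0 b0 pa; have [ma _] := la; have [mb _] := lb.
  have pa' := reac_sol_ae ma mb (posm _ ma) (posm _ mb) (posE _ a0) (posE _ b0) pa.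
  have [l1 l2] := Lloc1_cubic L (posm _ ma) (posm _ mb) (pos0 a) (pos0 b) (pos3 _ la) (pos3 _ lb).
  have a1 := weak_sol_le1 L0 (pos0 a) l1 (pos3 _ la) l2 pa'.
  exists (fun x => Num.min (pos a x) 1).
    split; first by apply: measurable_minr => //; exact: posm.
    by move=> x; rewrite le_min pos0 ler01 ge_min lexx orbT.
  by apply: filterS2 (posE _ a0) a1 => x ax1 ax2; rewrite min_l.
have [a [ma a01] ua] := bounded _ _ lu lv u0 v0 pu.
have [b [mb b01] vb] := bounded _ _ lv lu v0 u0 pv.
have pa := reac_sol_ae mu_ mv ma mb ua vb pu.
have pb := reac_sol_ae mv mu_ mb ma vb ua pv.
have [U UK aU] := bounded_sol_lipschitz L0 ma mb a01 b01 pa.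
have [V VK bV] := bounded_sol_lipschitz L0 mb ma b01 a01 pb.
have mU := measurable_lipschitz UK; have mV := measurable_lipschitz VK.
have cU := continuous_lipschitz UK; have cV := continuous_lipschitz VK.
have pU := reac_sol_ae ma mb mU mV aU bV pa.
have pV := reac_sol_ae mb ma mV mU bV aU pb.
have U01 := ae_unit_interval cU a01 aU; have V01 := ae_unit_interval cV b01 bV.
have uU : \forall x \ae mu, u x = U x by apply: filterS2 ua aU => x -> ->.
have vV : \forall x \ae mu, v x = V x by apply: filterS2 vb bV => x -> ->.
have K0 : 0 < (2 + L) * n.+1%:R by rewrite mulr_gt0//; lra.
exists U, V, ((2 + L) * n.+1%:R); split=> //; split=> //.
  by split=> //; apply: wlap_lipschitz_sol (ltW K0) _ _ UK VK _ || apply: wlap_lipschitz_sol (ltW K0) _ _ VK UK _.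
move=> e e0.
have [M1 H1] := unif_cvg_pinfty_repr cU uU up e0.
have [M2 H2] := unif_cvg_pinfty_repr cV vV vp e0.
have [M3 H3] := unif_cvg_ninfty_repr cU uU un e0.
have [M4 H4] := unif_cvg_ninfty_repr cV vV vn e0.
(* One threshold for all four limits; the [+ 1] turns its large inequalities into the strict ones
   they require. *)
exists (`|M1| + `|M2| + `|M3| + `|M4| + 1) => x.
have n1 := ler_norm M1; have n2 := ler_norm M2; have n3 := ler_norm (- M3); have n4 := ler_norm (- M4).
rewrite normrN in n3; rewrite normrN in n4.
have p1 := normr_ge0 M1; have p2 := normr_ge0 M2; have p3 := normr_ge0 M3; have p4 := normr_ge0 M4.
split=> xM.
  have := H1 x; have := H2 x; rewrite !ler_norml => h2 h1.
  have /andP[h1' _] : - e <= U x - 1 <= e by apply: h1; lra.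
  have /andP[_ h2'] : - e <= V x - 0 <= e by apply: h2; lra.
  lra.
have := H3 x; have := H4 x; rewrite !ler_norml => h2 h1.
have /andP[_ h1'] : - e <= U x - 0 <= e by apply: h1; lra.
have /andP[h2' _] : - e <= V x - 1 <= e by apply: h2; lra.
lra.
Qed.

End limits.

(* The dimension is N = n.+1, and x_N is the coordinate of index ord_max. *)
Theorem theorem1p1 (R : realType) (n : nat) (Lambda : R)
    (u v : 'rV[R]_n.+1 -> R) :
  1 < Lambda ->
  Lloc 3 u -> Lloc 3 v ->
  distributional_poisson u
    (fun x => u x - u x ^+ 3 - Lambda * u x * v x ^+ 2) ->
  distributional_poisson v
    (fun x => v x - v x ^+ 3 - Lambda * u x ^+ 2 * v x) ->
  (\forall x \ae lebesgue_measure_rV, 0 <= u x) ->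
  (\forall x \ae lebesgue_measure_rV, 0 <= v x) ->
  unif_cvg_pinfty u 1 -> unif_cvg_pinfty v 0 ->
  unif_cvg_ninfty u 0 -> unif_cvg_ninfty v 1 ->
  exists U V : 'rV[R]_n.+1 -> R,
    [/\ (\forall x \ae lebesgue_measure_rV, u x = U x),
        (\forall x \ae lebesgue_measure_rV, v x = V x),
        smooth U /\ smooth V,
        depends_only_on_last U /\ depends_only_on_last V &
        forall x, 0 < partial ord_max U x /\ partial ord_max V x < 0].
Proof.
move=> L1 lu lv pu pv u0 v0 up vp un vn.
have [U [V [K [uU vV /transition_layer_smooth_monotone[sUV dUV mUV]]]]] :=
  weak_sol_transition_layer L1 lu lv pu pv u0 v0 up vp un vn.
by exists U, V.
Qed.
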